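(* Let $p>0$ and $\alpha\ge -1$. Suppose that $f$ is a conformal mapping on the unit disk $\mathbb{D}$ and, for $r>0$, set $U_r=\{z\in\mathbb{D}: |f(z)|>r\}$. Then $f\in A_\alpha^p(\mathbb{D})$ if and only if $$\int_0^\infty r^{p-1}\,\mathrm{area}(U_r)^{\frac{\alpha+2}{2}}\,dr<\infty .$$
   Context: A conformal mapping on $\mathbb{D}$ is an injective holomorphic function $f:\mathbb{D}\to\mathbb{C}$. For $p>0$, $\alpha>-1$, the weighted Bergman space $A_\alpha^p(\mathbb{D})$ is the set of holomorphic $f$ on $\mathbb{D}$ with $\int_{\mathbb{D}}|f(z)|^p(1-|z|^2)^\alpha\,dA(z)<\infty$, where $dA$ is Lebesgue area measure. The Hardy space $H^p(\mathbb{D})$ is the set of holomorphic $f$ on $\mathbb{D}$ with $\sup_{0<r<1}\int_0^{2\pi}|f(re^{it})|^p\,dt<\infty$. Convention: $A_{-1}^p(\mathbb{D})=H^p(\mathbb{D})$. $\mathrm{area}$ denotes Euclidean (Lebesgue) area. *)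

(* Defs.v *)
From HB Require Import structures.
From mathcomp Require Import all_boot all_order all_algebra.
From mathcomp Require Import all_classical all_reals all_analysis.
From mathcomp Require Import complex.
Set Implicit Arguments.
Unset Strict Implicit.
Unset Printing Implicit Defensive.
Import Order.TTheory GRing.Theory Num.Theory.
Import numFieldNormedType.Exports.
Local Open Scope classical_set_scope.
Local Open Scope ring_scope.
Local Open Scope complex_scope.

(* Moduli are taken with Normc.normc, which is R-valued; the norm `|z| of R[i]
   lives in R[i]. *)

Definition unit_disk (R : realType) : set R[i] := [set z | Normc.normc z < 1].
Arguments unit_disk : clear implicits.

(* Complex differentiability is derivability over the field R[i], in the
   direction 1; the normed-module structure over R[i] is carried by R[i]^o.
   Functions are total, and only their values on the disk matter. *)
Definition holomorphic_disk (R : realType) (f : R[i] -> R[i]) : Prop :=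
  forall z, unit_disk R z -> derivable (f : R[i]^o -> R[i]^o) z 1.

Definition conformal_disk (R : realType) (f : R[i] -> R[i]) : Prop :=
  holomorphic_disk f /\ set_inj (unit_disk R) f.

Definition to_complex (R : realType) (w : R * R) : R[i] := w.1 +i* w.2.

Definition lebesgue2 (R : realType) :=
  (@lebesgue_measure R \x @lebesgue_measure R)%E.
Arguments lebesgue2 : clear implicits.

Definition area (R : realType) (A : set R[i]) : \bar R :=
  lebesgue2 R (@to_complex R @^-1` A).

Definition bergman (R : realType) (p alpha : R) : set (R[i] -> R[i]) :=
  [set f | holomorphic_disk f /\
    (\int[lebesgue2 R]_(w in @to_complex R @^-1` unit_disk R)
       (Normc.normc (f (to_complex w)) `^ p
        * (1 - Normc.normc (to_complex w) ^+ 2) `^ alpha)%:E < +oo)%E].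

Definition hardy (R : realType) (p : R) : set (R[i] -> R[i]) :=
  [set f | holomorphic_disk f /\
    (ereal_sup [set \int[lebesgue_measure]_(t in `[0%R, (2 * pi)%R])
       (Normc.normc (f ((r * cos t) +i* (r * sin t))) `^ p)%:E
       | r in `]0%R, 1%R[] < +oo)%E].

(* A^p_alpha for alpha >= -1, with the convention A^p_{-1} = H^p. *)
Definition bergman_hardy (R : realType) (p alpha : R) : set (R[i] -> R[i]) :=
  if alpha == -1 then hardy p else bergman p alpha.

Definition superlevel (R : realType) (f : R[i] -> R[i]) (r : R) : set R[i] :=
  [set z | unit_disk R z /\ r < Normc.normc (f z)].

(* Main.v *)
From HB Require Import structures.
Require Import Defs.
From mathcomp Require Import all_boot all_order all_algebra.
From mathcomp Require Import all_classical all_reals all_analysis.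
From mathcomp Require Import complex measurable_realfun.
From mathcomp Require Import ring lra.
Import Order.TTheory GRing.Theory Num.Theory.
Import numFieldNormedType.Exports.
Local Open Scope classical_set_scope.
Local Open Scope ring_scope.
Local Open Scope complex_scope.
Set Implicit Arguments.
Unset Strict Implicit.
Unset Printing Implicit Defensive.

(* For large r let X r be the supremum of -ln |z| over the z with |f z| > r. For
   every alpha > -1 the weighted area of {|f| > c r} is comparable, from above and
   below and up to universal constants c, to (X r)^(alpha + 2), and the same holds
   with exponent 1 for the length of {|f| > c r} on a circle of radius close to 1.
   By the layer cake formula, each of the three integrals is therefore finite
   exactly when r^(p - 1) (X r)^(alpha + 2) is integrable at infinity.

   Both comparisons are statements on the univalent function h = f o exp in the
   left half-plane and rest on the length-area principle: the horizontal (or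
   vertical) segments of a rectangle along which |h| passes from tau to 2^k tau
   have total measure at most C/k times their length, since the h-image of a
   univalent function at level 2^l tau has area at most C (2^l tau)^2. The upper
   bound applies it with k = 1 between the circle -ln |z| = 2 X r, where |f| <= r,
   and the circle considered. For the lower bound, a point with |h| > r at distance
   e from the imaginary axis is surrounded by a rectangle of size e; the maximum
   principle yields on it a point where |h| is comparable to r, and with k large
   most segments of length e issuing from there keep |h| comparable to r. *)

(** * Goursat's theorem on rectangles *)

Section integrals.
Variable R : realType.
Local Notation leb := (@lebesgue_measure R).

(** All estimates are needed only up to universal constants, and this decides which function theory
    is developed. In place of Cauchy's formula stands Goursat's theorem with a positive lower bound
    for the winding integral; it gives a maximum principle with a non-sharp constant, and from it
    Cauchy and Taylor estimates. Likewise the area of an image is not computed by a Jacobian: on a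
    fine grid every small square whose derivative is not too small covers a box, injectivity makes
    the boxes disjoint, and Cauchy-Schwarz is applied to finite sums. The factor 1/k of the
    length-area principle comes from using k dyadic levels at once. Each level has normalised area
    O(1), so all levels together cost O(k), while a segment crossing all of them costs a multiple of
    k^2 divided by the number of its cells, because the levels share these cells. The obstacle in
    the Hardy case is that the lower bound for arcs holds only on circles at most half as deep as
    the point where |f| is large, hence a truncated depth and a monotone limit. *)

Definition RI (a b : R) (f : R -> R) : R := (\int[leb]_(x in `[a, b]) f x)%R.
(** Continuity is two-sided also at the end points: the integrands come from functions that are
    continuous in the plane at these points, and restriction to subintervals is then immediate. *)
Definition cts (a b : R) (f : R -> R) := forall x, a <= x <= b -> {for x, continuous f}.

Lemma cts_within a b f : cts a b f -> {within `[a, b], continuous f}.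
Proof.
move=> cf; apply: continuous_in_subspaceT => x; rewrite inE/= in_itv/= => xab.
exact: cf.
Qed.

Lemma cts_sub a b a' b' f : a <= a' -> b' <= b -> cts a b f -> cts a' b' f.
Proof.
move=> aa bb cf x /andP[h1 h2]; apply: cf.
by rewrite (le_trans aa h1) (le_trans h2 bb).
Qed.

Lemma cts_integrable a b f : cts a b f -> leb.-integrable `[a, b] (EFin \o f).
Proof.
move=> cf; apply: continuous_compact_integrable; first exact: segment_compact.
exact: cts_within.
Qed.

Lemma RI_split a m b f : a <= m -> m <= b -> cts a b f ->
  RI a b f = RI a m f + RI m b f.
Proof.
move=> am mb cf; apply/eqP; rewrite addrC -subr_eq; apply/eqP.
rewrite /RI Rintegral_itvB.
- rewrite Rintegral_itv_obnd_cbnd//.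
  have := cts_integrable (cts_sub am (lexx b) cf).
  apply: integrableS => //.
  by apply: subset_itvr; rewrite bnd_simp.
- exact: cts_integrable.
- by rewrite bnd_simp.
- by rewrite bnd_simp.
Qed.

Lemma RID a b f g : cts a b f -> cts a b g ->
  RI a b (fun x => f x + g x) = RI a b f + RI a b g.
Proof. by move=> cf cg; rewrite /RI RintegralD//; exact: cts_integrable. Qed.

Lemma RIZ a b f k : cts a b f -> RI a b (fun x => k * f x) = k * RI a b f.
Proof. by move=> cf; rewrite /RI RintegralZl//; exact: cts_integrable. Qed.

Lemma RI_cst a b k : a <= b -> RI a b (fun=> k) = k * (b - a).
Proof.
move=> ab; rewrite /RI Rintegral_cst//= lebesgue_measure_itv/= lte_fin.
case: ltP => //= ba; have -> : a = b by apply/eqP; rewrite eq_le ab ba.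
by rewrite subrr.
Qed.

Lemma RI_le a b f g : cts a b f -> cts a b g ->
  (forall x, a <= x <= b -> f x <= g x) -> RI a b f <= RI a b g.
Proof.
move=> cf cg fg; apply: le_Rintegral => //; try exact: cts_integrable.
Qed.

Lemma RI_bound a b f M : a <= b -> cts a b f ->
  (forall x, a <= x <= b -> `|f x| <= M) -> `|RI a b f| <= M * (b - a).
Proof.
move=> ab cf fM; rewrite -RI_cst// ler_norml; apply/andP; split.
  rewrite -mulN1r -RIZ; last by move=> ? _; exact: cst_continuous.
  apply: RI_le => //; first by move=> ? _; exact: cst_continuous.
  by move=> x xab; rewrite mulN1r lerNl (le_trans (ler_norm _))// normrN fM.
apply: RI_le => //; first by move=> ? _; exact: cst_continuous.
by move=> x xab; rewrite (le_trans (ler_norm _))// fM.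
Qed.

End integrals.

Section goursat.
Variable R : realType.
Local Notation N := (@Normc.normc R).
Local Notation C := R[i].
Local Notation Re := (@complex.Re R).
Local Notation Im := (@complex.Im R).

Lemma N_ge0 (z : C) : 0 <= N z.
Proof. by case: z => x y; exact: sqrtr_ge0. Qed.
Lemma N0 : N 0 = 0. Proof. exact: Normc.normc0. Qed.
Lemma N1 : N 1 = 1. Proof. exact: Normc.normc1. Qed.
Lemma N_eq0 (z : C) : N z = 0 -> z = 0. Proof. exact: Normc.eq0_normc. Qed.
Lemma N_gt0 (z : C) : z != 0 -> 0 < N z.
Proof. by move=> z0; rewrite lt_neqAle N_ge0 andbT eq_sym; apply: contra_neq z0; exact: N_eq0. Qed.
Lemma NM (z w : C) : N (z * w) = N z * N w. Proof. exact: Normc.normcM. Qed.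
Lemma NV (z : C) : N z^-1 = (N z)^-1. Proof. exact: Normc.normcV. Qed.
Lemma ND (z w : C) : N (z + w) <= N z + N w. Proof. exact: le_normcD. Qed.
Lemma NN (z : C) : N (- z) = N z. Proof. exact: normcN. Qed.
Lemma NB (z w : C) : N (z - w) <= N z + N w. Proof. by rewrite -(NN w) ND. Qed.
Lemma NC (z w : C) : N (z - w) = N (w - z). Proof. by rewrite -NN opprB. Qed.
Lemma NBr (z w : C) : N z - N w <= N (z - w).
Proof. by rewrite lerBlDr -{1}(subrK w z) ND. Qed.
Lemma N_Re (z : C) : `|Re z| <= N z.
Proof.
case: z => x y /=; rewrite -sqrtr_sqr ler_sqrt ?addr_ge0 ?sqr_ge0//.
by rewrite lerDl sqr_ge0.
Qed.
Lemma N_Im (z : C) : `|Im z| <= N z.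
Proof.
case: z => x y /=; rewrite -sqrtr_sqr ler_sqrt ?addr_ge0 ?sqr_ge0//.
by rewrite lerDr sqr_ge0.
Qed.
Lemma N_le (z : C) : N z <= `|Re z| + `|Im z|.
Proof.
case: z => x y /=; have s0 : 0 <= `|x| + `|y| by rewrite addr_ge0.
rewrite -(ger0_norm s0) -sqrtr_sqr ler_wsqrtr// sqrrD !real_normK ?num_real//.
by rewrite addrAC lerDl mulrn_wge0// mulr_ge0.
Qed.
Lemma N_real (x : R) : N (x%:C) = `|x|.
Proof. by rewrite /= expr0n addr0 sqrtr_sqr. Qed.
Lemma N_dist (x y x' y' : R) : N ((x +i* y) - (x' +i* y')) <= `|x - x'| + `|y - y'|.
Proof. exact: (le_trans (N_le _)). Qed.

Definition ccont (g : C -> C) z := forall e : R, 0 < e -> exists2 t : R, 0 < t &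
  forall w, N (w - z) < t -> N (g w - g z) < e.
(** A first-order expansion with real error constants. The division-free form also makes sense at
    [w = z]; [cdiff_cderiv] converts the difference quotients of [derivable] into it. *)
Definition cderiv (g : C -> C) z (l : C) := forall e : R, 0 < e -> exists2 t : R, 0 < t &
  forall w, N (w - z) < t -> N (g w - g z - l * (w - z)) <= e * N (w - z).

Lemma cderiv_cont g z l : cderiv g z l -> ccont g z.
Proof.
move=> gl e e0; have [t t0 ht] := gl 1 ltr01.
have K0 : 0 < 1 + N l by rewrite ltr_pwDl// N_ge0.
exists (Num.min t (e / (1 + N l))); first by rewrite lt_min t0 divr_gt0.
move=> w; rewrite lt_min => /andP[/ht h1 h2].
rewrite -(subrK (l * (w - z)) (g w - g z)) (le_lt_trans (ND _ _))//.
rewrite (@le_lt_trans _ _ ((1 + N l) * N (w - z)))//.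
  by rewrite mulrDl lerD// NM.
by rewrite mulrC -ltr_pdivlMr.
Qed.

Lemma ccont_ex (g : C -> C) x y (F : C -> R) :
  (forall z w, `|F z - F w| <= N (z - w)) -> ccont g (x +i* y) ->
  {for x, continuous (fun t => F (g (t +i* y)))} /\
  {for y, continuous (fun t => F (g (x +i* t)))}.
Proof.
move=> FL gc; split; apply/cvgrPdist_lt => e e0; have [t t0 ht] := gc e e0.
- near=> u; rewrite (le_lt_trans (FL _ _))// NC ht//.
  rewrite (le_lt_trans (N_dist _ _ _ _))// subrr normr0 addr0.
  near: u; apply: cvgr_distC_lt => //; exact: cvg_id.
- near=> u; rewrite (le_lt_trans (FL _ _))// NC ht//.
  rewrite (le_lt_trans (N_dist _ _ _ _))// subrr normr0 add0r.
  near: u; apply: cvgr_distC_lt => //; exact: cvg_id.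
Unshelve. all: by end_near. Qed.

Lemma Re_lip (z w : C) : `|Re z - Re w| <= N (z - w).
Proof. by have := N_Re (z - w); case: z w => [? ?] [? ?]. Qed.
Lemma Im_lip (z w : C) : `|Im z - Im w| <= N (z - w).
Proof. by have := N_Im (z - w); case: z w => [? ?] [? ?]. Qed.

Definition rect (a b c d : R) (z : C) := a <= Re z <= b /\ c <= Im z <= d.

(** The real part of the counterclockwise contour integral of [g] along the rectangle. One part
    suffices, since the other is reached by multiplying [g] by [- 'i]. *)
Definition bnd (g : C -> C) (a b c d : R) : R :=
  RI a b (fun x => Re (g (x +i* c))) - RI a b (fun x => Re (g (x +i* d)))
  - RI c d (fun y => Im (g (b +i* y))) + RI c d (fun y => Im (g (a +i* y))).

Definition ctsr g a b c d := forall z, rect a b c d z -> ccont g z.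

Definition bdry (a b c d : R) (z : C) := rect a b c d z /\
  (Re z = a \/ Re z = b \/ Im z = c \/ Im z = d).
Definition ctsb g a b c d := forall z, bdry a b c d z -> ccont g z.

Lemma ctsr_b g a b c d : ctsr g a b c d -> ctsb g a b c d.
Proof. by move=> cg z [/cg]. Qed.

Lemma bdry_bot a b c d x : c <= d -> a <= x <= b -> bdry a b c d (x +i* c).
Proof. by move=> cd xab; split; [split; rewrite //= lexx cd|do 2 right; left]. Qed.
Lemma bdry_top a b c d x : c <= d -> a <= x <= b -> bdry a b c d (x +i* d).
Proof. by move=> cd xab; split; [split; rewrite //= lexx cd|do 3 right]. Qed.
Lemma bdry_left a b c d y : a <= b -> c <= y <= d -> bdry a b c d (a +i* y).
Proof. by move=> cd xab; split; [split; rewrite //= lexx cd|left]. Qed.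
Lemma bdry_right a b c d y : a <= b -> c <= y <= d -> bdry a b c d (b +i* y).
Proof. by move=> cd xab; split; [split; rewrite //= lexx cd|right; left]. Qed.

Lemma ctsb_cts g a b c d : a <= b -> c <= d -> ctsb g a b c d ->
  [/\ cts a b (fun x => Re (g (x +i* c))), cts a b (fun x => Re (g (x +i* d))),
      cts c d (fun y => Im (g (b +i* y))) & cts c d (fun y => Im (g (a +i* y)))].
Proof.
move=> ab cd cg; split=> x xab.
- by have/cg/(ccont_ex Re_lip)[] := bdry_bot cd xab.
- by have/cg/(ccont_ex Re_lip)[] := bdry_top cd xab.
- by have/cg/(ccont_ex Im_lip)[] := bdry_right ab xab.
- by have/cg/(ccont_ex Im_lip)[] := bdry_left ab xab.
Qed.

Lemma bnd_split_x g a m b c d : a <= m -> m <= b -> c <= d -> ctsb g a b c d ->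
  bnd g a b c d = bnd g a m c d + bnd g m b c d.
Proof.
move=> am mb cd cg; have [c1 c2 _ _] := ctsb_cts (le_trans am mb) cd cg.
by rewrite /bnd (RI_split am mb c1) (RI_split am mb c2); ring.
Qed.
Lemma bnd_split_y g a b c m d : c <= m -> m <= d -> a <= b -> ctsb g a b c d ->
  bnd g a b c d = bnd g a b c m + bnd g a b m d.
Proof.
move=> am mb ab cg; have [_ _ c1 c2] := ctsb_cts ab (le_trans am mb) cg.
by rewrite /bnd (RI_split am mb c1) (RI_split am mb c2); ring.
Qed.

Lemma bnd_bound g a b c d M : a <= b -> c <= d -> ctsb g a b c d ->
  (forall z, bdry a b c d z -> N (g z) <= M) ->
  `|bnd g a b c d| <= 2 * M * ((b - a) + (d - c)).
Proof.
move=> ab cd cg gM; have [c1 c2 c3 c4] := ctsb_cts ab cd cg.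
have h1 := @RI_bound _ _ _ _ M ab c1 _; have h2 := @RI_bound _ _ _ _ M ab c2 _.
have h3 := @RI_bound _ _ _ _ M cd c3 _; have h4 := @RI_bound _ _ _ _ M cd c4 _.
have {}h1 : `|RI a b (fun x => Re (g (x +i* c)))| <= M * (b - a).
  by apply: h1 => x xab; rewrite (le_trans (N_Re _))// gM//; apply: bdry_bot.
have {}h2 : `|RI a b (fun x => Re (g (x +i* d)))| <= M * (b - a).
  by apply: h2 => x xab; rewrite (le_trans (N_Re _))// gM//; apply: bdry_top.
have {}h3 : `|RI c d (fun y => Im (g (b +i* y)))| <= M * (d - c).
  by apply: h3 => x xab; rewrite (le_trans (N_Im _))// gM//; apply: bdry_right.
have {}h4 : `|RI c d (fun y => Im (g (a +i* y)))| <= M * (d - c).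
  by apply: h4 => x xab; rewrite (le_trans (N_Im _))// gM//; apply: bdry_left.
move: h1 h2 h3 h4; rewrite /bnd !ler_norml => /andP[? ?] /andP[? ?] /andP[? ?] /andP[? ?].
by apply/andP; split; lra.
Qed.

Lemma bndD g h a b c d : a <= b -> c <= d -> ctsb g a b c d -> ctsb h a b c d ->
  bnd (fun z => g z + h z) a b c d = bnd g a b c d + bnd h a b c d.
Proof.
move=> ab cd cg ch; have [c1 c2 c3 c4] := ctsb_cts ab cd cg.
have [d1 d2 d3 d4] := ctsb_cts ab cd ch.
have E1 y : (fun x => Re (g (x +i* y) + h (x +i* y))) =
  (fun x => Re (g (x +i* y)) + Re (h (x +i* y))).
  by apply/funext => x; case: (g _) (h _) => [? ?] [? ?].
have E2 x : (fun y => Im (g (x +i* y) + h (x +i* y))) =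
  (fun y => Im (g (x +i* y)) + Im (h (x +i* y))).
  by apply/funext => y; case: (g _) (h _) => [? ?] [? ?].
by rewrite /bnd !E1 !E2 !RID//; ring.
Qed.

Lemma ccont_lip (g : C -> C) L z : 0 <= L -> (forall w, N (g w - g z) <= L * N (w - z)) -> ccont g z.
Proof.
move=> L0 gL e e0; have L1 : 0 < 1 + L by rewrite ltr_pwDl.
exists (e / (1 + L)); first by rewrite divr_gt0.
move=> w; rewrite ltr_pdivlMr// mulrC => h; rewrite (le_lt_trans (gL w))//.
by rewrite (le_lt_trans _ h)// ler_wpM2r ?N_ge0// lerDr.
Qed.

Lemma ccont_affine (al be : C) z : ccont (fun z => al + be * z) z.
Proof.
apply: (@ccont_lip _ (N be)) => [|w]; first exact: N_ge0.
by rewrite -NM; have -> : al + be * w - (al + be * z) = be * (w - z) by ring.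
Qed.

Lemma RIB a b (f g : R -> R) k : a <= b -> cts a b f -> cts a b g ->
  (forall x, f x = g x + k) -> RI a b f = RI a b g + k * (b - a).
Proof.
move=> ab cf cg fg; rewrite -RI_cst// -RID//; first by congr RI; exact/funext.
by move=> ? _; exact: cst_continuous.
Qed.

(** Opposite sides differ by a constant, [Im be * (d - c)] for the horizontal pair and
    [Im be * (b - a)] for the vertical one; multiplied by the lengths of the sides these cancel. *)
Lemma bnd_affine (al be : C) a b c d : a <= b -> c <= d ->
  bnd (fun z => al + be * z) a b c d = 0.
Proof.
move=> ab cd; have [c1 c2 c3 c4] := ctsb_cts ab cd (fun z _ => @ccont_affine al be z).
rewrite /bnd (@RIB _ _ _ _ (Im be * (d - c)) ab c1 c2); last first.
  by move=> x; case: al be {c1 c2 c3 c4} => [? ?] [? ?] /=; ring.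
rewrite (@RIB _ _ _ _ (Im be * (b - a)) cd c3 c4); last first.
  by move=> x; case: al be {c1 c2 c3 c4} => [? ?] [? ?] /=; ring.
by ring.
Qed.

Lemma ccontD g h z : ccont g z -> ccont h z -> ccont (fun z => g z + h z) z.
Proof.
move=> cg ch e e0; have e2 : 0 < e / 2 by rewrite divr_gt0.
have [t t0 ht] := cg _ e2; have [u u0 hu] := ch _ e2.
exists (Num.min t u); first by rewrite lt_min t0.
move=> w; rewrite lt_min => /andP[/ht h1 /hu h2].
by rewrite opprD addrACA (le_lt_trans (ND _ _))// (splitr e) ltrD.
Qed.

(** Subtracting the first-order expansion at [z0], whose integral vanishes, leaves at most [e / 2]
    times the half-perimeter on the boundary; the half-perimeter enters a second time as the length
    of the path. *)
Lemma bnd_local g z0 l e : 0 < e -> cderiv g z0 l -> exists2 t : R, 0 < t &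
  forall a b c d, rect a b c d z0 -> b - a < t -> d - c < t -> ctsr g a b c d ->
   `|bnd g a b c d| <= e * ((b - a) + (d - c)) ^+ 2.
Proof.
move=> e0 gl; have [t t0 ht] := gl (e / 2) (divr_gt0 e0 (ltr0n R 2)).
exists (t / 2); first by rewrite divr_gt0.
move=> a b c d [zab zcd] ba dc cg.
have ab : a <= b by case/andP: zab => /le_trans; exact.
have cd : c <= d by case/andP: zcd => /le_trans; exact.
pose r z := g z - g z0 - l * (z - z0).
pose q z := (g z0 - l * z0) + l * z.
have cq z : ccont q z by exact: ccont_affine.
have cr z : rect a b c d z -> ccont r z.
  move=> zr; rewrite (_ : r = (fun z => g z + ((- (g z0 - l * z0)) + (- l) * z))).
    by apply: ccontD; [exact: cg|exact: ccont_affine].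
  by apply/funext => w; rewrite /r; ring.
have -> : g = (fun z => q z + r z) by apply/funext => w; rewrite /q /r; ring.
rewrite (bndD ab cd (fun z _ => cq z) (ctsr_b cr)) bnd_affine// add0r.
have h w : bdry a b c d w -> N (r w) <= e / 2 * ((b - a) + (d - c)).
  move=> [[wab wcd] _].
  have hN : N (w - z0) <= (b - a) + (d - c).
    rewrite (le_trans (N_le _))//; case: w z0 wab wcd zab zcd {ht gl cr r q cq}  => [x y] [x' y'] /=.
    move=> /andP[? ?] /andP[? ?] /andP[? ?] /andP[? ?].
    by rewrite lerD// ler_norml; apply/andP; split; lra.
  rewrite (le_trans (ht w _))//; last by rewrite ler_wpM2l// divr_ge0// ltW.
  by rewrite (le_lt_trans hN)//; lra.
have := bnd_bound ab cd _ h; rewrite expr2 => /(_ (ctsr_b cr)); lra.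
Qed.

(** Nested quartering for any predicate that passes from a rectangle to one of its quarters. The
    coordinates of the common point are the suprema of the left and of the lower end points. *)
Lemma bisection (P : R -> R -> R -> R -> Prop) a b c d : a <= b -> c <= d -> P a b c d ->
 (forall a' b' c' d', a <= a' -> a' <= b' -> b' <= b -> c <= c' -> c' <= d' -> d' <= d ->
   P a' b' c' d' ->
   [\/ P a' ((a' + b') / 2) c' ((c' + d') / 2), P ((a' + b') / 2) b' c' ((c' + d') / 2),
       P a' ((a' + b') / 2) ((c' + d') / 2) d' | P ((a' + b') / 2) b' ((c' + d') / 2) d' ]) ->
 exists z, rect a b c d z /\ forall e, 0 < e -> exists a' b' c' d',
   [/\ a <= a', b' <= b, c <= c', d' <= d & rect a' b' c' d' z] /\
   [/\ b' - a' < e, d' - c' < e & P a' b' c' d'].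
Proof.
move=> ab cd P0 step.
pose T := (R * R * R * R)%type.
pose ok (s : T) := let: (a', b', c', d') := s in
  [/\ a <= a', a' <= b' & b' <= b] /\ [/\ c <= c', c' <= d', d' <= d & P a' b' c' d'].
pose nest (s t : T) := let: (a1, b1, c1, d1) := s in let: (a2, b2, c2, d2) := t in
  [/\ a1 <= a2, b2 <= b1, c1 <= c2 & d2 <= d1] /\ (b2 - a2 = (b1 - a1) / 2 /\ d2 - c2 = (d1 - c1) / 2).
(* [choice] needs a total successor, so a state violating the invariant gets itself as a dummy
   successor. *)
have next s : exists t, ok s -> ok t /\ nest s t.
  have [oks|?] := pselect (ok s); last by exists s.
  move: s oks => [[[a' b'] c'] d'] [[? ? ?] [? ? ? Ps]].
  have [] // := step a' b' c' d' => Pt; [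
   exists (a', (a' + b') / 2, c', (c' + d') / 2) | exists ((a' + b') / 2, b', c', (c' + d') / 2)
  | exists (a', (a' + b') / 2, (c' + d') / 2, d') | exists ((a' + b') / 2, b', (c' + d') / 2, d')] => _;
  (split; [split; split=> //; lra|split; [split|split]; lra]).
have [F hF] := choice next.
pose s n := iter n F (a, b, c, d).
have oks n : ok (s n).
  elim: n => [|n /hF[]//]; by rewrite /s/=; split; split.
pose A n := (s n).1.1.1; pose B n := (s n).1.1.2; pose CC n := (s n).1.2; pose D n := (s n).2.
have sE n : s n = (A n, B n, CC n, D n) by rewrite /A /B /CC /D; case: (s n) => [[[]]].
have nst n : [/\ A n <= A n.+1, B n.+1 <= B n, CC n <= CC n.+1 & D n.+1 <= D n] /\
   (B n.+1 - A n.+1 = (B n - A n) / 2 /\ D n.+1 - CC n.+1 = (D n - CC n) / 2).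
  have [_] := hF _ (oks n); rewrite -[F (s n)]/(s n.+1) !sE; exact.
have okn n : [/\ a <= A n, A n <= B n & B n <= b] /\
   [/\ c <= CC n, CC n <= D n, D n <= d & P (A n) (B n) (CC n) (D n)].
  by have := oks n; rewrite sE.
have len n : B n - A n = (b - a) / 2 ^+ n /\ D n - CC n = (d - c) / 2 ^+ n.
  elim: n => [|n [h1 h2]]; first by rewrite !expr0 !divr1.
  by have [_ [-> ->]] := nst n; rewrite h1 h2 exprSr invfM !mulrA.
have mono n m : (n <= m)%N -> [/\ A n <= A m, B m <= B n, CC n <= CC m & D m <= D n].
  elim: m => [|m IH]; first by rewrite leqn0 => /eqP ->; split.
  rewrite leq_eqVlt => /predU1P[->|]; first by split.
  rewrite ltnS => /IH[h1 h2 h3 h4]; have [[g1 g2 g3 g4] _] := nst m.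
  by split; [exact: le_trans g1|exact: le_trans h2|exact: le_trans g3|exact: le_trans h4].
have AB n m : A n <= B m.
  have [h1 _ _ _] := mono _ _ (leq_maxl n m); have [_ h2 _ _] := mono _ _ (leq_maxr n m).
  by rewrite (le_trans h1)// (le_trans _ h2)//; have [[]] := okn (maxn n m).
have CD n m : CC n <= D m.
  have [_ _ h1 _] := mono _ _ (leq_maxl n m); have [_ _ _ h2] := mono _ _ (leq_maxr n m).
  by rewrite (le_trans h1)// (le_trans _ h2)//; have [_ []] := okn (maxn n m).
pose x := sup (range A); pose y := sup (range CC).
have hx n : A n <= x <= B n.
  apply/andP; split.
    by apply: ub_le_sup; [exists (B 0%N) => _ [m _ <-]; exact: AB|exists n].
  by apply: ge_sup; [exists (A 0%N), 0%N|move=> _ [m _ <-]; exact: AB].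
have hy n : CC n <= y <= D n.
  apply/andP; split.
    by apply: ub_le_sup; [exists (D 0%N) => _ [m _ <-]; exact: CD|exists n].
  by apply: ge_sup; [exists (CC 0%N), 0%N|move=> _ [m _ <-]; exact: CD].
exists (x +i* y); split; first by split; [exact: hx 0%N|exact: hy 0%N].
move=> e e0.
pose K := (b - a) + (d - c).
have K0 : 0 <= K by rewrite addr_ge0 ?subr_ge0.
have [n hn] : exists n, K / 2 ^+ n < e.
  have [n] : exists n : nat, K / e < n%:R.
    exists (Num.Def.trunc (K / e)).+1; exact: truncnS_gt.
  rewrite ltr_pdivrMr// => h; exists n.
  rewrite ltr_pdivrMr ?exprn_gt0// (lt_le_trans h)// mulrC ler_wpM2l// ltW//.
  have : n%:R < (2 ^ n)%:R :> R by rewrite ltr_nat ltn_expl.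
  by rewrite natrX.
have [[? ? ?] [? ? ? ?]] := okn n; have [L1 L2] := len n.
exists (A n), (B n), (CC n), (D n); split; first by split.
by split => //; rewrite ?L1 ?L2 (le_lt_trans _ hn)// ler_wpM2r ?invr_ge0 ?exprn_ge0// /K; lra.
Qed.

Lemma goursat_rect g a b c d : a <= b -> c <= d ->
  (forall z, rect a b c d z -> exists l, cderiv g z l) -> bnd g a b c d = 0.
Proof.
move=> ab cd dg; apply/eqP/negPn/negP => n0.
have cg : ctsr g a b c d by move=> z /dg[l /cderiv_cont].
pose K := (b - a) + (d - c).
(* If both sides have length zero, the four integrals are over single points and vanish; otherwise
   division by [K] is possible. *)
have K0 : 0 < K.
  rewrite lt_neqAle eq_sym addr_ge0 ?subr_ge0// andbT; apply/eqP => K0.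
  have [eb ed] : b = a /\ d = c by split; rewrite /K in K0; lra.
  move: n0; rewrite /bnd eb ed !/(RI a a _) !/(RI c c _) /RI !set_itv1 !Rintegral_set1.
  by rewrite !subrr addr0 eqxx.
pose k := `|bnd g a b c d| / K ^+ 2.
have k0 : 0 < k by rewrite divr_gt0 ?exprn_gt0// normr_gt0.
(* Quartering divides the squared half-perimeter by 4, so one of the quarters inherits the
   inequality with the same [k]. Near the limit point this contradicts [bnd_local] for [k / 2]. *)
pose P a b c d := 0 < (b - a) + (d - c) /\ k * ((b - a) + (d - c)) ^+ 2 <= `|bnd g a b c d|.
have P0 : P a b c d by split=> //; rewrite /k -mulrA mulVf ?mulr1// expf_neq0// gt_eqF.
have [|z [zr hz]] := bisection ab cd P0.
  move=> a' b' c' d' h1 h2 h3 h4 h5 h6; rewrite /P.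
  set m := (a' + b') / 2; set n := (c' + d') / 2.
  have cg' : ctsr g a' b' c' d'.
    by move=> w [/andP[? ?] /andP[? ?]]; apply: cg; split; apply/andP; split; lra.
  have m1 : a' <= m by rewrite /m; lra. have m2 : m <= b' by rewrite /m; lra.
  have n1 : c' <= n by rewrite /n; lra. have n2 : n <= d' by rewrite /n; lra.
  have cgL : ctsr g a' m c' d'.
    by move=> w [/andP[? ?] ?]; apply: cg'; split=> //; apply/andP; split; lra.
  have cgR : ctsr g m b' c' d'.
    by move=> w [/andP[? ?] ?]; apply: cg'; split=> //; apply/andP; split; lra.
  rewrite (bnd_split_x m1 m2 h5 (ctsr_b cg')) (bnd_split_y n1 n2 m1 (ctsr_b cgL)) (bnd_split_y n1 n2 m2 (ctsr_b cgR)).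
  set B1 := bnd g a' m c' n; set B2 := bnd g a' m n d'.
  set B3 := bnd g m b' c' n; set B4 := bnd g m b' n d' => -[Hpos H].
  set X := k * _ in H.
  have e1 : k * ((m - a') + (n - c')) ^+ 2 = X / 4 by rewrite /X /m /n; field.
  have e2 : k * ((m - a') + (d' - n)) ^+ 2 = X / 4 by rewrite /X /m /n; field.
  have e3 : k * ((b' - m) + (n - c')) ^+ 2 = X / 4 by rewrite /X /m /n; field.
  have e4 : k * ((b' - m) + (d' - n)) ^+ 2 = X / 4 by rewrite /X /m /n; field.
  rewrite e1 e2 e3 e4.
  have [?|l1] := lerP (X / 4) `|B1|; first by apply: Or41; split=> //; rewrite /m /n; lra.
  have [?|l2] := lerP (X / 4) `|B3|; first by apply: Or42; split=> //; rewrite /m /n; lra.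
  have [?|l3] := lerP (X / 4) `|B2|; first by apply: Or43; split=> //; rewrite /m /n; lra.
  have [?|l4] := lerP (X / 4) `|B4|; first by apply: Or44; split=> //; rewrite /m /n; lra.
  have : X < X; last by rewrite ltxx.
  rewrite (le_lt_trans H)// (le_lt_trans (ler_normD _ _))//.
  have := ler_normD B1 B2; have := ler_normD B3 B4; lra.
have [l dl] := dg z zr.
have [t t0 ht] := bnd_local (divr_gt0 k0 (ltr0n R 2)) dl.
have [a' [b' [c' [d' [[h1 h2 h3 h4 hr] [h5 h6 hP]]]]]] := hz t t0.
have cg' : ctsr g a' b' c' d'.
  by move=> w [/andP[? ?] /andP[? ?]]; apply: cg; split; apply/andP; split; lra.
have := ht _ _ _ _ hr h5 h6 cg'; move: hP => [].
set q := _ + _ ; set x := `|_| => q0 hx.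
have : k / 2 * q ^+ 2 < k * q ^+ 2 by rewrite ltr_pM2r ?exprn_gt0//; lra.
lra.
Qed.
End goursat.

(** * Removable singularities in Goursat's theorem *)

Section one_singularity.
Variable R : realType.
Local Notation N := (@Normc.normc R).
Local Notation C := R[i].
Local Notation Re := (@complex.Re R).
Local Notation Im := (@complex.Im R).

Definition cdiff (g : C -> C) z := derivable (g : R[i]^o -> R[i]^o) z 1.

Lemma cnormE (z : C) : `|z| = (N z)%:C. Proof. by []. Qed.

Lemma cdiff_cderiv g z : cdiff g z -> exists l, cderiv g z l.
Proof.
move=> /cvg_ex[/= l hl]; exists l => e e0.
have eC : 0 < e%:C :> C by rewrite ltcR.
move/cvgrPdist_le : hl => /(_ _ eC) => -[/= t].
rewrite /= => t0 ht.
have [t1 t1_gt0 tE] : exists2 t1 : R, 0 < t1 & t = t1%:C.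
  by move: t0; case: t {ht} => x y; rewrite ltcE/= => /andP[/eqP -> ?]; exists x.
exists t1 => // w; have [->|wz] := eqVneq w z; first by rewrite !subrr mulr0 subr0 N0 mulr0.
move=> wt; have wz0 : w - z != 0 by rewrite subr_eq0.
have := ht (w - z); rewrite /ball_ /= => /(_ _ wz0).
rewrite sub0r normrN tE cnormE ltcR => /(_ wt).
rewrite cnormE /GRing.scale/= mulr1 subrK lecR => h.
rewrite (_ : _ - _ = - ((l - (w - z)^-1 * (g w - g z)) * (w - z))); last by field.
by rewrite NN NM ler_wpM2r// N_ge0.
Qed.

Lemma cderiv_cdiff g z l : cderiv g z l -> cdiff g z.
Proof.
move=> hl; apply/cvg_ex; exists l; apply/cvgrPdist_le => e.
case: e => e1 e2; rewrite ltcE/= => /andP[/eqP -> e0]; rewrite complexr0.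
have [t t0 ht] := hl e1 e0; exists (t%:C) => /=; first by rewrite ltcR.
move=> h; rewrite /ball_/= sub0r normrN !cnormE ltcR lecR => ht1 h0.
rewrite /GRing.scale/= mulr1.
have := ht (h + z); rewrite addrK => /(_ ht1) => h1.
rewrite -(ler_pM2r (N_gt0 h0)) -NM (_ : _ * h = - (g (h + z) - g z - l * h)); last by field.
by rewrite NN.
Qed.

Lemma cdiff_ccont g z : cdiff g z -> ccont g z.
Proof. by move=> /cdiff_cderiv[l /cderiv_cont]. Qed.

Lemma cdiffV (g : C -> C) z : g z != 0 -> cdiff g z -> cdiff (fun w => (g w)^-1) z.
Proof. exact: derivableV. Qed.
Lemma cdiffM (g h : C -> C) z : cdiff g z -> cdiff h z -> cdiff (fun w => g w * h w) z.
Proof. exact: derivableM. Qed.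
Lemma cdiffD (g h : C -> C) z : cdiff g z -> cdiff h z -> cdiff (fun w => g w + h w) z.
Proof. exact: derivableD. Qed.
Lemma cdiffB (g h : C -> C) z : cdiff g z -> cdiff h z -> cdiff (fun w => g w - h w) z.
Proof. exact: derivableB. Qed.
Lemma cdiff_cst (c z : C) : cdiff (fun=> c) z. Proof. exact: derivable_cst. Qed.
Lemma cdiff_id (z : C) : cdiff (fun w => w) z. Proof. exact: derivable_id. Qed.

(** Riemann's condition that [(w - e) * g w] tends to 0 at [e]. It holds for difference quotients at
    their centre and says nothing about the value at [e] itself. *)
Definition remov (g : C -> C) e := forall eps : R, 0 < eps -> exists2 t : R, 0 < t &
  forall w, w != e -> N (w - e) < t -> N (g w) * N (w - e) <= eps.

Lemma ccont_remov g z : ccont g z -> remov g z.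
Proof.
move=> cg e e0; have [t t0 ht] := cg 1 ltr01.
have K0 : 0 < N (g z) + 1 by rewrite ltr_wpDl// N_ge0.
exists (Num.min t (e / (N (g z) + 1))); first by rewrite lt_min t0 divr_gt0.
move=> w _; rewrite lt_min => /andP[/ht h1]; rewrite ltr_pdivlMr// mulrC => h2.
rewrite (le_trans _ (ltW h2))// ler_wpM2r ?N_ge0//.
by have := NBr (g w) (g z); lra.
Qed.

Lemma bdry_square (e z : C) t : 0 < t ->
  bdry (Re e - t) (Re e + t) (Im e - t) (Im e + t) z -> t <= N (z - e) /\ N (z - e) <= 2 * t.
Proof.
move=> t0 [[/andP[z1 z2] /andP[z3 z4]] zb]; split; last first.
  rewrite (le_trans (N_le _))//; case: z e z1 z2 z3 z4 {zb} => [x y] [u v] /= ? ? ? ?.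
  have -> : 2 * t = t + t by ring.
  by apply: lerD; rewrite ler_norml; apply/andP; split; lra.
have := N_Re (z - e); have := N_Im (z - e).
have -> : Re (z - e) = Re z - Re e by case: z e {z1 z2 z3 z4 zb} => [? ?] [? ?].
have -> : Im (z - e) = Im z - Im e by case: z e {z1 z2 z3 z4 zb} => [? ?] [? ?].
by move=> h1 h2; case: zb => [|[|[|]]] E; [apply: le_trans h2|apply: le_trans h2|apply: le_trans h1|
  apply: le_trans h1]; rewrite E addrC addKr ?normrN gtr0_norm.
Qed.

(** The rectangle is cut into four pieces avoiding [e] and a square of half-side [t] around it. On
    the boundary of that square [g] is at most [eps0 / 8 / t], so [bnd_bound] with sides [2 * t]
    gives exactly [eps0]. *)
Lemma goursat1 g e a b c d : a < Re e < b -> c < Im e < d ->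
  (forall z, rect a b c d z -> z != e -> cdiff g z) -> remov g e ->
  bnd g a b c d = 0.
Proof.
move=> /andP[ae eb] /andP[ce ed] dg ge.
apply/eqP; rewrite -normr_eq0 eq_le normr_ge0 andbT; apply/ler_addgt0Pr => eps0 eps00; rewrite add0r.
have eps8 : 0 < eps0 / 8 by rewrite divr_gt0.
have [t0 t00 ht] := ge _ eps8.
pose t := Num.min (t0 / 4) (Num.min (Num.min ((Re e - a) / 2) ((b - Re e) / 2))
  (Num.min ((Im e - c) / 2) ((d - Im e) / 2))).
have tp : 0 < t by rewrite !lt_min !divr_gt0 ?subr_gt0.
have [t1 [t2 t3] [t4 t5]] : [/\ t <= t0 / 4, t <= (Re e - a) / 2 /\ t <= (b - Re e) / 2
   & t <= (Im e - c) / 2 /\ t <= (d - Im e) / 2].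
  by split; [|split|split]; rewrite /t !ge_min lexx ?orbT.
pose x1 := Re e - t; pose x2 := Re e + t; pose y1 := Im e - t; pose y2 := Im e + t.
have [ax1 x1e ex2 x2b] : [/\ a < x1, x1 < Re e, Re e < x2 & x2 < b].
  by rewrite /x1 /x2; clear -ae eb tp t2 t3; split; lra.
have [cy1 y1e ey2 y2d] : [/\ c < y1, y1 < Im e, Im e < y2 & y2 < d].
  by rewrite /y1 /y2; clear -ce ed tp t4 t5; split; lra.
have cb a' b' c' d' : a <= a' -> b' <= b -> c <= c' -> d' <= d ->
   (Re e != a') && (Re e != b') && (Im e != c') && (Im e != d') -> ctsb g a' b' c' d'.
  move=> h1 h2 h3 h4 /andP[/andP[/andP[n1 n2] n3] n4] z [[/andP[z1 z2] /andP[z3 z4]] zb].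
  apply: cdiff_ccont; apply: dg.
    by split; rewrite ?(le_trans h1 z1) ?(le_trans z2 h2) ?(le_trans h3 z3) ?(le_trans z4 h4).
  apply/eqP => ze; move: zb n1 n2 n3 n4; rewrite ze.
  by case=> [->|[->|[->|->]]]; rewrite eqxx ?andbF.
have G0 a' b' c' d' : a <= a' -> a' <= b' -> b' <= b -> c <= c' -> c' <= d' -> d' <= d ->
   [|| Re e < a', b' < Re e, Im e < c' | d' < Im e] -> bnd g a' b' c' d' = 0.
  move=> h1 h2 h3 h4 h5 h6 out; apply: goursat_rect => // z [/andP[z1 z2] /andP[z3 z4]].
  apply: cdiff_cderiv; apply: dg.
    by split; rewrite ?(le_trans h1 z1) ?(le_trans z2 h3) ?(le_trans h4 z3) ?(le_trans z4 h6).
  apply/eqP => ze; move: out; rewrite -ze !ltNge z1 z2 z3 z4//.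
have neq (x y : R) : x < y -> (x != y) && (y != x) by move=> xy; rewrite lt_eqF// gt_eqF.
have [x1n x1n'] := andP (neq _ _ x1e); have [x2n x2n'] := andP (neq _ _ ex2).
have [y1n y1n'] := andP (neq _ _ y1e); have [y2n y2n'] := andP (neq _ _ ey2).
have [an an'] := andP (neq _ _ ae); have [bn bn'] := andP (neq _ _ eb).
have [cn cn'] := andP (neq _ _ ce); have [dn dn'] := andP (neq _ _ ed).
have x12 := lt_trans x1e ex2; have y12 := lt_trans y1e ey2.
have x1b := lt_trans x12 x2b; have y1d := lt_trans y12 y2d.
have cd := lt_trans ce ed.
have W (x y : R) : x < y -> x <= y by exact: ltW.
rewrite (@bnd_split_x _ _ _ x1 _ _ _ (W _ _ ax1) (W _ _ x1b) (W _ _ cd)); last first.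
  by apply: cb; rewrite ?lexx// an' bn cn' dn.
rewrite (G0 a x1) ?lexx ?(W _ _ ax1) ?(W _ _ x1b) ?(W _ _ cd) ?x1e ?orbT// add0r.
rewrite (@bnd_split_x _ _ _ x2 _ _ _ (W _ _ x12) (W _ _ x2b) (W _ _ cd)); last first.
  by apply: cb; rewrite ?lexx ?(ltW ax1)// x1n' bn cn' dn.
rewrite (G0 x2 b) ?lexx ?(W _ _ (lt_trans ax1 x12)) ?(W _ _ x2b) ?(W _ _ cd) ?ex2 ?orbT// addr0.
rewrite (@bnd_split_y _ _ _ _ _ y1 _ (W _ _ cy1) (W _ _ y1d) (W _ _ x12)); last first.
  by apply: cb; rewrite ?lexx ?(ltW ax1) ?(ltW x2b)// x1n' x2n cn' dn.
rewrite (G0 x1 x2 c y1) ?lexx ?(W _ _ ax1) ?(W _ _ x12) ?(W _ _ x2b) ?(W _ _ cy1) ?(W _ _ y1d) ?y1e ?orbT// add0r.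
rewrite (@bnd_split_y _ _ _ _ _ y2 _ (W _ _ y12) (W _ _ y2d) (W _ _ x12)); last first.
  by apply: cb; rewrite ?lexx ?(ltW ax1) ?(ltW x2b) ?(ltW cy1)// x1n' x2n y1n' dn.
rewrite (G0 x1 x2 y2 d) ?lexx ?(W _ _ ax1) ?(W _ _ x12) ?(W _ _ x2b) ?(W _ _ (lt_trans cy1 y12)) ?(W _ _ y2d) ?ey2 ?orbT// addr0.
have E := @bnd_bound _ g x1 x2 y1 y2 (eps0 / 8 / t).
apply: (@le_trans _ _ (2 * (eps0 / 8 / t) * (x2 - x1 + (y2 - y1)))).
  apply: E; [exact: ltW|exact: ltW| |].
    by apply: cb; rewrite ?(ltW ax1) ?(ltW x2b) ?(ltW cy1) ?(ltW y2d)// x1n' x2n y1n' y2n.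
  move=> z [[/andP[z1 z2] /andP[z3 z4]] zb].
  have [tz tz'] : t <= N (z - e) /\ N (z - e) <= 2 * t.
    apply: bdry_square => //; split=> //.
    by rewrite /x1 /x2 /y1 /y2 in z1 z2 z3 z4; split; rewrite ?z1 ?z2 ?z3 ?z4.
  have ze : z != e by apply: contraTneq tp => ze; rewrite ze subrr N0 in tz; rewrite -leNgt.
  rewrite ler_pdivlMr//; apply: le_trans (ht z ze _).
    by rewrite ler_wpM2l ?N_ge0.
  by rewrite (le_lt_trans tz')//; clear -t1 t00; lra.
rewrite /x1 /x2 /y1 /y2 (_ : _ * _ = eps0)//; field.
by rewrite gt_eqF.
Qed.
End one_singularity.

(** * A maximum principle with a universal constant *)

Section two_singularities.
Variable R : realType.
Local Notation N := (@Normc.normc R).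
Local Notation C := R[i].
Local Notation Re := (@complex.Re R).
Local Notation Im := (@complex.Im R).

Definition inrect (a b c d : R) (z : C) := a < Re z < b /\ c < Im z < d.

Lemma Re_mul (z w : C) : Re (z * w) = Re z * Re w - Im z * Im w.
Proof. by case: z w => [? ?] [? ?]. Qed.
Lemma Im_mul (z w : C) : Im (z * w) = Re z * Im w + Im z * Re w.
Proof. by case: z w => [? ?] [? ?]. Qed.
Lemma Re_inv (z : C) : Re z^-1 = Re z / (Re z ^+ 2 + Im z ^+ 2).
Proof. by case: z. Qed.
Lemma Im_inv (z : C) : Im z^-1 = - Im z / (Re z ^+ 2 + Im z ^+ 2).
Proof. by case: z => x y /=; rewrite mulNr. Qed.

Lemma removD g h e : remov g e -> remov h e -> remov (fun z : C => g z + h z) e.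
Proof.
move=> rg rh eps eps0; have e2 : 0 < eps / 2 by rewrite divr_gt0.
have [t t0 ht] := rg _ e2; have [u u0 hu] := rh _ e2.
exists (Num.min t u); first by rewrite lt_min t0.
move=> w we; rewrite lt_min => /andP[/(ht _ we) h1 /(hu _ we) h2].
rewrite (splitr eps) (le_trans _ (lerD h1 h2))// -mulrDl.
by rewrite ler_wpM2r ?N_ge0 ?ND.
Qed.

Lemma removM g h e : remov g e -> ccont h e -> remov (fun z : C => g z * h z) e.
Proof.
move=> rg ch eps eps0; have [u u0 hu] := ch 1 ltr01.
have K0 : 0 < N (h e) + 1 by rewrite ltr_wpDl// N_ge0.
have [t t0 ht] := rg _ (divr_gt0 eps0 K0).
exists (Num.min t u); first by rewrite lt_min t0.
move=> w we; rewrite lt_min => /andP[/(ht _ we) h1 /hu h2].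
rewrite NM mulrAC (@le_trans _ _ (eps / (N (h e) + 1) * N (h w)))//.
  by rewrite ler_wpM2r// N_ge0.
rewrite mulrAC ler_pdivrMr// ler_wpM2l ?(ltW eps0)//.
by have := NBr (h w) (h e); lra.
Qed.

Lemma inrect_rect a b c d z : inrect a b c d z -> rect a b c d z.
Proof. by move=> [/andP[? ?] /andP[? ?]]; split; rewrite !ltW. Qed.

Lemma inrect_ord a b c d z : inrect a b c d z -> a < b /\ c < d.
Proof. by move=> [/andP[? ?] /andP[? ?]]; split; [exact: (@lt_trans _ _ (Re z))|exact: (@lt_trans _ _ (Im z))]. Qed.

Lemma ctsb_off g e1 e2 a b c d :
  (forall z, rect a b c d z -> z != e1 -> z != e2 -> cdiff g z) ->
  inrect a b c d e1 -> inrect a b c d e2 -> ctsb g a b c d.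
Proof.
move=> dg e1i e2i z [zr zb]; apply: cdiff_ccont; apply: dg => //.
- apply: contraPneq zb => ->; case: e1i => /andP[x1 x2] /andP[x3 x4].
  by case=> [E|[E|[E|E]]]; move: x1 x2 x3 x4; rewrite E ltxx.
- apply: contraPneq zb => ->; case: e2i => /andP[x1 x2] /andP[x3 x4].
  by case=> [E|[E|[E|E]]]; move: x1 x2 x3 x4; rewrite E ltxx.
Qed.

Lemma goursat2_x g e1 e2 a b c d : Re e1 < Re e2 -> inrect a b c d e1 -> inrect a b c d e2 ->
  (forall z, rect a b c d z -> z != e1 -> z != e2 -> cdiff g z) -> remov g e1 -> remov g e2 ->
  bnd g a b c d = 0.
Proof.
move=> e12 e1i e2i dg r1 r2; have cb := ctsb_off dg e1i e2i.
case: e1i e2i => /andP[x1 x2] /andP[x3 x4] [/andP[y1 y2] /andP[y3 y4]].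
have [m1 m2] : Re e1 < (Re e1 + Re e2) / 2 /\ (Re e1 + Re e2) / 2 < Re e2.
  by clear -e12; split; lra.
rewrite (@bnd_split_x _ _ _ ((Re e1 + Re e2) / 2)) //; first last.
- exact: ltW (lt_trans x3 x4).
- exact: ltW (lt_trans m2 y2).
- exact: ltW (lt_trans x1 m1).
rewrite (@goursat1 _ g e1) ?x1 ?x3 //; last first.
  move=> z [/andP[z1 z2] zc] ze; apply: dg => //.
    by split=> //; rewrite z1 (le_trans z2)// ltW// (lt_trans m2).
  by apply: contraTneq z2 => ->; rewrite -ltNge.
rewrite (@goursat1 _ g e2) ?m2 ?y3 ?addr0 //.
move=> z [/andP[z1 z2] zc] ze; apply: dg => //.
  by split=> //; rewrite z2 (le_trans _ z1)// ltW// (lt_trans x1).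
by apply: contraTneq z1 => ->; rewrite -ltNge.
Qed.

Lemma goursat2_y g e1 e2 a b c d : Im e1 < Im e2 -> inrect a b c d e1 -> inrect a b c d e2 ->
  (forall z, rect a b c d z -> z != e1 -> z != e2 -> cdiff g z) -> remov g e1 -> remov g e2 ->
  bnd g a b c d = 0.
Proof.
move=> e12 e1i e2i dg r1 r2; have cb := ctsb_off dg e1i e2i.
case: e1i e2i => /andP[x1 x2] /andP[x3 x4] [/andP[y1 y2] /andP[y3 y4]].
have [m1 m2] : Im e1 < (Im e1 + Im e2) / 2 /\ (Im e1 + Im e2) / 2 < Im e2.
  by clear -e12; split; lra.
rewrite (@bnd_split_y _ _ _ _ _ ((Im e1 + Im e2) / 2)) //; first last.
- exact: ltW (lt_trans x1 x2).
- exact: ltW (lt_trans m2 y4).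
- exact: ltW (lt_trans x3 m1).
rewrite (@goursat1 _ g e1) ?x1 ?x3 //; last first.
  move=> z [zc /andP[z1 z2]] ze; apply: dg => //.
    by split=> //; rewrite z1 (le_trans z2)// ltW// (lt_trans m2).
  by apply: contraTneq z2 => ->; rewrite -ltNge.
rewrite (@goursat1 _ g e2) ?m2 ?y1 ?addr0 //.
move=> z [zc /andP[z1 z2]] ze; apply: dg => //.
  by split=> //; rewrite z2 (le_trans _ z1)// ltW// (lt_trans x3).
by apply: contraTneq z1 => ->; rewrite -ltNge.
Qed.

(** A line halfway between the two points, vertical if their real parts differ and horizontal
    otherwise, leaves one singularity on each side. Coinciding points fall back on [goursat1]. *)
Lemma goursat2 g e1 e2 a b c d : inrect a b c d e1 -> inrect a b c d e2 ->
  (forall z, rect a b c d z -> z != e1 -> z != e2 -> cdiff g z) -> remov g e1 -> remov g e2 ->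
  bnd g a b c d = 0.
Proof.
move=> i1 i2 dg r1 r2.
have dg' z : rect a b c d z -> z != e2 -> z != e1 -> cdiff g z by move=> *; exact: dg.
case: (ltgtP (Re e1) (Re e2)) => [h|h|h].
- exact: (goursat2_x h i1 i2).
- exact: (goursat2_x h i2 i1).
case: (ltgtP (Im e1) (Im e2)) => [k|k|k].
- exact: (goursat2_y k i1 i2).
- exact: (goursat2_y k i2 i1).
have E : e1 = e2 by case: e1 e2 h k {i1 i2 dg r1 r2 dg'} => [? ?] [? ?] /= -> ->.
case: i1 => h1 h2; apply: (@goursat1 _ g e1) => // z zr ze; apply: dg => //.
by rewrite -E.
Qed.

Lemma RI_ge a b (f : R -> R) k : a <= b -> cts a b f ->
  (forall x, a <= x <= b -> k <= f x) -> k * (b - a) <= RI a b f.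
Proof.
by move=> ab cf fk; rewrite -RI_cst//; apply: RI_le => // ? _; exact: cst_continuous.
Qed.
Lemma RI_leN a b (f : R -> R) k : a <= b -> cts a b f ->
  (forall x, a <= x <= b -> f x <= - k) -> RI a b f <= - (k * (b - a)).
Proof.
by move=> ab cf fk; rewrite -mulNr -RI_cst//; apply: RI_le => // ? _; exact: cst_continuous.
Qed.

(* Re of the winding integral of [-i/(z - w)] *)
Lemma winding_lb a b c d w rho : 0 < rho ->
  a + rho <= Re w <= b - rho -> c + rho <= Im w <= d - rho ->
  2 * ((b - a) + (d - c)) * (rho / ((b - a) ^+ 2 + (d - c) ^+ 2)) <=
  bnd (fun z => - 'i / (z - w)) a b c d.
Proof.
move=> r0 /andP[h1 h2] /andP[h3 h4].
set D := (b - a) ^+ 2 + (d - c) ^+ 2.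
have ab : a < b by clear -h1 h2 r0; lra.
have cd : c < d by clear -h3 h4 r0; lra.
have cb : ctsb (fun z => - 'i / (z - w)) a b c d.
  move=> z [_ zb]; apply: cdiff_ccont; apply: cdiffM; first exact: cdiff_cst.
  apply: cdiffV; last by apply: cdiffB; [exact: cdiff_id|exact: cdiff_cst].
  rewrite subr_eq0; apply: contraPneq zb => ->.
  by case=> [E|[E|[E|E]]]; move: h1 h2 h3 h4; rewrite E; clear -r0; lra.
have [c1 c2 c3 c4] := ctsb_cts (ltW ab) (ltW cd) cb.
have D0 : 0 < D by rewrite ltr_wpDl ?sqr_ge0// exprn_gt0// subr_gt0.
(* On each side of the rectangle the integrand keeps one sign: the numerator is, up to sign, the
   distance of [w] to that side, at least [rho], and the denominator is at most the squared diagonal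
   [D]. *)
have key u v : `|u| <= b - a -> `|v| <= d - c -> forall s, rho <= s -> 0 < u ^+ 2 + v ^+ 2 ->
   rho / D <= s / (u ^+ 2 + v ^+ 2).
  move=> hu hv s rs uv; apply: ler_pM; rewrite ?invr_ge0 ?(ltW r0) ?(ltW D0)// lef_pV2 ?posrE//.
  by rewrite /D -(real_normK (num_real u)) -(real_normK (num_real v)) lerD// ler_sqr// nnegrE subr_ge0 ltW.
have E x y : Re (- 'i / (x +i* y - w)) = - (y - Im w) / ((x - Re w) ^+ 2 + (y - Im w) ^+ 2).
  by rewrite Re_mul Re_inv Im_inv; case: w {h1 h2 h3 h4 cb c1 c2 c3 c4} => u v /=; ring.
have F x y : Im (- 'i / (x +i* y - w)) = - (x - Re w) / ((x - Re w) ^+ 2 + (y - Im w) ^+ 2).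
  by rewrite Im_mul Re_inv Im_inv; case: w {h1 h2 h3 h4 cb c1 c2 c3 c4 E} => u v /=; ring.
set k := rho / D.
have B1 : k * (b - a) <= RI a b (fun x => Re (- 'i / (x +i* c - w))).
  apply: RI_ge => // [|x /andP[x1 x2]]; first exact: ltW.
  have n0 : 0 < (c - Im w) ^+ 2 by rewrite exprn_even_gt0//=; clear -h3 r0; lra.
  rewrite E; apply: key; last by rewrite ltr_wpDl ?sqr_ge0.
  - by rewrite ler_norml; apply/andP; split; clear -x1 x2 h1 h2 r0; lra.
  - by rewrite ler_norml; apply/andP; split; clear -h3 h4 r0; lra.
  - by clear -h3; lra.
have B2 : RI a b (fun x => Re (- 'i / (x +i* d - w))) <= - (k * (b - a)).
  apply: RI_leN => // [|x /andP[x1 x2]]; first exact: ltW.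
  have n0 : 0 < (d - Im w) ^+ 2 by rewrite exprn_even_gt0//=; clear -h4 r0; lra.
  rewrite E mulNr lerN2; apply: key; last by rewrite ltr_wpDl ?sqr_ge0.
  - by rewrite ler_norml; apply/andP; split; clear -x1 x2 h1 h2 r0; lra.
  - by rewrite ler_norml; apply/andP; split; clear -h3 h4 r0; lra.
  - by clear -h4; lra.
have B3 : RI c d (fun y => Im (- 'i / (b +i* y - w))) <= - (k * (d - c)).
  apply: RI_leN => // [|x /andP[x1 x2]]; first exact: ltW.
  have n0 : 0 < (b - Re w) ^+ 2 by rewrite exprn_even_gt0//=; clear -h2 r0; lra.
  rewrite F mulNr lerN2; apply: key; last by rewrite ltr_pwDl ?sqr_ge0.
  - by rewrite ler_norml; apply/andP; split; clear -h1 h2 r0; lra.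
  - by rewrite ler_norml; apply/andP; split; clear -x1 x2 h3 h4 r0; lra.
  - by clear -h2; lra.
have B4 : k * (d - c) <= RI c d (fun y => Im (- 'i / (a +i* y - w))).
  apply: RI_ge => // [|x /andP[x1 x2]]; first exact: ltW.
  have n0 : 0 < (a - Re w) ^+ 2 by rewrite exprn_even_gt0//=; clear -h1 r0; lra.
  rewrite F; apply: key; last by rewrite ltr_pwDl ?sqr_ge0.
  - by rewrite ler_norml; apply/andP; split; clear -h1 h2 r0; lra.
  - by rewrite ler_norml; apply/andP; split; clear -x1 x2 h3 h4 r0; lra.
  - by clear -h1; lra.
by rewrite /bnd; move: B1 B2 B3 B4; clear; lra.
Qed.

(* [v] is the limit of [g] at [w]; [e] is a second removable singularity *)
Lemma weak_max g (v w e : C) a b c d rho M : 0 < rho ->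
  a + rho <= Re w <= b - rho -> c + rho <= Im w <= d - rho -> inrect a b c d e ->
  (forall z, rect a b c d z -> z != w -> z != e -> cdiff g z) ->
  remov (fun z => (g z - v) / (z - w)) w -> (e != w -> remov g e) ->
  (forall z, bdry a b c d z -> N (g z) <= M) ->
  N v * rho ^+ 2 <= M * ((b - a) ^+ 2 + (d - c) ^+ 2).
Proof.
move=> r0 hw1 hw2 ie dg rw re gM.
have iw : inrect a b c d w.
  by move: hw1 hw2 => /andP[u1 u2] /andP[u3 u4]; split; apply/andP; split; clear -u1 u2 u3 u4 r0; lra.
have [ab cd] := inrect_ord iw.
have M0 : 0 <= M.
  apply: le_trans (gM (a +i* c) _); first exact: N_ge0.
  by apply: bdry_left; rewrite ?lexx ltW.
have [->|v0] := eqVneq v 0.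
  by rewrite N0 mul0r mulr_ge0// addr_ge0// sqr_ge0.
have Nv := N_gt0 v0.
(* By the hypothesis on [v] the difference of [q] and [s] is removable at [w], so both have the same
   boundary integral, which [winding_lb] bounds below and [M] above. The factor [- 'i] makes the
   imaginary winding integral real, as [bnd] only sees real parts. *)
pose q z := - 'i / v * g z / (z - w); pose s z := - 'i / (z - w).
have dlin z : z != w -> cdiff (fun z => (z - w)^-1) z.
  move=> zw; apply: cdiffV; first by rewrite subr_eq0.
  by apply: cdiffB; [exact: cdiff_id|exact: cdiff_cst].
have ds z : z != w -> cdiff s z by move=> zw; apply: cdiffM; [exact: cdiff_cst|exact: dlin].
have dq z : rect a b c d z -> z != w -> z != e -> cdiff q z.
  move=> zr zw ze; apply: cdiffM; last exact: dlin.
  by apply: cdiffM; [exact: cdiff_cst|exact: dg].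
have cq : ctsb q a b c d by exact: ctsb_off iw ie.
have cs : ctsb s a b c d by apply: (@ctsb_off _ w w) => // z _ zw _; exact: ds.
have ri : remov (fun z => q z + (- 1) * s z) w.
  move=> eps eps0; have [t t0 ht] := rw (eps * N v) (mulr_gt0 eps0 Nv); exists t => // z zw zt.
  have -> : q z + -1 * s z = - 'i / v * ((g z - v) / (z - w)).
    rewrite /q /s; have : z - w != 0 by rewrite subr_eq0.
    by move: v0 (z - w) => v0 u u0; field; rewrite v0 u0.
  rewrite !NM NN NV -mulrA.
  have -> : N 'i = 1 by rewrite /= expr0n expr1n add0r sqrtr1.
  rewrite mul1r mulrC -ler_pdivlMr ?invr_gt0// invrK.
  by rewrite -NM; exact: ht.
have G0 : bnd (fun z => q z + (- 1) * s z) a b c d = 0.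
  apply: (goursat2 iw ie _ ri) => [z zr zw ze|].
    by apply: cdiffD; [exact: dq|apply: cdiffM; [exact: cdiff_cst|exact: ds]].
  have [->|ew] := eqVneq e w; first exact: ri.
  apply: removD.
    have -> : q = (fun z => g z * (- 'i / v * (z - w)^-1)) by apply/funext => z; rewrite /q; ring.
    apply: removM; first exact: re.
    by apply: cdiff_ccont; apply: cdiffM; [exact: cdiff_cst|exact: dlin].
  by apply: ccont_remov; apply: cdiff_ccont; apply: cdiffM; [exact: cdiff_cst|exact: ds].
have cs' : ctsb (fun z => -1 * s z) a b c d.
  apply: (@ctsb_off _ w w) => // z _ zw _.
  by apply: cdiffM; [exact: cdiff_cst|exact: ds].
have Bq : bnd q a b c d = bnd s a b c d.
  rewrite (_ : q = (fun z => (q z + -1 * s z) + s z)); last by apply/funext => z; ring.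
  have csum : ctsb (fun z => q z + -1 * s z) a b c d.
    apply: (ctsb_off _ iw ie) => z zr zw ze; apply: cdiffD; first exact: dq.
    by apply: cdiffM; [exact: cdiff_cst|exact: ds].
  by rewrite (bndD (ltW ab) (ltW cd) csum cs) G0 add0r.
have := winding_lb r0 hw1 hw2; rewrite -/s -Bq => L.
have bq z : bdry a b c d z -> N (q z) <= M / (N v * rho).
  move=> zb; have gz := gM z zb.
  have zw : rho <= N (z - w).
    have := N_Re (z - w); have := N_Im (z - w).
    have -> : Re (z - w) = Re z - Re w by clear; case: z w => [? ?] [? ?].
    have -> : Im (z - w) = Im z - Im w by clear; case: z w => [? ?] [? ?].
    move: hw1 hw2 => /andP[u1 u2] /andP[u3 u4] n1 n2.
    by case: zb => _ [|[|[|]]] E; [apply: le_trans n2|apply: le_trans n2|apply: le_trans n1|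
      apply: le_trans n1]; rewrite ler_normr E; apply/orP; [right|left|right|left]; clear -u1 u2 u3 u4 r0; lra.
  rewrite /q !NM NN !NV.
  have -> : N 'i = 1 by rewrite /= expr0n expr1n add0r sqrtr1.
  rewrite mul1r mulrAC -invfM mulrC; apply: ler_pM; rewrite ?N_ge0 ?invr_ge0 ?mulr_ge0 ?N_ge0//.
  have zw0 := lt_le_trans r0 zw.
  by rewrite lef_pV2 ?posrE ?ler_pM2l ?mulr_gt0.
have := bnd_bound (ltW ab) (ltW cd) cq bq => U.
have S0 : 0 < (b - a) + (d - c) by clear -ab cd; lra.
have D0 : 0 < (b - a) ^+ 2 + (d - c) ^+ 2 by rewrite ltr_wpDl ?sqr_ge0// exprn_gt0// subr_gt0.
have := le_trans (le_trans L (ler_norm _)) U.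
set S := (b - a) + _ in S0 *; set D := _ + _ ^+ 2 in D0 *.
have -> : 2 * S * (rho / D) = 2 * S * (N v * rho ^+ 2) / (D * (N v * rho)).
  by field; rewrite !gt_eqF.
have -> : 2 * (M / (N v * rho)) * S = 2 * S * (M * D) / (D * (N v * rho)).
  by field; rewrite !gt_eqF.
by rewrite ler_pM2r ?invr_gt0 ?mulr_gt0// ler_pM2l// mulr_gt0.
Qed.
End two_singularities.

(** * Taylor estimates and images of squares *)

Section taylor.
Variable R : realType.
Local Notation N := (@Normc.normc R).
Local Notation C := R[i].
Local Notation Re := (@complex.Re R).
Local Notation Im := (@complex.Im R).

Definition sq (w : C) (s : R) : C -> Prop := rect (Re w - s) (Re w + s) (Im w - s) (Im w + s).

Lemma N_sq w s z : sq w s z -> N (z - w) <= 2 * s.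
Proof.
move=> [/andP[? ?] /andP[? ?]]; rewrite (le_trans (N_le _))//.
have -> : Re (z - w) = Re z - Re w by clear; case: z w => [? ?] [? ?].
have -> : Im (z - w) = Im z - Im w by clear; case: z w => [? ?] [? ?].
have -> : 2 * s = s + s by ring.
by apply: lerD; rewrite ler_norml; apply/andP; split; lra.
Qed.

Lemma sq_N w s z : N (z - w) <= s -> sq w s z.
Proof.
have := N_Re (z - w); have := N_Im (z - w).
have -> : Re (z - w) = Re z - Re w by clear; case: z w => [? ?] [? ?].
have -> : Im (z - w) = Im z - Im w by clear; case: z w => [? ?] [? ?].
move=> h1 h2 h3; move: (le_trans h1 h3) (le_trans h2 h3).
by rewrite !ler_norml => /andP[? ?] /andP[? ?]; split; apply/andP; split; lra.
Qed.

Lemma remov_quot g z : ccont g z -> remov (fun w : C => (g w - g z) / (w - z)) z.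
Proof.
move=> cg e e0; have [t t0 ht] := cg e e0; exists t => // w wz /ht/ltW.
by rewrite -NM divfK// subr_eq0.
Qed.

(** Cauchy's estimate: [weak_max] for the difference quotient at [w], with [v = l] and no second
    singularity. On the boundary the quotient is at most [2 * M / eta], and the squared diagonal is
    [8 * eta ^+ 2], whence 16. *)
Lemma deriv_bound h w l eta M : 0 < eta -> cderiv h w l ->
  (forall z, sq w eta z -> cdiff h z) -> (forall z, sq w eta z -> N (h z) <= M) ->
  N l <= 16 * M / eta.
Proof.
move=> e0 hl dh hM.
pose g z := (h z - h w) / (z - w).
have ww : sq w eta w by split; apply/andP; split; lra.
have M0 : 0 <= M by rewrite (le_trans _ (hM w ww))// N_ge0.
have := @weak_max _ g l w w (Re w - eta) (Re w + eta) (Im w - eta) (Im w + eta) eta (2 * M / eta) e0.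
rewrite !subrK !addrK !lexx eqxx => /(_ isT isT).
rewrite (_ : Re w + eta - _ = 2 * eta); last by ring.
rewrite (_ : Im w + eta - _ = 2 * eta); last by ring.
have -> : 2 * M / eta * ((2 * eta) ^+ 2 + (2 * eta) ^+ 2) = 16 * M / eta * eta ^+ 2.
  by field; rewrite gt_eqF.
rewrite ler_pM2r ?exprn_gt0//; apply.
- by split; apply/andP; split; lra.
- move=> z zr zw _; apply: cdiffM.
    by apply: cdiffB; [exact: dh|exact: cdiff_cst].
  apply: cdiffV; first by rewrite subr_eq0.
  by apply: cdiffB; [exact: cdiff_id|exact: cdiff_cst].
- move=> eps eps0; have [t t0 ht] := hl eps eps0; exists t => // z zw zt.
  have z0 : z - w != 0 by rewrite subr_eq0.
  rewrite -NM divfK// -(ler_pM2r (N_gt0 z0)) -NM mulrBl divfK//.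
  exact: ht.
- by [].
- move=> z zb; have [h1 h2] := bdry_square e0 zb.
  have zw : z - w != 0.
    by apply: contraTneq e0 => z0; rewrite z0 N0 in h1; rewrite -leNgt.
  rewrite /g NM NV; apply: ler_pM; rewrite ?N_ge0 ?invr_ge0 ?N_ge0//.
    rewrite (le_trans (NB _ _))//; have := hM w ww; have := hM z zb.1; lra.
  by rewrite lef_pV2 ?posrE ?N_gt0.
Qed.

(** [weak_max] is applied to the second-order quotient [g] at the point [z1]. Its centre [w] is then
    a second singularity, which is the purpose of the extra point in [weak_max]. On the boundary [g]
    is at most [34 * M / eta ^+ 2], where 34 = 2 + 32 with 32 from [deriv_bound], and 1088 = 34 * 32
    because the squared diagonal is 32 times [(eta / 2) ^+ 2]. *)
Lemma taylor h w l eta M : 0 < eta -> cderiv h w l ->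
  (forall z, sq w eta z -> cdiff h z) -> (forall z, sq w eta z -> N (h z) <= M) ->
  forall z, sq w (eta / 2) z ->
    N (h z - h w - l * (z - w)) <= 1088 * M / eta ^+ 2 * N (z - w) ^+ 2.
Proof.
move=> e0 hl dh hM z1 z1q.
have ww : sq w eta w by split; apply/andP; split; lra.
have M0 : 0 <= M by rewrite (le_trans _ (hM w ww))// N_ge0.
have [->|z1w] := eqVneq z1 w; first by rewrite !subrr mulr0 subr0 N0 expr0n mulr0.
have z10 : z1 - w != 0 by rewrite subr_eq0.
pose g z := (h z - h w - l * (z - w)) / (z - w) ^+ 2.
have Nl := deriv_bound e0 hl dh hM.
have dg z : sq w eta z -> z != w -> cdiff g z.
  move=> zr zw; apply: cdiffM.
    apply: cdiffB.
      by apply: cdiffB; [exact: dh|exact: cdiff_cst].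
    by apply: cdiffM; [exact: cdiff_cst|apply: cdiffB; [exact: cdiff_id|exact: cdiff_cst]].
  apply: cdiffV; first by rewrite expf_neq0// subr_eq0.
  by apply: cdiffM; apply: cdiffB; [exact: cdiff_id|exact: cdiff_cst|exact: cdiff_id|exact: cdiff_cst].
have z1e : sq w eta z1.
  by case: z1q => /andP[? ?] /andP[? ?]; split; apply/andP; split; clear z1w z10 hl dh hM g Nl dg; lra.
have e20 : 0 < eta / 2 by rewrite divr_gt0.
have := @weak_max _ g (g z1) z1 w (Re w - eta) (Re w + eta) (Im w - eta) (Im w + eta) (eta / 2)
  (34 * M / eta ^+ 2) e20.
rewrite (_ : Re w + eta - (Re w - eta) = 2 * eta); last by ring.
rewrite (_ : Im w + eta - (Im w - eta) = 2 * eta); last by ring.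
have -> : 34 * M / eta ^+ 2 * ((2 * eta) ^+ 2 + (2 * eta) ^+ 2) = 1088 * M / eta ^+ 2 * (eta / 2) ^+ 2.
  by field; rewrite gt_eqF.
rewrite ler_pM2r ?exprn_gt0// => H.
have {}H : N (g z1) <= 1088 * M / eta ^+ 2.
  apply: H.
  - by case: z1q => /andP[? ?] _; clear z1w z10 hl dh hM g Nl dg; lra.
  - by case: z1q => _ /andP[? ?]; clear z1w z10 hl dh hM g Nl dg; lra.
  - by split; apply/andP; split; clear z1w z10 hl dh hM g Nl dg; lra.
  - by move=> z zr _ zw; exact: dg.
  - by apply: remov_quot; apply: cdiff_ccont; exact: dg.
  - move=> _ eps eps0; have [t t0 ht] := hl eps eps0; exists t => // z zw zt.
    have z0 : z - w != 0 by rewrite subr_eq0.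
    rewrite -NM (_ : g z * (z - w) = (h z - h w - l * (z - w)) / (z - w)); last first.
      by rewrite /g; field.
    by rewrite NM NV ler_pdivrMr ?N_gt0//; exact: ht.
  - move=> z zb; have [h1 h2] := bdry_square e0 zb.
    have zw : z - w != 0.
      by apply: contraTneq e0 => z0; rewrite z0 N0 in h1; rewrite -leNgt.
    rewrite /g NM NV; apply: ler_pM; rewrite ?N_ge0 ?invr_ge0 ?N_ge0//; last first.
      have q0 : 0 < N ((z - w) ^+ 2) by rewrite N_gt0// expf_neq0.
      by rewrite lef_pV2 ?posrE ?exprn_gt0// !expr2 NM; apply: ler_pM; rewrite ?(ltW e0).
    have k1 : N (l * (z - w)) <= 32 * M.
      rewrite NM (_ : 32 * M = 16 * M / eta * (2 * eta)); last by field; rewrite gt_eqF.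
      by apply: ler_pM; rewrite ?N_ge0.
    have k2 := hM _ zb.1; have k3 := hM _ ww.
    rewrite (le_trans (NB _ _))// (_ : 34 * M = M + M + 32 * M); last by ring.
    by rewrite lerD// (le_trans (NB _ _))// lerD.
have E : h z1 - h w - l * (z1 - w) = g z1 * (z1 - w) ^+ 2 by rewrite /g divfK// expf_neq0.
by rewrite E NM (expr2 (z1 - w)) NM -expr2 ler_wpM2r// sqr_ge0.
Qed.

Lemma max_loop h w a b c d rho M : 0 < rho ->
  a + rho <= Re w <= b - rho -> c + rho <= Im w <= d - rho ->
  (forall z, rect a b c d z -> cdiff h z) -> (forall z, bdry a b c d z -> N (h z) <= M) ->
  N (h w) * rho ^+ 2 <= M * ((b - a) ^+ 2 + (d - c) ^+ 2).
Proof.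
move=> r0 h1 h2 dh hM.
have iw : inrect a b c d w.
  by move: h1 h2 => /andP[? ?] /andP[? ?]; split; apply/andP; split; lra.
apply: (@weak_max _ h (h w) w w a b c d rho M) => //.
- by move=> z zr _ _; exact: dh.
- by apply: remov_quot; apply: cdiff_ccont; apply: dh; exact: inrect_rect.
- by rewrite eqxx.
Qed.

End taylor.

(** * Images of small squares *)

Section square_images.
Variable R : realType.
Local Notation N := (@Normc.normc R).
Local Notation C := R[i].
Local Notation Re := (@complex.Re R).
Local Notation Im := (@complex.Im R).

Lemma N_lip (z w : C) : `|N z - N w| <= N (z - w).
Proof.
rewrite ler_norml NBr andbT lerNl opprB NC; exact: NBr.
Qed.

Lemma ccont_prod (g : C -> C) (F : C -> R) (x y : R) :
  (forall z w, `|F z - F w| <= N (z - w)) -> ccont g (x +i* y) ->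
  {for (x, y), continuous (fun p : R * R => F (g (p.1 +i* p.2)))}.
Proof.
move=> FL gc; apply/cvgrPdist_lt => e e0; have [t t0 ht] := gc e e0.
have t2 : 0 < t / 2 by rewrite divr_gt0.
near=> p.
rewrite (le_lt_trans (FL _ _))// NC ht// (le_lt_trans (N_dist _ _ _ _))// (splitr t) ltrD//.
  near: p; apply: (@cvgr_distC_lt _ _ _ _ _ fst) => //; exact: cvg_fst.
near: p; apply: (@cvgr_distC_lt _ _ _ _ _ snd) => //; exact: cvg_snd.
Unshelve. all: by end_near. Qed.

(** Stated for a 1-Lipschitz [F] so that it serves [N], for minima, as well as [- N], for the
    maximum in [rect_max]. *)
Lemma rect_min (g : C -> C) (F : C -> R) a b c d : a <= b -> c <= d ->
  (forall z w, `|F z - F w| <= N (z - w)) -> ctsr g a b c d ->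
  exists2 w, rect a b c d w & forall z, rect a b c d z -> F (g w) <= F (g z).
Proof.
move=> ab cd FL cg.
have K : compact (`[a, b] `*` `[c, d] : set (R * R)).
  by apply: compact_setX; exact: segment_compact.
have /(_ _)[||[x y]] := compact_EVT_min _ K (f := fun p : R * R => F (g (p.1 +i* p.2))).
- by exists (a, c); split; rewrite /= in_itv/= lexx.
- apply: continuous_in_subspaceT => -[x y]; rewrite inE /= !in_itv/= => -[xa yc].
  exact: (ccont_prod FL (cg (x +i* y) (conj xa yc))).
- rewrite inE /= !in_itv/= => -[xa yc] H; exists (x +i* y) => // -[u v] [/= uab vcd].
  by have := H (u, v); rewrite inE /= !in_itv /=; apply.
Qed.

Lemma rect_max (g : C -> C) a b c d : a <= b -> c <= d -> ctsr g a b c d ->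
  exists M, forall z, rect a b c d z -> N (g z) <= M.
Proof.
move=> ab cd cg.
have [||||w _ hw] := @rect_min g (fun z => - N z) a b c d; rewrite //.
  by move=> z w; rewrite -opprD normrN; exact: N_lip.
by exists (N (g w)) => z /hw; rewrite lerN2.
Qed.

Definition taylor_on (h dh : C -> C) (L : R) (Q : C -> Prop) := forall w z, Q w -> Q z ->
  N (h z - h w - dh w * (z - w)) <= L * N (z - w) ^+ 2.

Lemma taylor_deriv_lip h dh L Q w z : taylor_on h dh L Q -> Q w -> Q z ->
  N (dh z - dh w) <= 2 * L * N (z - w).
Proof.
move=> T qw qz; have [->|zw] := eqVneq z w; first by rewrite !subrr N0 mulr0.
have z0 : z - w != 0 by rewrite subr_eq0.
rewrite -(ler_pM2r (N_gt0 z0)) -NM.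
have -> : (dh z - dh w) * (z - w) =
  (h z - h w - dh w * (z - w)) + (h w - h z - dh z * (w - z)) by ring.
rewrite (le_trans (ND _ _))// (le_trans (lerD (T _ _ qw qz) (T _ _ qz qw)))//.
by rewrite (NC w z) le_eqVlt; apply/orP; left; apply/eqP; ring.
Qed.

(** A quantitative open mapping statement. A point of the closed square minimising the distance from
    [h] to [u] is not on the boundary, where [h] has moved away from [h c] by more than
    [N (dh c) * s / 2]; at an interior minimum with nonzero distance a short Newton step would
    decrease it. *)
Lemma square_image h dh L c s u : 0 < s -> 0 <= L -> taylor_on h dh L (sq c s) ->
  (forall z, sq c s z -> ccont h z) -> 16 * L * s <= N (dh c) -> 0 < N (dh c) ->
  N (u - h c) <= N (dh c) * s / 4 ->
  exists2 z, inrect (Re c - s) (Re c + s) (Im c - s) (Im c + s) z & h z = u.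
Proof.
move=> s0 L0 T ch Ls D0 uc; set D := N (dh c) in Ls D0 uc.
have cc : sq c s c by split; apply/andP; split; lra.
have [||||w wq wmin] := @rect_min (fun z => h z - u) N (Re c - s) (Re c + s) (Im c - s) (Im c + s).
- by lra.
- by lra.
- exact: N_lip.
- by move=> z zq; apply: ccontD; [exact: ch|move=> e e0; exists 1 => // ? _; rewrite subrr N0].
have wc : N (h w - u) <= D * s / 4 by rewrite (le_trans (wmin c cc))// NC.
have wi : inrect (Re c - s) (Re c + s) (Im c - s) (Im c + s) w.
  have [//|nw] := pselect (inrect (Re c - s) (Re c + s) (Im c - s) (Im c + s) w).
  have wb : bdry (Re c - s) (Re c + s) (Im c - s) (Im c + s) w.
    split=> //; case: wq => /andP[a1 a2] /andP[a3 a4].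
    have [?|n1] := eqVneq (Re w) (Re c - s); first by left.
    have [?|n2] := eqVneq (Re w) (Re c + s); first by right; left.
    have [?|n3] := eqVneq (Im w) (Im c - s); first by right; right; left.
    have [?|n4] := eqVneq (Im w) (Im c + s); first by right; right; right.
    by case: nw; split; rewrite !lt_neqAle ?a1 ?a2 ?a3 ?a4 ?n2 ?n4 eq_sym ?n1 ?n3.
  have [k1 k2] := bdry_square s0 wb.
  have := T c w cc wq; set r := N (w - c) in k1 k2 * => Tr.
  have e1 : D * r <= D * s / 2 + L * r ^+ 2.
    rewrite -NM (_ : dh c * (w - c) = (h w - u) + (u - h c) - (h w - h c - dh c * (w - c))); last by ring.
    rewrite (le_trans (NB _ _))// lerD// (le_trans (ND _ _))//.
    by rewrite (_ : D * s / 2 = D * s / 4 + D * s / 4); [exact: lerD|field].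
  have e2 : L * r ^+ 2 <= D * r / 8.
    have r0 : 0 <= r by exact: N_ge0.
    have : L * r <= D / 8.
      have : L * r <= L * (2 * s) by rewrite ler_wpM2l.
      by clear -Ls; lra.
    by rewrite expr2 mulrA => /(ler_wpM2r r0); clear; lra.
  have e3 : D * s <= D * r by rewrite ler_pM2l.
  have e4 : 0 < D * s by rewrite mulr_gt0.
  by clear -e1 e2 e3 e4; lra.
exists w => //; apply/eqP; rewrite -subr_eq0; apply/negPn/negP => n0.
have P0 := N_gt0 n0.
have dw : dh w != 0.
  apply: contraTneq D0 => dw0; rewrite -leNgt.
  have := taylor_deriv_lip T wq cc; rewrite dw0 subr0 -/D (NC c) => h1.
  have h2 : 2 * L * N (w - c) <= 2 * L * (2 * s) by rewrite ler_wpM2l ?mulr_ge0// N_sq.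
  by clear -h1 h2 Ls; lra.
(* The Newton direction. The damping [tau] keeps the new point in the square and makes the quadratic
   error at most half of the linear gain [tau * N (h w - u)]. *)
pose k := - (h w - u) / dh w.
pose K := N k + 1.
have K0 : 0 < K by rewrite ltr_wpDl ?N_ge0.
have [m m0 hm] : exists2 m : R, 0 < m & forall z, N (z - w) <= m -> sq c s z.
  case: wi => /andP[a1 a2] /andP[a3 a4].
  pose m := Num.min (Num.min (Re w - (Re c - s)) (Re c + s - Re w)) (Num.min (Im w - (Im c - s)) (Im c + s - Im w)).
  have [m1 m2 m3 m4] : [/\ m <= Re w - (Re c - s), m <= Re c + s - Re w, m <= Im w - (Im c - s) & m <= Im c + s - Im w].
    by split; rewrite /m !ge_min lexx ?orbT.
  exists m; first by rewrite !lt_min !subr_gt0 a1 a2 a3 a4.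
  move=> z /sq_N[/andP[b1 b2] /andP[b3 b4]]; split; apply/andP; split.
  - by clear -m1 b1; lra.
  - by clear -m2 b2; lra.
  - by clear -m3 b3; lra.
  - by clear -m4 b4; lra.
pose tau := Num.min 1 (Num.min (m / K) (N (h w - u) / (2 * (L + 1) * K ^+ 2))).
have L1 : 0 < L + 1 by clear -L0; lra.
have den : 0 < 2 * (L + 1) * K ^+ 2 by rewrite !mulr_gt0// exprn_gt0.
have tau0 : 0 < tau by rewrite !lt_min ltr01 !divr_gt0.
have [t1 t2 t3] : [/\ tau <= 1, tau <= m / K & tau <= N (h w - u) / (2 * (L + 1) * K ^+ 2)].
  by split; rewrite /tau !ge_min lexx ?orbT.
rewrite ler_pdivlMr// in t2; rewrite ler_pdivlMr// in t3.
pose z := w + tau%:C * k.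
have zw : z - w = tau%:C * k by rewrite /z addrC addKr.
have Nzw : N (z - w) <= tau * K.
  by rewrite zw NM N_real gtr0_norm// ler_wpM2l ?(ltW tau0)// /K lerDl.
have zq : sq c s z by apply: hm; exact: le_trans Nzw t2.
have := wmin z zq; rewrite leNgt => /negP; apply.
have -> : h z - u = (1 - tau)%:C * (h w - u) + (h z - h w - dh w * (z - w)).
  rewrite zw (_ : dh w * (tau%:C * k) = - (tau%:C * (h w - u))); last by rewrite /k; field.
  by rewrite rmorphB rmorph1; ring.
have E1 : N ((1 - tau)%:C * (h w - u)) = (1 - tau) * N (h w - u).
  by rewrite NM N_real ger0_norm// subr_ge0.
have E2 : N (h z - h w - dh w * (z - w)) <= L * (tau * K) ^+ 2.
  rewrite (le_trans (T _ _ wq zq))// ler_wpM2l// ler_sqr ?nnegrE ?N_ge0//.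
  by rewrite mulr_ge0 ?ltW.
have E3 : L * (tau * K) ^+ 2 <= tau * N (h w - u) / 2.
  have : 2 * (L + 1) * K ^+ 2 * tau * tau <= N (h w - u) * tau by rewrite ler_wpM2r ?(ltW tau0)// mulrC.
  have : 0 <= tau ^+ 2 * K ^+ 2 by rewrite mulr_ge0 ?sqr_ge0.
  rewrite exprMn; move: (K ^+ 2) (N _) => KK NN; clear; set q := tau ^+ 2 * KK => q0.
  have -> : 2 * (L + 1) * KK * tau * tau = 2 * L * q + 2 * q by rewrite /q; ring.
  lra.
have E4 : 0 < tau * N (h w - u) by rewrite mulr_gt0.
rewrite (le_lt_trans (ND _ _))// E1 mulrBl mul1r.
by move: E2 E3 E4; clear; lra.
Qed.
End square_images.

(** * The length-area estimate *)

Section boxes.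
Variable R : realType.
Local Notation N := (@Normc.normc R).
Local Notation leb := (@lebesgue_measure R).

Lemma measure_disjoint_seq d (T : measurableType d) (mu : {measure set T -> \bar R})
  (I : choiceType) (P : pred I) (F : I -> set T) (r : seq I) : uniq r ->
  (forall i, P i -> measurable (F i)) ->
  (forall i j x, P i -> P j -> F i x -> F j x -> i = j) ->
  (\sum_(i <- r | P i) mu (F i) = mu (\big[setU/set0]_(i <- r | P i) F i))%E.
Proof.
move=> + mF tF; elim: r => [|i r IH] /=; first by rewrite !big_nil measure0.
move=> /andP[ir /IH E]; rewrite !big_cons; case: ifP => // Pi.
rewrite E measureU//; [exact: mF| |].
  by apply: bigsetU_measurable => j /mF.
rewrite -subset0 => x [xi].
rewrite -bigcup_seq_cond => -[j /= /andP[jr Pj] xj].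
by rewrite (tF i j x Pi Pj xi xj) jr in ir.
Qed.

(** A packing bound by additivity of planar Lebesgue measure. The control of the area of the image
    of [h] enters the length-area estimate only through it. *)
Lemma disjoint_boxes (I : finType) (P : pred I) (cx cy q : I -> R) T : 0 <= T ->
  (forall p, P p -> 0 <= q p) ->
  (forall p p' u v, P p -> P p' -> `|u - cx p| <= q p -> `|v - cy p| <= q p ->
     `|u - cx p'| <= q p' -> `|v - cy p'| <= q p' -> p = p') ->
  (forall p, P p -> `|cx p| + q p <= T /\ `|cy p| + q p <= T) ->
  \sum_(p | P p) (2 * q p) ^+ 2 <= (2 * T) ^+ 2.
Proof.
move=> T0 q0 dis inT.
pose box (x y r : R) : set (R * R) := `[x - r, x + r] `*` `[y - r, y + r].
have mbox x y r : measurable (box x y r) by apply: measurableX; exact: measurable_itv.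
have li (x r : R) : 0 <= r -> leb `[x - r, x + r] = (2 * r)%:E.
  move=> r0; rewrite lebesgue_measure_itv/= lte_fin ltrD2l.
  have [r00|r00] := ltP (- r) r; last first.
    have -> : r = 0 by lra.
    by rewrite mulr0.
  by rewrite -EFinB; congr EFin; ring.
have abox x y r : 0 <= r -> lebesgue2 R (box x y r) = ((2 * r) ^+ 2)%:E.
  move=> r0; rewrite /lebesgue2 product_measure1E; [|exact: measurable_itv..].
  transitivity ((2 * r)%:E * (2 * r)%:E)%E; last by rewrite -EFinM -expr2.
  by congr mule; exact: li.
have inbox x y r u v : box x y r (u, v) <-> `|u - x| <= r /\ `|v - y| <= r.
  by rewrite /box /= !in_itv/= !ler_distl.
rewrite -lee_fin -sumEFin -(abox 0 0 T T0).
have -> : (\sum_(p | P p) ((2 * q p) ^+ 2)%:E =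
    lebesgue2 R (\big[setU/set0]_(p | P p) box (cx p) (cy p) (q p)))%E.
  have -> : (\sum_(p | P p) ((2 * q p) ^+ 2)%:E = \sum_(p | P p) lebesgue2 R (box (cx p) (cy p) (q p)))%E.
    by apply: eq_bigr => p Pp; rewrite abox// q0.
  apply: measure_disjoint_seq.
  - exact: index_enum_uniq.
  - by move=> p _; exact: mbox.
  - by move=> i j [u v] Pi Pj /inbox[? ?] /inbox[? ?]; exact: (dis i j u v).
apply: le_measure; rewrite ?inE; [by apply: bigsetU_measurable => j _; exact: mbox|exact: mbox|].
rewrite -bigcup_seq_cond => -[u v] [p /= /andP[_ Pp] /inbox[h1 h2]].
apply/inbox; rewrite !subr0; have [k1 k2] := inT p Pp; split.
  by rewrite (le_trans _ k1)// -{1}(subrK (cx p) u) addrC (le_trans (ler_normD _ _))// lerD2l.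
by rewrite (le_trans _ k2)// -{1}(subrK (cy p) v) addrC (le_trans (ler_normD _ _))// lerD2l.
Qed.

Lemma telescope_le (u : nat -> R) n m K : (n <= K)%N -> (m <= K)%N ->
  u m - u n <= \sum_(i < K) `|u i.+1 - u i|.
Proof.
have key n' m' : (n' <= m')%N -> (m' <= K)%N -> `|u m' - u n'| <= \sum_(i < K) `|u i.+1 - u i|.
  move=> nm mK; rewrite -telescope_sumr// (le_trans (ler_norm_sum _ _ _))//.
  rewrite -(big_mkord xpredT (fun i => `|u i.+1 - u i|)).
  rewrite (big_cat_nat (leq0n n') (leq_trans nm mK))/= (big_cat_nat nm mK)/=.
  by rewrite addrCA lerDl addr_ge0// sumr_ge0.
move=> nK mK; rewrite (le_trans (ler_norm _))//.
by have [nm|/ltnW mn] := leqP n m; [exact: key|rewrite distrC; exact: key].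
Qed.

(** Truncation to [[A, B]]: it makes a function constant off one dyadic level, so that the variation
    is charged to the cells of that level alone. *)
Definition clamp (A B v : R) := Num.min (Num.max v A) B.
Lemma clamp_lip A B v w : A <= B -> `|clamp A B v - clamp A B w| <= `|v - w|.
Proof.
move=> AB; rewrite /clamp; set x := Num.max v A; set y := Num.max w A.
apply: (@le_trans _ _ `|x - y|).
  case: (leP x B) => ?; case: (leP y B) => ? //.
  - by rewrite distrC [leRHS]distrC !ger0_norm; lra.
  - by rewrite !ger0_norm; lra.
  - by rewrite subrr normr0.
rewrite /x /y; case: (leP v A) => ?; case: (leP w A) => ? //.
- by rewrite subrr normr0.
- by rewrite distrC [leRHS]distrC !ger0_norm; lra.
- by rewrite !ger0_norm; lra.
Qed.
Lemma clamp_low A B v : A <= B -> v <= A -> clamp A B v = A.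
Proof. by move=> AB vA; rewrite /clamp max_r// min_l. Qed.
Lemma clamp_high A B v : A <= B -> B <= v -> clamp A B v = B.
Proof. by move=> AB Bv; rewrite /clamp max_l ?(le_trans AB)// min_r. Qed.
End boxes.

(** * Counting crossing rows on a grid *)

Section cells.
Variable R : realType.
Local Notation N := (@Normc.normc R).
Local Notation C := R[i].
Local Notation Re := (@complex.Re R).
Local Notation Im := (@complex.Im R).

Lemma locate (a s x : R) n : 0 < s -> (0 < n)%N -> a <= x <= a + n%:R * s ->
  exists2 i : 'I_n, true & a + i%:R * s <= x <= a + i.+1%:R * s.
Proof.
case: n => // n s0 _ /andP[ax xn].
have q0 : 0 <= (x - a) / s by rewrite divr_ge0 ?subr_ge0// ltW.
have /andP[h1 h2] := truncn_itv q0; set t := Num.trunc _ in h1 h2.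
rewrite ler_pdivlMr// in h1; rewrite ltr_pdivrMr// in h2.
have [tn|nt] := ltnP t n.+1.
  by exists (Ordinal tn) => //=; clear -h1 h2; lra.
exists ord_max => //=; rewrite xn andbT.
have : (n%:R : R) <= t%:R by rewrite ler_nat ltnW.
by move=> /(ler_wpM2r (ltW s0)); clear -h1; lra.
Qed.

Lemma cReE (x y : R) : Re (x +i* y) = x. Proof. by []. Qed.
Lemma cImE (x y : R) : Im (x +i* y) = y. Proof. by []. Qed.

Section grid.
Variables (h dh : C -> C) (a c s L tau : R) (n m k : nat).
Definition ct (i j : nat) : C := (a + (i%:R + 2^-1) * s) +i* (c + (j%:R + 2^-1) * s).
Let D i j := N (dh (ct i j)).
(** A bound for the deviation of [N (h z)] from its central value, since points of a cell are within
    [s] of its centre. It plays the role of |h'| times the side, with the Taylor error included. *)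
Let dd i j := D i j * s + L * s ^+ 2.
Let v i j := N (h (ct i j)).
Definition lev l i j := (2 ^+ l * tau <= v i j) && (v i j < 2 ^+ l.+1 * tau).

Hypothesis s0 : 0 < s.
Hypothesis L0 : 0 <= L.
Hypothesis tau0 : 0 < tau.
Hypothesis n0 : (0 < n)%N.
Hypothesis k0 : (0 < k)%N.
Hypothesis Hc : ctsr h a (a + n%:R * s) c (c + m%:R * s).
Hypothesis HT : forall (i : 'I_n) (j : 'I_m), taylor_on h dh L (sq (ct i j) (s / 2)).
Hypothesis Hosc : forall (i : 'I_n) (j : 'I_m), N (dh (ct i j)) * s + L * s ^+ 2 <= tau / 16.
Hypothesis Hinj : forall z w, inrect a (a + n%:R * s) c (c + m%:R * s) z ->
  inrect a (a + n%:R * s) c (c + m%:R * s) w -> h z = h w -> z = w.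
(** Cells with small derivative provide no image box, but their [dd] is at most [9 * L * s ^+ 2];
    this hypothesis bounds the sum of its squares over the whole grid by [tau ^+ 2]. *)
Hypothesis Hsmall : 81 * L ^+ 2 * s ^+ 2 * (n%:R * s * (m%:R * s)) <= tau ^+ 2.

Lemma cell_sq (i j : nat) (x y : R) : a + i%:R * s <= x <= a + i.+1%:R * s ->
  c + j%:R * s <= y <= c + j.+1%:R * s -> sq (ct i j) (s / 2) (x +i* y).
Proof.
rewrite -[i.+1%:R]natr1 -[j.+1%:R]natr1 => /andP[h1 h2] /andP[h3 h4]; rewrite /sq /rect !cReE !cImE.
by split; apply/andP; split; lra.
Qed.

Lemma cell_rect (i : 'I_n) (j : 'I_m) z : sq (ct i j) (s / 2) z ->
  rect a (a + n%:R * s) c (c + m%:R * s) z.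
Proof.
rewrite /sq /rect /inrect !cReE !cImE => -[/andP[h1 h2] /andP[h3 h4]].
have i0 : 0 <= (i%:R : R) * s by rewrite mulr_ge0 ?(ltW s0).
have j0 : 0 <= (j%:R : R) * s by rewrite mulr_ge0 ?(ltW s0).
have i1 : (i.+1%:R : R) * s <= n%:R * s by rewrite ler_wpM2r ?ler_nat ?(ltW s0).
have j1 : (j.+1%:R : R) * s <= m%:R * s by rewrite ler_wpM2r ?ler_nat ?(ltW s0).
rewrite -!natr1 in i1 j1.
by split; apply/andP; split; lra.
Qed.

Lemma cell_inrect (i : 'I_n) (j : 'I_m) z :
  inrect (Re (ct i j) - s / 2) (Re (ct i j) + s / 2) (Im (ct i j) - s / 2) (Im (ct i j) + s / 2) z ->
  inrect a (a + n%:R * s) c (c + m%:R * s) z.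
Proof.
rewrite /sq /rect /inrect !cReE !cImE => -[/andP[h1 h2] /andP[h3 h4]].
have i0 : 0 <= (i%:R : R) * s by rewrite mulr_ge0 ?(ltW s0).
have j0 : 0 <= (j%:R : R) * s by rewrite mulr_ge0 ?(ltW s0).
have i1 : (i.+1%:R : R) * s <= n%:R * s by rewrite ler_wpM2r ?ler_nat ?(ltW s0).
have j1 : (j.+1%:R : R) * s <= m%:R * s by rewrite ler_wpM2r ?ler_nat ?(ltW s0).
rewrite -!natr1 in i1 j1.
by split; apply/andP; split; lra.
Qed.

Lemma cell_disj (i i' j j' : nat) z :
  inrect (Re (ct i j) - s / 2) (Re (ct i j) + s / 2) (Im (ct i j) - s / 2) (Im (ct i j) + s / 2) z ->
  inrect (Re (ct i' j') - s / 2) (Re (ct i' j') + s / 2) (Im (ct i' j') - s / 2) (Im (ct i' j') + s / 2) z ->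
  i = i' /\ j = j'.
Proof.
have key (p q : nat) (t u : R) : t + (p%:R + 2^-1) * s - s / 2 < u ->
   u < t + (q%:R + 2^-1) * s + s / 2 -> (p <= q)%N.
  move=> h1 h2; rewrite -ltnS -(ltr_nat R) -(ltr_pM2r s0) -natr1.
  by lra.
rewrite /inrect !cReE !cImE => -[/andP[h1 h2] /andP[h3 h4]] [/andP[h5 h6] /andP[h7 h8]].
split; apply/eqP; rewrite eqn_leq; apply/andP; split.
- exact: key h1 h6.
- exact: key h5 h2.
- exact: key h3 h8.
- exact: key h7 h4.
Qed.

Lemma cell_osc (i : 'I_n) (j : 'I_m) z : sq (ct i j) (s / 2) z -> `|N (h z) - v i j| <= dd i j.
Proof.
move=> zq; apply: le_trans (N_lip _ _) _; have s0' := s0.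
have cc : sq (ct i j) (s / 2) (ct i j).
  by rewrite /sq /rect; split; apply/andP; split; lra.
have Nz : N (z - ct i j) <= s by have := N_sq zq; rewrite mulrC divfK.
rewrite -(subrK (dh (ct i j) * (z - ct i j)) (h z - h (ct i j))).
rewrite (le_trans (ND _ _))// addrC lerD//.
  by rewrite NM ler_wpM2l// N_ge0.
rewrite (le_trans (HT cc zq))// ler_wpM2l// ler_sqr// nnegrE ?N_ge0//.
exact: ltW.
Qed.

(** Along the row the modulus must traverse the middle half of the level, from 5/4 to 7/4 of [tl].
    The margins [tl / 4] exceed the deviation within a cell, at most [tau / 16], so a cell whose
    centre is outside the level does not move the truncated modulus at all. *)
Lemma row_level (j : 'I_m) y x x' l : (l < k)%N -> c + j%:R * s <= y <= c + j.+1%:R * s ->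
  a <= x <= a + n%:R * s -> a <= x' <= a + n%:R * s ->
  2 ^+ k * tau <= N (h (x +i* y)) -> N (h (x' +i* y)) <= tau ->
  2 ^+ l * tau / 2 <= \sum_(i < n | lev l i j) 2 * dd i j.
Proof.
move=> lk yj xa xa' hx hx'; have s0' := s0; have tau0' := tau0.
set tl := 2 ^+ l * tau.
have tl1 : tau <= tl by rewrite /tl ler_peMl ?(ltW tau0)// exprn_ege1// ler1n.
have tl2 : 2 * tl <= 2 ^+ k * tau.
  by rewrite /tl mulrA -exprS ler_wpM2r ?(ltW tau0)// ler_weXn2l// ler1n.
have [i1 _ hi1] := locate s0 n0 xa; have [i0 _ hi0] := locate s0 n0 xa'.
(* Samples of the row at the vertical grid lines. Consecutive samples belong to one cell and both
   lie within [dd] of its central value, hence the factor 2 in the conclusion. *)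
pose X (i : nat) := a + i%:R * s.
pose V i := N (h (X i +i* y)).
pose A := 5 / 4 * tl; pose B := 7 / 4 * tl.
have AB : A <= B by rewrite /A /B; lra.
pose u i := clamp A B (V i).
have ls (i : nat) : X i <= X i.+1 by rewrite /X -natr1; lra.
have oV (i : 'I_n) : `|V i - v i j| <= dd i j /\ `|V i.+1 - v i j| <= dd i j.
  by split; apply: cell_osc; apply: cell_sq => //; rewrite lexx ls.
have u0 : u i0 = A.
  apply: clamp_low => //.
  have := cell_osc (cell_sq hi0 yj); have [+ _] := oV i0; have := Hosc i0 j.
  rewrite -/(dd i0 j) /A; move: hx'; set p := N _.
  rewrite !ler_norml => ? ? /andP[? ?] /andP[? ?]; lra.
have u1 : u i1 = B.
  apply: clamp_high => //.
  have := cell_osc (cell_sq hi1 yj); have [+ _] := oV i1; have := Hosc i1 j.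
  rewrite -/(dd i1 j) /B; move: hx; set p := N _.
  rewrite !ler_norml => ? ? /andP[? ?] /andP[? ?]; lra.
have := @telescope_le _ u i0 i1 n (ltnW (ltn_ord _)) (ltnW (ltn_ord _)).
rewrite u0 u1 => T.
have -> : tl / 2 = B - A by rewrite /A /B; field.
rewrite (le_trans T)// [leRHS]big_mkcond/=; apply: ler_sum => i _.
have [w1 w2] := oV i; have w3 : dd i j <= tau / 16 by exact: Hosc.
case: ifPn => [_|nl].
  rewrite (le_trans (clamp_lip _ _ AB))//.
  by move: w1 w2; rewrite !ler_norml => /andP[? ?] /andP[? ?]; apply/andP; split; lra.
rewrite le_eqVlt; apply/orP; left; apply/eqP.
move: nl; rewrite /lev negb_and -!ltNge -leNgt exprS -mulrA -/tl => /orP[nl|nl].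
  rewrite /u !clamp_low ?subrr ?normr0// /A.
    by move: w1; rewrite ler_norml => /andP[? ?]; lra.
  by move: w2; rewrite ler_norml => /andP[? ?]; lra.
rewrite /u !clamp_high ?subrr ?normr0// /B.
  by move: w1; rewrite ler_norml => /andP[? ?]; lra.
by move: w2; rewrite ler_norml => /andP[? ?]; lra.
Qed.

(** Where [D] dominates the Taylor error, the image of the cell contains a box of half-side
    [D * s / 16]. By injectivity these boxes are disjoint, and at level [l] they lie in a square of
    half-side [3 * tl]. As [dd ^+ 2] is at most 128 times the area of the box, up to the error term,
    they contribute at most 128 * 36 = 4608 times [tl ^+ 2]; the remaining 1 comes from [Hsmall]. *)
Lemma level_area l :
  \sum_(p : 'I_n * 'I_m | lev l p.1 p.2) (dd p.1 p.2) ^+ 2 <= 4609 * (2 ^+ l * tau) ^+ 2.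
Proof.
have s0' := s0; have tau0' := tau0; have L0' := L0.
set tl := 2 ^+ l * tau.
have tl1 : tau <= tl by rewrite /tl ler_peMl ?(ltW tau0)// exprn_ege1// ler1n.
(* The threshold [8 * L * s] is the hypothesis [16 * L * s <= N (dh c)] of [square_image] for
   squares of half-side [s / 2]. *)
pose P (p : 'I_n * 'I_m) := lev l p.1 p.2 && (8 * L * s <= D p.1 p.2) && (0 < D p.1 p.2).
pose q (p : 'I_n * 'I_m) := D p.1 p.2 * s / 16.
have D0 i j : 0 <= D i j by exact: N_ge0.
have q0 p : 0 <= q p by rewrite /q divr_ge0// mulr_ge0// ltW.
have box : \sum_(p | P p) (2 * q p) ^+ 2 <= (2 * (3 * tl)) ^+ 2.
  apply: (@disjoint_boxes _ _ P (fun p => Re (h (ct p.1 p.2))) (fun p => Im (h (ct p.1 p.2)))).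
  - by lra.
  - by move=> p _; exact: q0.
  - have img p u w : P p -> `|u - Re (h (ct p.1 p.2))| <= q p -> `|w - Im (h (ct p.1 p.2))| <= q p ->
      exists2 z, inrect (Re (ct p.1 p.2) - s / 2) (Re (ct p.1 p.2) + s / 2)
        (Im (ct p.1 p.2) - s / 2) (Im (ct p.1 p.2) + s / 2) z & h z = u +i* w.
      move=> /andP[/andP[_ p1] p2] hu hw.
      apply: (square_image _ L0 (@HT p.1 p.2)); rewrite ?divr_gt0//.
      - by move=> z /cell_rect; exact: Hc.
      - by rewrite -/(D p.1 p.2); lra.
      - rewrite -/(D p.1 p.2) (le_trans (N_le _))//.
        have -> : Re (u +i* w - h (ct p.1 p.2)) = u - Re (h (ct p.1 p.2)) by case: (h _).
        have -> : Im (u +i* w - h (ct p.1 p.2)) = w - Im (h (ct p.1 p.2)) by case: (h _).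
        by rewrite (le_trans (lerD hu hw))// /q; lra.
    move=> p p' u w Pp Pp' h1 h2 h3 h4.
    have [z zi hz] := img p u w Pp h1 h2; have [z' zi' hz'] := img p' u w Pp' h3 h4.
    have E : z = z'.
      by apply: Hinj; [exact: cell_inrect zi|exact: cell_inrect zi'|rewrite hz hz'].
    rewrite -E in zi'; have [e1 e2] := cell_disj zi zi'.
    by case: p p' e1 e2 {Pp Pp' h1 h2 h3 h4 zi hz zi' hz'} => [i j] [i' j'] /= /val_inj -> /val_inj ->.
  - move=> p /andP[/andP[/andP[_ pv] _] _].
    have qs : q p <= tau / 16.
      have := Hosc p.1 p.2; rewrite -/(D p.1 p.2) /q.
      have : 0 <= L * s ^+ 2 by rewrite mulr_ge0// sqr_ge0.
      have : 0 <= D p.1 p.2 * s by rewrite mulr_ge0// ltW.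
      lra.
    rewrite exprS -mulrA -/tl in pv.
    have := N_Re (h (ct p.1 p.2)); have := N_Im (h (ct p.1 p.2)); rewrite -/(v p.1 p.2).
    by split; lra.
pose err := 81 * L ^+ 2 * s ^+ 2 * (s ^+ 2).
have err0 : 0 <= err by rewrite /err mulr_ge0 ?sqr_ge0 // mulr_ge0 ?sqr_ge0 // mulr_ge0 ?sqr_ge0.
have pw (p : 'I_n * 'I_m) : lev l p.1 p.2 -> (dd p.1 p.2) ^+ 2 <= (if P p then 128 * (2 * q p) ^+ 2 else 0) + err.
  move=> lp; case: ifPn => [/andP[/andP[_ p1] p2]|].
    have : dd p.1 p.2 <= D p.1 p.2 * s * (9 / 8).
      have : 8 * L * s * s <= D p.1 p.2 * s by rewrite ler_wpM2r ?(ltW s0).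
      by rewrite /dd expr2; lra.
    have Ds0 : 0 <= D p.1 p.2 * s by rewrite mulr_ge0// ltW.
    have dd0 : 0 <= dd p.1 p.2 by rewrite addr_ge0// mulr_ge0// sqr_ge0.
    move=> h1; have : dd p.1 p.2 ^+ 2 <= (D p.1 p.2 * s * (9 / 8)) ^+ 2.
      by rewrite ler_sqr ?nnegrE// mulr_ge0//; lra.
    have -> : 128 * (2 * q p) ^+ 2 = 2 * (D p.1 p.2 * s) ^+ 2 by rewrite /q; field.
    have : 0 <= (D p.1 p.2 * s) ^+ 2 by rewrite sqr_ge0.
    rewrite [(_ * (9 / 8)) ^+ 2]exprMn; lra.
  rewrite /P lp /= negb_and -ltNge -leNgt => nP.
  have Dle : D p.1 p.2 <= 8 * L * s.
    case/orP: nP => [/ltW//|]; move/le_trans; apply.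
    by rewrite !mulr_ge0// ltW.
  have : dd p.1 p.2 <= 9 * L * s * s.
    have : D p.1 p.2 * s <= 8 * L * s * s by rewrite ler_wpM2r ?(ltW s0).
    by rewrite /dd expr2; lra.
  have dd0 : 0 <= dd p.1 p.2 by rewrite addr_ge0 ?mulr_ge0 ?sqr_ge0// ltW.
  rewrite add0r (_ : err = (9 * L * s * s) ^+ 2); last by rewrite /err; ring.
  by move=> h1; rewrite ler_sqr ?nnegrE// !mulr_ge0// ltW.
apply: le_trans (ler_sum _ pw) _; rewrite big_split/=.
have -> : 4609 * tl ^+ 2 = 4608 * tl ^+ 2 + tl ^+ 2 by ring.
apply: lerD.
  apply: (@le_trans _ _ (\sum_(p | P p) 128 * (2 * q p) ^+ 2)).
    rewrite [leRHS]big_mkcond [leLHS]big_mkcond/=; apply: ler_sum => p _.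
    by case: ifP => // lp; case: ifP => // _; rewrite mulr_ge0// sqr_ge0.
  rewrite -mulr_sumr (_ : 4608 * tl ^+ 2 = 128 * (2 * (3 * tl)) ^+ 2); last by ring.
  by rewrite ler_pM2l.
apply: (@le_trans _ _ (tau ^+ 2)); last by rewrite ler_sqr ?nnegrE//; lra.
apply: le_trans Hsmall.
apply: (@le_trans _ _ (\sum_(p : 'I_n * 'I_m) err)).
  by rewrite [leLHS]big_mkcond/=; apply: ler_sum => p _; case: ifP.
rewrite sumr_const card_prod !card_ord -[err *+ _]mulr_natr natrM /err.
by rewrite le_eqVlt; apply/orP; left; apply/eqP; ring.
Qed.

Lemma lev_uniq (i : 'I_n) (j : 'I_m) : \sum_(l < k | lev l i j) (1 : R) <= 1.
Proof.
have [[l0 hl0]|none] := pselect (exists l : 'I_k, lev l i j); last first.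
  by rewrite big_pred0// => l; apply/negP => hl; apply: none; exists l.
rewrite (bigD1 l0)//= big_pred0 ?addr0// => l; apply/negP => /andP[/andP[h1 h2] /negP].
apply; apply/eqP/val_inj/eqP => /=; move/andP: hl0 => [h3 h4].
have key (p q : nat) : 2 ^+ p * tau <= v i j -> v i j < 2 ^+ q.+1 * tau -> (p <= q)%N.
  move=> g1 g2; rewrite -ltnS -(@ltr_eXn2l R 2) ?ltr1n//.
  by rewrite -(ltr_pM2r tau0) (le_lt_trans g1).
by rewrite eqn_leq (key _ _ h1 h4) (key _ _ h3 h2).
Qed.

Definition crossing_row (j : 'I_m) := exists y x x',
  [/\ c + j%:R * s <= y <= c + j.+1%:R * s, a <= x <= a + n%:R * s, a <= x' <= a + n%:R * s,
  2 ^+ k * tau <= N (h (x +i* y)) & N (h (x' +i* y)) <= tau].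

(** Length-area in discrete form: the sum [S j] of squared normalised oscillations is at least
    [k ^+ 2 / (16 * n)] in a crossing row, while by [level_area] the sum over all rows and all [k]
    levels is at most [4609 * k]. *)
Lemma rows_count (J : pred 'I_m) : (forall j, J j -> crossing_row j) ->
  #|J|%:R * k%:R <= 16 * 4609 * n%:R :> R.
Proof.
move=> HJ.
have kR : 0 < k%:R :> R by rewrite ltr0n.
have nR : 0 < n%:R :> R by rewrite ltr0n.
pose tl l : R := 2 ^+ l * tau.
have tl0 l : 0 < tl l by rewrite mulr_gt0// exprn_gt0.
pose S (j : 'I_m) := \sum_(l < k) \sum_(i < n | lev l i j) (dd i j / tl l) ^+ 2.
(* Cauchy-Schwarz is used in the form 4 X <= 4 lam X^2 + 1 / lam. A cell has at most one level, so
   the terms [lam^-1] add up to at most [n%:R / lam]; this choice makes that [k%:R / 2], half of the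
   left-hand side. *)
pose lam : R := 2 * n%:R / k%:R.
have lam0 : 0 < lam by rewrite divr_gt0// mulr_gt0.
have row j : J j -> k%:R ^+ 2 / (16 * n%:R) <= S j.
  move=> /HJ[y [x [x' [yj xa xa' hx hx']]]].
  have lv (l : 'I_k) : 1 <= \sum_(i < n | lev l i j) (4 * lam * (dd i j / tl l) ^+ 2 + lam^-1).
    have := row_level (ltn_ord l) yj xa xa' hx hx'; rewrite -/(tl l) => T.
    apply: (@le_trans _ _ (\sum_(i < n | lev l i j) 4 * (dd i j / tl l))).
      move: T; rewrite -(ler_pM2r (_ : 0 < 2 / tl l)) ?divr_gt0// mulr_suml.
      rewrite (_ : tl l / 2 * (2 / tl l) = 1); last by field; rewrite gt_eqF.
      move=> /le_trans; apply; rewrite le_eqVlt; apply/orP; left; apply/eqP.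
      by apply: eq_bigr => i _; ring.
    apply: ler_sum => i _; set X := _ / _.
    rewrite -subr_ge0 (_ : _ - _ = lam^-1 * (2 * lam * X - 1) ^+ 2); last first.
      by field; rewrite gt_eqF.
    by rewrite mulr_ge0 ?sqr_ge0// invr_ge0 ltW.
  have : k%:R <= \sum_(l < k) \sum_(i < n | lev l i j) (4 * lam * (dd i j / tl l) ^+ 2 + lam^-1).
    apply: (@le_trans _ _ (\sum_(l < k) 1)); first by rewrite sumr_const card_ord.
    by apply: ler_sum.
  under eq_bigr => l _ do rewrite big_split/= -mulr_sumr.
  rewrite big_split/= -mulr_sumr -/(S j).
  have : \sum_(l < k) \sum_(i < n | lev l i j) lam^-1 <= n%:R * lam^-1.
    under eq_bigr => l _ do rewrite big_mkcond/=.
    rewrite exchange_big/=.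
    apply: (@le_trans _ _ (\sum_(i < n) lam^-1)); last by rewrite sumr_const card_ord mulr_natl.
    apply: ler_sum => i _; rewrite -big_mkcond/=.
    rewrite (eq_bigr (fun=> lam^-1 * 1)); last by move=> ? _; rewrite mulr1.
    rewrite -mulr_sumr -[leRHS]mulr1 ler_wpM2l ?invr_ge0 ?(ltW lam0)//.
    exact: lev_uniq.
  have -> : n%:R * lam^-1 = k%:R / 2 by rewrite /lam; field; rewrite !gt_eqF.
  move=> h1 h2.
  have h3 : k%:R / 2 <= 4 * lam * S j by lra.
  rewrite ler_pdivrMr ?mulr_gt0//.
  have : k%:R / 2 * (2 * k%:R) <= 4 * lam * S j * (2 * k%:R) by rewrite ler_wpM2r ?mulr_ge0// ltW.
  rewrite (_ : 4 * lam * S j * (2 * k%:R) = S j * (16 * n%:R)); last first.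
    by rewrite /lam; field; rewrite gt_eqF.
  by rewrite (_ : k%:R / 2 * (2 * k%:R) = k%:R ^+ 2)//; field.
have tot : \sum_(j < m) S j <= 4609 * k%:R :> R.
  rewrite /S exchange_big/=.
  apply: (@le_trans _ _ (\sum_(l < k) 4609)); last by rewrite sumr_const card_ord mulr_natr.
  apply: ler_sum => l _.
  have := level_area l; rewrite -/(tl l) => LA.
  rewrite -(ler_pM2r (_ : 0 < tl l ^+ 2)) ?exprn_gt0// (le_trans _ LA)//.
  rewrite mulr_suml.
  rewrite [leRHS](eq_bigl (fun p : 'I_n * 'I_m => xpredT p.1 && lev l p.1 p.2))//.
  rewrite -(pair_big_dep xpredT (fun (i : 'I_n) (j : 'I_m) => lev l i j) (fun (i : 'I_n) (j : 'I_m) => dd i j ^+ 2))/=.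
  rewrite [leRHS](exchange_big_dep xpredT)//=.
  apply: ler_sum => j _; rewrite mulr_suml; apply: ler_sum => i _.
  by rewrite expr_div_n divfK// expf_neq0// gt_eqF.
have : \sum_(j | J j) k%:R ^+ 2 / (16 * n%:R) <= 4609 * k%:R :> R.
  apply: le_trans tot; rewrite big_mkcond/=; apply: ler_sum => j _.
  case: ifP => [/row//|_]; rewrite /S; apply: sumr_ge0 => l _; apply: sumr_ge0 => i _.
  exact: sqr_ge0.
have -> : \sum_(j | J j) k%:R ^+ 2 / (16 * n%:R) = #|J|%:R * (k%:R ^+ 2 / (16 * n%:R)) :> R.
  by rewrite sumr_const; exact/esym/mulr_natl.
rewrite mulrA ler_pdivrMr ?mulr_gt0// expr2 mulrA => h1.
rewrite -(ler_pM2r kR) (le_trans h1)//.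
by rewrite le_eqVlt; apply/orP; left; apply/eqP; ring.
Qed.
End grid.
End cells.

Section length_area.
Variable R : realType.
Local Notation N := (@Normc.normc R).
Local Notation C := R[i].
Local Notation Re := (@complex.Re R).
Local Notation Im := (@complex.Im R).
Local Notation leb := (@lebesgue_measure R).

Lemma itv_length (x y : R) : x <= y -> leb `[x, y] = (y - x)%:E.
Proof.
move=> xy; rewrite lebesgue_measure_itv/= lte_fin; have [?|yx] := ltP x y; first by rewrite -EFinB.
have -> : y = x by apply/eqP; rewrite eq_le xy yx.
by rewrite subrr.
Qed.

Definition rows (c s : R) m (J : pred 'I_m) : set R :=
  \big[setU/set0]_(j < m | J j) `[c + j%:R * s, c + j.+1%:R * s]%classic.

Lemma rows_measure (c s : R) m (J : pred 'I_m) : 0 <= s ->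
  (leb (rows c s J) <= (#|J|%:R * s)%:E)%E.
Proof.
move=> s0; apply: (@le_trans _ _ (\sum_(j < m | J j) s%:E)%E); last first.
  by rewrite sumEFin lee_fin sumr_const mulr_natl.
suff [] : measurable (rows c s J) /\
  (leb (rows c s J) <= \sum_(j < m | J j) s%:E)%E by [].
apply: (@big_rec2 _ _ (fun (A : set R) x => measurable A /\ (leb A <= x)%E)).
  by rewrite measure0; split.
move=> j x A Jj [mA IH]; split; first by apply: measurableU => //; exact: measurable_itv.
apply: le_trans (measureU2 _ _ _) _; [exact: measurable_itv|exact: mA|].
have E : leb `[c + j%:R * s, c + j.+1%:R * s] = s%:E.
  by rewrite itv_length -[j.+1%:R]natr1; [congr EFin; ring|lra].
by apply: leeD IH; move: E => /= ->.
Qed.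

(** The mesh [s] divides the width exactly but not the height. The strip left over at the top is put
    into [B]; with at least [k] columns its height is at most [(b - a) / k%:R], which is absorbed by
    passing from 4609 to 4610. *)
Lemma length_area (h dh : C -> C) a b c d L eta tau k : a < b -> c < d -> 0 <= L -> 0 < eta ->
  0 < tau -> (0 < k)%N -> ctsr h a b c d ->
  (forall w z, rect a b c d w -> rect a b c d z -> N (z - w) <= eta ->
    N (h z - h w - dh w * (z - w)) <= L * N (z - w) ^+ 2) ->
  (forall z w, inrect a b c d z -> inrect a b c d w -> h z = h w -> z = w) ->
  exists B : set R, [/\ measurable B, (leb B <= (16 * 4610 * (b - a) / k%:R)%:E)%E &
    forall y x x', c <= y <= d -> a <= x <= b -> a <= x' <= b ->
      2 ^+ k * tau <= N (h (x +i* y)) -> N (h (x' +i* y)) <= tau -> B y].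
Proof.
move=> ab cd L0 eta0 tau0 k0 ch T inj.
have [M hM] := rect_max (ltW ab) (ltW cd) ch.
pose r := Num.min eta ((b - a) / 2).
have r0 : 0 < r by rewrite lt_min eta0 divr_gt0// subr_gt0.
have [re rab] : r <= eta /\ r <= (b - a) / 2 by rewrite /r !ge_min !lexx orbT.
have M0 : 0 <= M.
  by apply: le_trans (hM (a +i* c) _); [exact: N_ge0|split; rewrite /= lexx ltW].
pose Dm := (2 * M + L * r ^+ 2) / r.
have Dm0 : 0 <= Dm by rewrite divr_ge0 ?(ltW r0)// addr_ge0 ?mulr_ge0 ?sqr_ge0// ltW.
(* [dh] is any function satisfying the Taylor bound. It is bounded by comparing [h] at [w] and at a
   point of the rectangle at distance exactly [r], found to the right or to the left of [w]. *)
have hD w : rect a b c d w -> N (dh w) <= Dm.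
  move=> wr; have [z [zr zw]] : exists z, rect a b c d z /\ N (z - w) = r.
    case: wr => /andP[w1 w2] w34.
    have [le|gt] := leP (Re w) ((a + b) / 2).
      exists ((Re w + r) +i* Im w); split; first by split=> //=; apply/andP; split; lra.
      have -> : (Re w + r) +i* Im w - w = r%:C.
        by case: w {w1 w2 w34 le} => x y /=; apply/eqP; rewrite eq_complex/=; apply/andP; split; apply/eqP; ring.
      by rewrite N_real gtr0_norm.
    exists ((Re w - r) +i* Im w); split; first by split=> //=; apply/andP; split; lra.
    have -> : (Re w - r) +i* Im w - w = (- r)%:C.
      by case: w {w1 w2 w34 gt} => x y /=; apply/eqP; rewrite eq_complex/=; apply/andP; split; apply/eqP; ring.
    by rewrite N_real normrN gtr0_norm.
  rewrite /Dm ler_pdivlMr// -{1}zw -NM.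
  have -> : dh w * (z - w) = (h z - h w) - (h z - h w - dh w * (z - w)) by ring.
  rewrite (le_trans (NB _ _))// lerD//.
    rewrite (le_trans (NB _ _))//; have := hM _ zr; have := hM _ wr; lra.
  by have := T w z wr zr; rewrite zw; apply.
pose E := (b - a) + (d - c).
have E0 : 0 < E by rewrite addr_gt0// subr_gt0.
(* The three bounds on the mesh serve the Taylor hypothesis [HT], [Hosc] and [Hsmall], in this
   order; the summands 1 keep the denominators positive. *)
pose sm := Num.min (Num.min (eta / 2) (tau / 16 / (Dm + L * (b - a) + 1))) (tau / (9 * L * E + 1)).
have X1 : 0 < Dm + L * (b - a) + 1 by rewrite ltr_wpDl// addr_ge0// mulr_ge0// subr_ge0 ltW.
have X2 : 0 < 9 * L * E + 1 by rewrite ltr_wpDl// mulr_ge0 ?(ltW E0)// mulr_ge0.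
have sm0 : 0 < sm by rewrite !lt_min !divr_gt0.
pose n := maxn k (Num.trunc ((b - a) / sm)).+1.
have n0 : (0 < n)%N by rewrite leq_max k0.
have nR : 0 < n%:R :> R by rewrite ltr0n.
pose s := (b - a) / n%:R.
have s0 : 0 < s by rewrite divr_gt0// subr_gt0.
have nsE : n%:R * s = b - a by rewrite /s mulrC divfK ?gt_eqF.
have nsb : a + n%:R * s = b by rewrite nsE; ring.
have ssm : s <= sm.
  rewrite /s ler_pdivrMr// mulrC -ler_pdivrMr//.
  apply: le_trans (ltW (truncnS_gt _)) _.
  by rewrite ler_nat leq_max leqnn orbT.
have sab : s <= b - a by rewrite -nsE ler_peMl ?(ltW s0)// ler1n.
have [s1 s2 s3] : [/\ s <= eta / 2, s <= tau / 16 / (Dm + L * (b - a) + 1) & s <= tau / (9 * L * E + 1)].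
  by split; apply: le_trans ssm _; rewrite /sm !ge_min lexx ?orbT.
rewrite ler_pdivlMr// in s2; rewrite ler_pdivlMr// in s3.
pose m := Num.trunc ((d - c) / s).
have /andP[m1 m2] : m%:R <= (d - c) / s < m.+1%:R.
  by apply: truncn_itv; rewrite divr_ge0 ?subr_ge0 ?ltW.
rewrite ler_pdivlMr// in m1; rewrite ltr_pdivrMr// in m2.
have inR z : rect a (a + n%:R * s) c (c + m%:R * s) z -> rect a b c d z.
  rewrite nsb => -[? /andP[z1 z2]]; split=> //; apply/andP; split=> //.
  by clear -z2 m1; lra.
have cell (i : 'I_n) (j : 'I_m) z : sq (ct a c s i j) (s / 2) z -> rect a b c d z.
  by move=> /(cell_rect s0); exact: inR.
have cc (i : 'I_n) (j : 'I_m) : sq (ct a c s i j) (s / 2) (ct a c s i j).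
  by rewrite /sq /rect; split; apply/andP; split; clear -s0; lra.
have HT (i : 'I_n) (j : 'I_m) : taylor_on h dh L (sq (ct a c s i j) (s / 2)).
  move=> w z wq zq; apply: T; [exact: cell wq|exact: cell zq|].
  rewrite -(subrK (ct a c s i j) z) -addrA (le_trans (ND _ _))// (NC (ct _ _ _ _ _)).
  by have := N_sq wq; have := N_sq zq; clear -s1; lra.
have Hosc (i : 'I_n) (j : 'I_m) : N (dh (ct a c s i j)) * s + L * s ^+ 2 <= tau / 16.
  have h1 := hD _ (cell _ _ _ (cc i j)).
  have h2 : N (dh (ct a c s i j)) * s <= Dm * s by rewrite ler_wpM2r ?(ltW s0).
  have h3 : L * s * s <= L * (b - a) * s by rewrite ler_wpM2r ?(ltW s0)// ler_wpM2l.
  have -> : L * s ^+ 2 = L * s * s by ring.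
  by move: h2 h3 s2 s0; clear; lra.
have Hsmall : 81 * L ^+ 2 * s ^+ 2 * (n%:R * s * (m%:R * s)) <= tau ^+ 2.
  have h1 : 9 * L * E * s <= tau by clear -s3 s0; lra.
  apply: (@le_trans _ _ ((9 * L * E * s) ^+ 2)); last first.
    have p0 : 0 <= 9 * L * E * s by rewrite mulr_ge0 ?(ltW s0)// mulr_ge0 ?(ltW E0)// mulr_ge0.
    by rewrite ler_sqr ?nnegrE ?(ltW tau0).
  rewrite nsE (_ : (9 * L * E * s) ^+ 2 = 81 * L ^+ 2 * s ^+ 2 * (E * E)); last by ring.
  apply: ler_wpM2l; first by apply: mulr_ge0; rewrite ?sqr_ge0// mulr_ge0 ?sqr_ge0.
  have ba0 : 0 <= b - a by rewrite subr_ge0 ltW.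
  have dc0 : 0 <= d - c by rewrite subr_ge0 ltW.
  have ms0 : 0 <= m%:R * s by rewrite mulr_ge0 ?(ltW s0).
  by apply: ler_pM => //; rewrite /E; [|apply: le_trans m1 _]; lra.
have ch' : ctsr h a (a + n%:R * s) c (c + m%:R * s) by move=> z /inR; exact: ch.
have inI z : inrect a (a + n%:R * s) c (c + m%:R * s) z -> inrect a b c d z.
  rewrite nsb => -[? /andP[z1 z2]]; split=> //; apply/andP; split=> //.
  by clear -z2 m1; lra.
have inj' z w : inrect a (a + n%:R * s) c (c + m%:R * s) z ->
    inrect a (a + n%:R * s) c (c + m%:R * s) w -> h z = h w -> z = w.
  by move=> /inI zi /inI wi; exact: inj.
pose J (j : 'I_m) : bool := `[< crossing_row h a c s tau n k j >].
have cnt := rows_count s0 L0 tau0 n0 k0 ch' HT Hosc inj' Hsmall (J := J) (fun j => @asboolW _).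
exists (rows c s J `|` `[c + m%:R * s, d]%classic).
have mU : measurable (rows c s J).
  by apply: bigsetU_measurable => j _; exact: measurable_itv.
split.
- by apply: measurableU => //; exact: measurable_itv.
- have mI : measurable (`[c + m%:R * s, d]%classic : set R) by exact: measurable_itv.
  apply: (le_trans (measureU2 leb mU mI)).
  apply: (@le_trans _ _ ((#|J|%:R * s)%:E + s%:E)%E).
    apply: leeD; first exact: rows_measure (ltW s0).
    have := @itv_length (c + m%:R * s) d; rewrite /= => ->.
      by rewrite lee_fin; move: m2; rewrite -[m.+1%:R]natr1; clear; lra.
    by clear -m1; lra.
  rewrite -EFinD lee_fin.
  have kR : 0 < k%:R :> R by rewrite ltr0n.
  rewrite ler_pdivlMr// mulrDl.
  have h1 : #|J|%:R * s * k%:R <= 16 * 4609 * (b - a).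
    rewrite -nsE.
    rewrite mulrAC [leRHS]mulrA ler_wpM2r ?(ltW s0)//.
  have h2 : s * k%:R <= b - a.
    rewrite -nsE [n%:R * s]mulrC.
    by rewrite ler_wpM2l ?(ltW s0)// ler_nat leq_maxl.
  by clear -h1 h2 ab; lra.
- move=> y x x' /andP[y1 y2] xa xa' hx hx'.
  have [ym|ym] := lerP (c + m%:R * s) y; first by right; rewrite /= in_itv/= ym.
  have m0 : (0 < m)%N.
    by rewrite lt0n; apply/eqP => m0; move: ym; rewrite m0 mul0r addr0 ltNge y1.
  have yi : c <= y <= c + m%:R * s by rewrite y1 ltW.
  have [j _ hj] := locate s0 m0 yi.
  left; rewrite /rows -bigcup_seq_cond; exists j; last by rewrite /= in_itv.
  rewrite /= mem_index_enum; apply/asboolP; exists y, x, x'.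
  by rewrite nsb.
Qed.
End length_area.

(** * Conformal maps of strips *)

Section strips.
Variable R : realType.
Local Notation N := (@Normc.normc R).
Local Notation C := R[i].
Local Notation Re := (@complex.Re R).
Local Notation Im := (@complex.Im R).
Local Notation leb := (@lebesgue_measure R).

Lemma nice_rect (g : C -> C) a b c d rho : 0 < rho -> a <= b -> c <= d ->
  (forall z, rect (a - rho) (b + rho) (c - rho) (d + rho) z -> cdiff g z) ->
  exists dg L eta, [/\ 0 <= L, 0 < eta, ctsr g a b c d &
    forall w z, rect a b c d w -> rect a b c d z -> N (z - w) <= eta ->
    N (g z - g w - dg w * (z - w)) <= L * N (z - w) ^+ 2].
Proof.
move=> r0 ab cd hg.
have ctg : ctsr g (a - rho) (b + rho) (c - rho) (d + rho) by move=> z /hg/cdiff_ccont.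
have [||M hM] := @rect_max _ g (a - rho) (b + rho) (c - rho) (d + rho) _ _ ctg; [lra|lra|].
have /choice[dg hdg] : forall w, exists l, rect (a - rho) (b + rho) (c - rho) (d + rho) w -> cderiv g w l.
  move=> w; have [/hg/cdiff_cderiv[l hl]|nw] := pselect (rect (a - rho) (b + rho) (c - rho) (d + rho) w).
    by exists l.
  by exists 0.
have sub w z : rect a b c d w -> sq w rho z -> rect (a - rho) (b + rho) (c - rho) (d + rho) z.
  move=> [/andP[? ?] /andP[? ?]] [/andP[? ?] /andP[? ?]]; split; apply/andP; split; lra.
have ww w : sq w rho w by rewrite /sq /rect; split; apply/andP; split; lra.
have M0 : 0 <= M.
  apply: le_trans (hM (a +i* c) _); first exact: N_ge0.
  by apply: sub (ww _); rewrite /rect cReE cImE !lexx ab cd.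
exists dg, (1088 * M / rho ^+ 2), (rho / 2); split.
- by apply: divr_ge0; [apply: mulr_ge0; [exact: ler0n|exact: M0]|exact: sqr_ge0].
- by rewrite divr_gt0.
- by move=> z zr; apply: ctg; apply: sub zr (ww _).
- move=> w z wr zr zw; apply: taylor => //.
  + by apply: hdg; exact: sub wr (ww _).
  + by move=> u /(sub _ _ wr); exact: hg.
  + by move=> u /(sub _ _ wr); exact: hM.
  + exact: sq_N.
Qed.

Lemma horizontal_length_area (g : C -> C) a b c d rho tau k : 0 < rho -> a < b -> c < d ->
  0 < tau -> (0 < k)%N ->
  (forall z, rect (a - rho) (b + rho) (c - rho) (d + rho) z -> cdiff g z) ->
  (forall z w, inrect a b c d z -> inrect a b c d w -> g z = g w -> z = w) ->
  exists B : set R, [/\ measurable B, (leb B <= (16 * 4610 * (b - a) / k%:R)%:E)%E &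
    forall y x x', c <= y <= d -> a <= x <= b -> a <= x' <= b ->
      2 ^+ k * tau <= N (g (x +i* y)) -> N (g (x' +i* y)) <= tau -> B y].
Proof.
move=> r0 ab cd t0 k0 hg inj.
have [dg [L [eta [L0 e0 cg T]]]] := nice_rect r0 (ltW ab) (ltW cd) hg.
exact: (length_area ab cd L0 e0 t0 k0 cg T inj).
Qed.

(** Multiplication by [- 'i] maps horizontal segments to vertical ones, so this is the horizontal
    estimate for [g'] on the rotated rectangle. *)
Lemma vertical_length_area (g : C -> C) a b c d rho tau k : 0 < rho -> a < b -> c < d ->
  0 < tau -> (0 < k)%N ->
  (forall z, rect (a - rho) (b + rho) (c - rho) (d + rho) z -> cdiff g z) ->
  (forall z w, inrect a b c d z -> inrect a b c d w -> g z = g w -> z = w) ->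
  exists B : set R, [/\ measurable B, (leb B <= (16 * 4610 * (d - c) / k%:R)%:E)%E &
    forall x y y', a <= x <= b -> c <= y <= d -> c <= y' <= d ->
      2 ^+ k * tau <= N (g (x +i* y)) -> N (g (x +i* y')) <= tau -> B x].
Proof.
move=> r0 ab cd t0 k0 hg inj.
pose g' z := g (- 'i * z).
have rotE u v : - 'i * (u +i* v) = v +i* (- u) :> C.
  by apply/eqP; rewrite eq_complex/=; apply/andP; split; apply/eqP; ring.
have rotR z : Re (- 'i * z) = Im z by case: z => u v; rewrite rotE.
have rotI z : Im (- 'i * z) = - Re z by case: z => u v; rewrite rotE.
have dc : - d < - c by rewrite ltrN2.
have [z|z w|B [mB lB hB]] := @horizontal_length_area g' (- d) (- c) a b rho tau k r0 dc ab t0 k0.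
- move=> [/andP[? ?] /andP[? ?]].
  have : cdiff g (- 'i * z).
    by apply: hg; split; rewrite ?rotR ?rotI; apply/andP; split; lra.
  move=> /cdiff_cderiv[l hl]; apply: (@cderiv_cdiff _ _ _ (l * - 'i)) => e e1.
  have [t t1 ht] := hl e e1; exists t => // w wz.
  have Ni : N (- 'i) = 1 by rewrite NN /= expr0n expr1n add0r sqrtr1.
  have := ht (- 'i * w); rewrite -mulrBr NM Ni mul1r => /(_ wz).
  by rewrite mulrA.
- move=> [/andP[? ?] /andP[? ?]] [/andP[? ?] /andP[? ?]] /inj E.
  have i0 : - 'i != 0 :> C by rewrite oppr_eq0 eq_complex/= oner_eq0 andbF.
  by apply: (mulfI i0); apply: E; split; rewrite ?rotR ?rotI; apply/andP; split; lra.
exists B; split=> //; first by rewrite (_ : d - c = - c - - d)//; ring.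
move=> x y y' xa /andP[y1 y2] /andP[y3 y4] h1 h2; apply: (hB x (- y) (- y')) => //.
- by rewrite !lerN2; apply/andP.
- by rewrite !lerN2; apply/andP.
- by rewrite /g' rotE opprK.
- by rewrite /g' rotE opprK.
Qed.

Lemma pick_outside (B : set R) a b (e : R) : measurable B -> (leb B <= e%:E)%E -> e < b - a ->
  exists2 x, a < x < b & ~ B x.
Proof.
move=> mB lB eab; apply: contrapT => nx.
have : (leb `]a, b[ <= leb B)%E.
  apply: le_measure; rewrite ?inE; [exact: measurable_itv|exact: mB|].
  move=> x /=; rewrite in_itv/= => xab; apply: contrapT => nB; apply: nx; exists x => //.
have e0 : 0 <= e by rewrite -lee_fin; apply: le_trans lB.
rewrite leNgt => /negP; apply; apply: le_lt_trans lB _.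
rewrite lebesgue_measure_itv/= lte_fin ifT ?lte_fin ?EFinB//; lra.
Qed.

(** The properties of f o exp for f univalent in the disk. That composition has period 2 pi i, so
    injectivity is claimed only for imaginary parts less than [2 * pi] apart. *)
Definition halfplane_conformal (h : C -> C) :=
  (forall z, Re z < 0 -> cdiff h z) /\
  (forall z w, Re z < 0 -> Re w < 0 -> `|Im z - Im w| < 2 * pi -> h z = h w -> z = w).

(** The closed rectangle has height exactly [2 * pi], but any two of its interior points have
    imaginary parts closer than that, and only interior points need injectivity. *)
Lemma upper_strip h r x1 x2 w0 : halfplane_conformal h -> 0 < r -> x1 < x2 -> x2 < 0 ->
  (forall y, w0 <= y <= w0 + 2 * pi -> N (h (x1 +i* y)) <= r) ->
  exists B : set R, [/\ measurable B, (leb B <= (16 * 4610 * (x2 - x1))%:E)%E &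
    forall y, w0 <= y <= w0 + 2 * pi -> 2 * r <= N (h (x2 +i* y)) -> B y].
Proof.
move=> [dh inj] r0 x12 x20 hr.
have r1 : 0 < - x2 / 2 by lra.
have p0 : 0 < 2 * pi :> R by rewrite mulr_gt0// pi_gt0.
have w02 : w0 < w0 + 2 * pi by rewrite ltrDl.
have [z|z w|B [mB lB hB]] := @horizontal_length_area h x1 x2 w0 (w0 + 2 * pi) (- x2 / 2) r 1 r1 x12 w02 r0 isT.
- by move=> [/andP[? ?] _]; apply: dh; lra.
- move=> [/andP[? ?] /andP[? ?]] [/andP[? ?] /andP[? ?]]; apply: inj; [lra|lra|].
  by rewrite ltr_norml; apply/andP; split; lra.
exists B; split=> //; first by rewrite divr1 in lB.
move=> y yw hy; apply: (hB y x2 x1 yw); rewrite ?lexx ?(ltW x12) ?expr1//.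
exact: hr.
Qed.

(** Up to three losses of a factor [2 ^+ k]: along the side of the loop, to a full vertical segment,
    and along horizontal segments to the abscissa [x2]. Both length-area estimates are needed
    because the point on the loop may lie on a side of either direction. *)
Lemma lower_strip : exists2 c : R, 0 < c & forall h r x0 y0 x2, halfplane_conformal h ->
  0 < r -> - 1 <= x0 -> x0 < 0 -> x0 / 2 <= x2 -> x2 < 0 -> r <= N (h (x0 +i* y0)) ->
  exists B : set R, [/\ measurable B, (leb B <= (- x0 / 32)%:E)%E &
    forall y, y0 + x0 / 4 <= y <= y0 - x0 / 4 -> ~ B y -> c * r < N (h (x2 +i* y))].
Proof.
(* All segments used have length at most [5 * eta]; with this [k] each exceptional set has measure
   at most [eta / 8], since 40 = 5 * 8. *)
have [k k0 hk] : exists2 k : nat, (0 < k)%N & 40 * (16 * 4610) <= k%:R :> R.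
  exists (Num.trunc (40 * (16 * 4610) : R)).+1 => //.
  exact: ltW (truncnS_gt _).
have kR : 0 < k%:R :> R by rewrite ltr0n.
have k2 : 0 < 2 ^+ k :> R by rewrite exprn_gt0.
pose q : R := (2 ^+ k)^-1.
have q0 : 0 < q by rewrite invr_gt0.
exists (q * q * q / 64); first by rewrite divr_gt0// !mulr_gt0.
move=> h r x0 y0 x2 [dh inj] r0 x01 x00 x02 x20 hr.
pose eta := - x0 / 4.
have eta0 : 0 < eta by rewrite /eta; lra.
have p1 : 1 < pi :> R by have := @pi_ge2 R; lra.
(* 64 comes from [max_loop]: the loop has squared diagonal at most [8 * eta ^+ 2] and stays at least
   [eta / 2] away from the centre, a ratio of 32, and [32 * t0] is still only [r / 2]. *)
pose t0 := r / 64; pose t1 := t0 * q; pose t2 := t1 * q; pose t3 := t2 * q.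
have T0 : 0 < t0 by rewrite divr_gt0.
have T1 : 0 < t1 by rewrite mulr_gt0.
have T2 : 0 < t2 by rewrite mulr_gt0.
have T3 : 0 < t3 by rewrite mulr_gt0.
have E1 : 2 ^+ k * t1 = t0 by rewrite /t1 /q mulrC divfK// gt_eqF.
have E2 : 2 ^+ k * t2 = t1 by rewrite /t2 /q mulrC divfK// gt_eqF.
have E3 : 2 ^+ k * t3 = t2 by rewrite /t3 /q mulrC divfK// gt_eqF.
pose a := x0 - eta; pose c := y0 - eta; pose d := y0 + eta.
have aE : a = x0 - eta by []. have cE : c = y0 - eta by [].
have dE : d = y0 + eta by []. have etaE : eta = - x0 / 4 by [].
clearbody a c d.
have ax2 : a < x2 by clear -aE etaE x00 x02; lra.
have cd : c < d by clear -cE dE eta0; lra.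
have r1 : 0 < - x2 / 2 by clear -x20; lra.
have dQ z : rect (a - (- x2 / 2)) (x2 + (- x2 / 2)) (c - (- x2 / 2)) (d + (- x2 / 2)) z -> cdiff h z.
  by move=> [/andP[_ z1] _]; apply: dh; clear -z1 x20; lra.
have iQ z w : inrect a x2 c d z -> inrect a x2 c d w -> h z = h w -> z = w.
  move=> [/andP[_ z1] /andP[z2 z3]] [/andP[_ w1] /andP[w2 w3]].
  apply: inj; [exact: lt_trans z1 x20|exact: lt_trans w1 x20|].
  by rewrite ltr_norml; apply/andP; split; clear -z2 z3 w2 w3 cE dE etaE p1 x01; lra.
have small u e : 0 <= u -> u <= 5 * eta -> 0 < e -> 16 * 4610 * u / k%:R <= eta / 8.
  move=> u0 ue _; rewrite ler_pdivrMr//.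
  have : eta / 8 * (40 * (16 * 4610)) <= eta / 8 * k%:R by rewrite ler_wpM2l// divr_ge0// ltW.
  by move: ue; clear; lra.
have sx : x2 - a <= 5 * eta by clear -aE etaE x20; lra.
have sy : d - c <= 5 * eta by clear -cE dE eta0; lra.
have sub_rect (u v u' v' : R) z : u' <= u -> v <= v' -> rect (u - (- x2 / 2)) (v + (- x2 / 2)) (c - (- x2 / 2)) (d + (- x2 / 2)) z ->
  rect (u' - (- x2 / 2)) (v' + (- x2 / 2)) (c - (- x2 / 2)) (d + (- x2 / 2)) z.
  move=> h1 h2 [/andP[h3 h4] ?]; split=> //; apply/andP; split; [clear -h1 h3; lra|clear -h2 h4; lra].
pose b := x0 + eta.
have bE : b = x0 + eta by [].
clearbody b.
have ab : a < b by clear -aE bE eta0; lra.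
have bx2 : b <= x2 by clear -bE etaE x00 x02; lra.
have sb : b - a <= 5 * eta by clear -aE bE eta0; lra.
have dS z : rect (a - (- x2 / 2)) (b + (- x2 / 2)) (c - (- x2 / 2)) (d + (- x2 / 2)) z -> cdiff h z.
  by move=> zr; apply: dQ; apply: sub_rect zr.
have iS z w : inrect a b c d z -> inrect a b c d w -> h z = h w -> z = w.
  move=> [/andP[h1 h2] ?] [/andP[h3 h4] ?]; apply: iQ; split=> //.
    by rewrite h1 (lt_le_trans h2).
  by rewrite h3 (lt_le_trans h4).
have [B1 [mB1 lB1 hB1]] := horizontal_length_area r1 ax2 cd T1 k0 dQ iQ.
have [V1 [mV1 lV1 hV1]] := vertical_length_area r1 ab cd T1 k0 dS iS.
have [V2 [mV2 lV2 hV2]] := vertical_length_area r1 ab cd T2 k0 dS iS.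
have [B3 [mB3 lB3 hB3]] := horizontal_length_area r1 ax2 cd T3 k0 dQ iQ.
have e8 u : 0 <= u -> u <= 5 * eta -> 16 * 4610 * u / k%:R <= eta / 8 by move=> *; exact: small eta0.
have x2a0 : 0 <= x2 - a by rewrite subr_ge0 ltW.
have dc0 : 0 <= d - c by rewrite subr_ge0 ltW.
have lB1' : (leb B1 <= (eta / 8)%:E)%E by apply: le_trans lB1 _; rewrite lee_fin e8.
have lB3' : (leb B3 <= (eta / 8)%:E)%E by apply: le_trans lB3 _; rewrite lee_fin e8.
have lV1' : (leb V1 <= (eta / 8)%:E)%E by apply: le_trans lV1 _; rewrite lee_fin e8.
have lV2' : (leb V2 <= (eta / 8)%:E)%E by apply: le_trans lV2 _; rewrite lee_fin e8.
(* The four sides of the loop avoid the exceptional sets. Each is picked at a distance between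
   [eta / 2] and [eta] from the centre, an interval too long to be covered by a set of measure
   [eta / 8]. *)
have [|xm /andP[xm1 xm2] xmV] := @pick_outside V1 (x0 - eta) (x0 - eta / 2) (eta / 8) mV1 lV1' _; first by clear -eta0; lra.
have [|xp /andP[xp1 xp2] xpV] := @pick_outside V1 (x0 + eta / 2) (x0 + eta) (eta / 8) mV1 lV1' _; first by clear -eta0; lra.
have [|ym /andP[ym1 ym2] ymV] := @pick_outside B1 (y0 - eta) (y0 - eta / 2) (eta / 8) mB1 lB1' _; first by clear -eta0; lra.
have [|yp /andP[yp1 yp2] ypV] := @pick_outside B1 (y0 + eta / 2) (y0 + eta) (eta / 8) mB1 lB1' _; first by clear -eta0; lra.
have [p [[pr pb] hp]] : exists p, bdry xm xp ym yp p /\ t0 < N (h p).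
  apply: contrapT => np.
  have e20 : 0 < eta / 2 by rewrite divr_gt0.
  have := @max_loop _ h (x0 +i* y0) xm xp ym yp (eta / 2) t0 e20.
  rewrite cReE cImE.
  have -> : xm + eta / 2 <= x0 <= xp - eta / 2 by clear -xm2 xp1; apply/andP; split; lra.
  have -> : ym + eta / 2 <= y0 <= yp - eta / 2 by clear -ym2 yp1; apply/andP; split; lra.
  have dh' z : rect xm xp ym yp z -> cdiff h z.
    by move=> [/andP[_ z1] _]; apply: dh; clear -z1 xp2 bE bx2 x20; lra.
  have hM z : bdry xm xp ym yp z -> N (h z) <= t0.
    by move=> zb; rewrite leNgt; apply/negP => hz; apply: np; exists z.
  move=> /(_ isT isT dh' hM).
  have D2 : (xp - xm) ^+ 2 + (yp - ym) ^+ 2 <= 8 * eta ^+ 2.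
    rewrite (_ : 8 * eta ^+ 2 = (2 * eta) ^+ 2 + (2 * eta) ^+ 2); last by ring.
    by apply: lerD; rewrite ler_sqr ?nnegrE; clear -xm1 xm2 xp1 xp2 ym1 ym2 yp1 yp2 eta0; lra.
  have := ler_wpM2l (ltW T0) D2 => D3 D4; have := le_trans D4 D3.
  have : r * (eta / 2) ^+ 2 <= N (h (x0 +i* y0)) * (eta / 2) ^+ 2 by rewrite ler_wpM2r// sqr_ge0.
  move=> D5 D6; have := le_trans D5 D6.
  rewrite (_ : t0 * (8 * eta ^+ 2) = r / 2 * (eta / 2) ^+ 2); last by rewrite /t0; field.
  by rewrite ler_pM2r ?exprn_gt0//; clear -r0; lra.
move: pr pb hp; case: p => u v [/= /andP[pu1 pu2] /andP[pv1 pv2]] pb hp.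
have rx x : a <= x <= b -> a <= x <= x2 by move=> /andP[-> /le_trans]; apply.
have ux2 : a <= u <= b by clear -aE bE pu1 pu2 xm1 xp2; apply/andP; split; lra.
have vcd : c <= v <= d by clear -cE dE pv1 pv2 ym1 yp2; apply/andP; split; lra.
(* Outside [V1] even the bound [t1] holds; the weaker [t2] is what remains in the horizontal case as
   well. *)
have vert : ~ V1 u -> forall y, c <= y <= d -> t2 < N (h (u +i* y)).
  move=> nV y yc; rewrite ltNge; apply/negP => hy; apply: nV; apply: (hV1 u v y) => //.
    by rewrite E1 ltW.
  apply: le_trans hy _; rewrite -E2 ler_peMl ?(ltW T2)//.
  by rewrite exprn_ege1// ler1n.
have [xs xsb hxs] : exists2 xs, a <= xs <= b & forall y, c <= y <= d -> t2 < N (h (xs +i* y)).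
  (* Outside [B1] the bound [t1] persists along the whole width; a vertical line outside [V2]
     crosses this segment and inherits the bound [t2] along its whole height. *)
  have horiz : ~ B1 v -> exists2 xs, a <= xs <= b & forall y, c <= y <= d -> t2 < N (h (xs +i* y)).
    move=> nB; have hv x : a <= x <= x2 -> t1 < N (h (x +i* v)).
      move=> xa; rewrite ltNge; apply/negP => hx; apply: nB; apply: (hB1 v u x) => //; first exact: rx.
      by rewrite E1 ltW.
    have [|xs /andP[xs1 xs2] xsV] := @pick_outside V2 a b (eta / 8) mV2 lV2' _; first by clear -aE bE eta0; lra.
    have xsab : a <= xs <= b by rewrite !ltW.
    exists xs => // y yc; rewrite ltNge; apply/negP => hy; apply: xsV; apply: (hV2 xs v y) => //.
    by rewrite E2 ltW// hv// rx.
  case: pb => [E|[E|[E|E]]]; subst.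
  - by exists xm => //; exact: vert.
  - by exists xp => //; exact: vert.
  - exact: horiz.
  - exact: horiz.
exists B3; split=> //.
  by rewrite (_ : - x0 / 32 = eta / 8)//; rewrite etaE; field.
move=> y /andP[yc yd] nB.
have yI : c <= y <= d by clear -cE dE etaE yc yd; apply/andP; split; lra.
have -> : q * q * q / 64 * r = t3 by rewrite /t3 /t2 /t1 /t0; ring.
rewrite ltNge; apply/negP => hy; apply: nB; apply: (hB3 y xs x2) => //.
- exact: rx.
- by rewrite lexx ltW.
- by rewrite E3 ltW// hxs.
Qed.
End strips.

(** * Densities and polar coordinates *)

Section densities.
Local Open Scope ereal_scope.

Section weighted_image.
Context d d' (X : measurableType d) (Y : measurableType d') (R : realType).
Variables (mu : {measure set X -> \bar R}) (f : X -> R) (phi : X -> Y).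

(** The image under [phi] of the measure with density [f]. The measurability and sign proofs are
    arguments so that a measure structure can be attached to the term. *)
Definition wimage (mf : measurable_fun setT f) (f0 : forall x, (0 <= f x)%R)
  (mphi : measurable_fun setT phi) (A : set Y) : \bar R :=
  \int[mu]_(t in phi @^-1` A) (f t)%:E.

Variables (mf : measurable_fun setT f) (f0 : forall x, (0 <= f x)%R)
  (mphi : measurable_fun setT phi).
Let nu := wimage mf f0 mphi.
Let nu0 : nu set0 = 0. Proof. by rewrite /nu /wimage preimage_set0 integral_set0. Qed.
Let nu_ge0 A : 0 <= nu A. Proof. by apply: integral_ge0 => x _; rewrite lee_fin. Qed.
Let mpre A : measurable A -> measurable (phi @^-1` A).
Proof. by move=> mA; rewrite -[X in measurable X]setTI; exact: mphi. Qed.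
Let nu_add : semi_sigma_additive nu.
Proof.
move=> F mF tF mUF; rewrite /nu /wimage preimage_bigcup.
apply: (semi_sigma_additive_nng_induced (f := EFin \o f)).
- exact/measurable_EFinP.
- by move=> x; rewrite lee_fin.
- by move=> n; exact: mpre.
- apply/trivIsetP => /= i j _ _ ij; rewrite -preimage_setI.
  by move/trivIsetP : tF => /(_ _ _ _ _ ij) ->//; rewrite preimage_set0.
- by rewrite -preimage_bigcup; exact: mpre.
Qed.
HB.instance Definition _ := isMeasure.Build _ _ _ nu nu0 nu_ge0 nu_add.

Import HBNNSimple.

Let integral_nnsfun (g : {nnsfun Y >-> R}) :
  \int[nu]_y (g y)%:E = \int[mu]_x ((f x)%:E * (g (phi x))%:E).
Proof.
have mfE : measurable_fun setT (EFin \o f) by exact/measurable_EFinP.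
transitivity (\sum_(k \in range g) k%:E * nu (g @^-1` [set k])).
  by rewrite integralT_nnsfun sintegralE.
have mk k : measurable_fun setT (fun x => (f x)%:E * (k * \1_(g @^-1` [set k]) (phi x))%:E).
  apply: emeasurable_funM => //; apply/measurable_EFinP.
  by apply: measurable_funM => //; exact: measurableT_comp.
transitivity (\sum_(k \in range g) \int[mu]_x ((f x)%:E * (k * \1_(g @^-1` [set k]) (phi x))%:E)).
  apply: eq_fsbigr => k kg.
  have k0 : (0 <= k)%R by move: kg; rewrite inE => -[x _ <-].
  have mgk : measurable (phi @^-1` (g @^-1` [set k])).
    by apply: mpre; rewrite -[X in measurable X]setTI; exact: measurable_funP.
  have mp : measurable_fun setT ((fun t => (f t)%:E) \_ (phi @^-1` (g @^-1` [set k]))).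
    by apply/(measurable_restrictT _ mgk); exact: measurable_funTS.
  rewrite /nu /wimage integral_mkcond -(ge0_integralZl mu measurableT mp).
  - apply: eq_integral => x _; rewrite /patch indicE /=.
    rewrite [x \in _ in LHS](_ : _ = (phi x \in g @^-1` [set k])); last first.
      by apply/idP/idP; rewrite !inE.
    case: ifP => _; first by rewrite mulr1 muleC.
    by rewrite mulr0 !mule0.
  - by move=> x _; rewrite /patch; case: ifP => // _; rewrite lee_fin.
  - by rewrite lee_fin.
rewrite -ge0_integral_fsum//.
- apply: eq_integral => x _; rewrite -ge0_mule_fsumr; last by move=> k; rewrite EFinM nnfun_muleindic_ge0.
  by rewrite fsumEFin// -fimfunE.
- by move=> k x _; apply: mule_ge0; [rewrite lee_fin|rewrite EFinM nnfun_muleindic_ge0].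
Qed.

Lemma integral_wimage (g : Y -> \bar R) : measurable_fun setT g -> (forall y, 0 <= g y) ->
  \int[nu]_y g y = \int[mu]_x ((f x)%:E * g (phi x)).
Proof.
move=> mg g0.
have mfE : measurable_fun setT (EFin \o f) by exact/measurable_EFinP.
pose g_ := nnsfun_approx measurableT mg.
have ndg x : {homo (fun n => (g_ n x)%:E) : m n / (m <= n)%N >-> m <= n}.
  by move=> m n mn; rewrite lee_fin; exact/lefP/nd_nnsfun_approx.
have cg x : (g_ n x)%:E @[n --> \oo] --> g x.
  by apply: cvg_nnsfun_approx => // *; exact: g0.
have mgn n : measurable_fun setT (fun x => (g_ n x)%:E) by exact/measurable_EFinP/measurable_funP.
transitivity (limn (fun n => \int[nu]_x (g_ n x)%:E)).
  rewrite -monotone_convergence//.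
  - by apply: eq_integral => x _; apply/esym/cvg_lim => //; exact: cg.
  - by move=> n x _; rewrite lee_fin.
transitivity (limn (fun n => \int[mu]_x ((f x)%:E * (g_ n (phi x))%:E))).
  by congr (limn _); apply/funext => n; exact: integral_nnsfun.
rewrite -monotone_convergence//.
- apply: eq_integral => x _; apply/cvg_lim => //.
  by apply: cvgeZl => //; exact: cg.
- by move=> n; apply: emeasurable_funM => //; exact: (measurableT_comp (mgn n)).
- by move=> n x _; apply: mule_ge0; rewrite lee_fin.
- by move=> x _ m n mn; apply: lee_wpmul2l; rewrite ?lee_fin//; exact: ndg.
Qed.
End weighted_image.

Section substitutions.
Variable R : realType.
Local Notation leb := (@lebesgue_measure R).
Implicit Type g : R -> \bar R.

(** The hypothesis says that the image measure agrees with Lebesgue measure on half-open intervals,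
    and uniqueness of Lebesgue measure does the rest. *)
Lemma change_of_variable (f phi : R -> R) (mf : measurable_fun setT f) (f0 : forall x, (0 <= f x)%R)
   (mphi : measurable_fun setT (phi : measurableTypeR R -> measurableTypeR R)) :
  (forall a b : R, (a < b)%R -> \int[leb]_(t in phi @^-1` `]a, b]) (f t)%:E = (b - a)%:E) ->
  forall g, measurable_fun setT g -> (forall x, 0 <= g x) ->
  \int[leb]_x g x = \int[leb]_x ((f x)%:E * g (phi x)).
Proof.
move=> H g mg g0; rewrite -(integral_wimage leb mf f0 mphi mg g0).
apply: eq_measure_integral => A mA _; apply: (@lebesgue_measure_unique R (wimage leb mf f0 mphi)) => //.
move=> _ [[a b] _ <-]; rewrite /= /wimage.
have [ab|ba] := ltP a b.
  by rewrite H// lebesgue_measure_itv/= lte_fin ab EFinB.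
rewrite set_itv_ge; last by rewrite bnd_simp -leNgt.
by rewrite preimage_set0 integral_set0 measure0.
Qed.

Lemma measurable_scale (k : R) : measurable_fun setT ( *%R k : measurableTypeR R -> measurableTypeR R).
Proof. by apply: continuous_measurable_fun => x; apply: mulrl_continuous. Qed.

Lemma integral_scale (k : R) g : k != 0%R -> measurable_fun setT g -> (forall x, 0 <= g x) ->
  \int[leb]_x g x = `|k|%:E * \int[leb]_x g (k * x)%R.
Proof.
move=> k0 mg g0.
have mg' : measurable_fun setT (fun x => g (k * x)%R) by exact: (measurableT_comp mg (measurable_scale k)).
rewrite -(ge0_integralZl leb measurableT mg'); [|by move=> x _; exact: g0|by rewrite lee_fin].
apply: (@change_of_variable (fun=> `|k|%R) _ (measurable_cst _) (fun=> normr_ge0 k) (measurable_scale k) _ _ mg g0) => a b ab.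
 rewrite integral_cst; last first.
  by rewrite -[X in measurable X]setTI; apply: (measurable_scale k).
have [kp|kn] : (0 < k)%R \/ (k < 0)%R by case: (ltgtP k 0%R) k0; auto.
  have -> : *%R k @^-1` `]a, b] = `](a / k)%R, (b / k)%R]%classic.
    by apply/seteqP; split=> x /=; rewrite !in_itv/= ltr_pdivrMr// ler_pdivlMr// mulrC.
  transitivity (`|k|%:E * (b / k - a / k)%:E).
    congr (_ * _); apply: etrans (lebesgue_measure_itv _) _ => /=.
    by rewrite lte_fin ltr_pM2r ?invr_gt0// ab EFinB.
  by rewrite -EFinM gtr0_norm//; congr EFin; field; rewrite gt_eqF.
have -> : *%R k @^-1` `]a, b] = `[(b / k)%R, (a / k)%R[%classic.
  by apply/seteqP; split=> x /=; rewrite !in_itv/= ltr_ndivlMr// ler_ndivrMr// mulrC andbC.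
transitivity (`|k|%:E * (a / k - b / k)%:E).
  congr (_ * _); apply: etrans (lebesgue_measure_itv _) _ => /=.
  by rewrite lte_fin ltr_nM2r ?invr_lt0// ab EFinB.
by rewrite -EFinM ltr0_norm//; congr EFin; field; rewrite lt_eqF.
Qed.

Let I : set R := `](- (pi / 2))%R, (pi / 2)%R[%classic.
Lemma cos_gt0_I t : I t -> (0 < cos t)%R.
Proof. by rewrite /I /= in_itv/= => tI; apply: cos_gt0_pihalf. Qed.

(** Density and substitution are both extended by 0 outside the interval; the false values of [phi]
    there are harmless because the density vanishes. *)
Lemma integral_tan g : measurable_fun setT g -> (forall x, 0 <= g x) ->
  \int[leb]_x g x = \int[leb]_(t in I) (((cos t) ^- 2)%:E * g (tan t)).
Proof.
move=> mg g0.
pose f : R -> R := (fun t => (cos t) ^- 2)%R \_ I.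
pose phi : R -> R := tan \_ I.
have mI : measurable I by exact: measurable_itv.
have oI : open I by exact: interval_open.
have ccos t : I t -> {for t, continuous (fun t : R => (cos t) ^- 2)%R}.
  move=> /cos_gt0_I ct; apply: (@cvgV _ _ _ _ (fun t : R => cos t ^+ 2)%R).
    by rewrite expf_neq0// gt_eqF.
  by apply: (@continuous_comp _ _ _ (@cos R) (fun x => x ^+ 2)%R); [exact: continuous_cos|exact: exprn_continuous].
have mf : measurable_fun setT f.
  apply/(measurable_restrictT _ mI); apply: open_continuous_measurable_fun => // t.
  by rewrite inE => /ccos.
have mphi : measurable_fun setT (phi : measurableTypeR R -> measurableTypeR R).
  apply/(measurable_restrictT _ mI); apply: open_continuous_measurable_fun => // t.
  by rewrite inE => /cos_gt0_I ct; apply: continuous_tan; rewrite gt_eqF.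
have f0 x : (0 <= f x)%R.
  by rewrite /f /patch; case: ifP => // _; rewrite invr_ge0 sqr_ge0.
rewrite (change_of_variable mf f0 mphi _ mg g0); last first.
  move=> a b ab.
  have aI x : I (atan x) by rewrite /I /= in_itv/= atan_gtNpi2 atan_ltpi2.
  have -> : \int[leb]_(t in phi @^-1` `]a, b]) (f t)%:E = \int[leb]_(t in `]atan a, atan b]) (f t)%:E.
    rewrite integral_mkcond [RHS]integral_mkcond; apply: eq_integral => t _.
    rewrite /patch; have [tI|tI] := pselect (I t); last first.
      rewrite /f /patch [t \in I](_ : _ = false); last by apply/negbTE; rewrite notin_setE.
      by case: ifP; case: ifP.
    have mono u : (atan u < t)%R = (u < tan t)%R.
      by rewrite -ltr_tan ?atanK// ?in_itv/= ?atan_gtNpi2 ?atan_ltpi2//; exact: tI.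
    congr (if _ then _ else _); apply/idP/idP; rewrite !inE /= !in_itv/= /phi /patch mem_set//.
      by rewrite mono (leNgt t) mono -leNgt.
    by rewrite mono (leNgt t) mono -leNgt.
  have atab : (atan a < atan b)%R by exact: lt_atan.
  rewrite integral_itv_obnd_cbnd; last first.
    apply/measurable_EFinP; apply: measurable_funTS; exact: mf.
  have subI t : (atan a <= t <= atan b)%R -> I t.
    move=> /andP[h1 h2]; rewrite /I /= in_itv/= (lt_le_trans (atan_gtNpi2 a) h1).
    by rewrite (le_lt_trans h2)// atan_ltpi2.
  transitivity (\int[leb]_(t in `[atan a, atan b]) ((cos t) ^- 2)%:E).
    by apply: eq_integral => t; rewrite inE /= in_itv/= => /subI tI; rewrite /f /patch mem_set.
  rewrite (@continuous_FTC2 _ _ tan _ _ atab).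
  - by rewrite !atanK EFinB.
  - apply: continuous_in_subspaceT => t; rewrite inE /= in_itv/= => /subI; exact: ccos.
  - split.
    + move=> t; rewrite in_itv/= => /andP[h1 h2]; apply: derivable_tan.
      by rewrite gt_eqF//; apply: cos_gt0_I; apply: subI; rewrite !ltW.
    + by apply: cvg_at_right_filter; apply: continuous_tan; rewrite gt_eqF//; exact: cos_gt0_I.
    + by apply: cvg_at_left_filter; apply: continuous_tan; rewrite gt_eqF//; exact: cos_gt0_I.
  - move=> t; rewrite in_itv/= => /andP[h1 h2]; rewrite derive1E.
    apply: derive_val; apply: is_derive_tan; rewrite gt_eqF//; apply: cos_gt0_I.
    by apply: subI; rewrite !ltW.
rewrite [RHS]integral_mkcond; apply: eq_integral => t _; rewrite /f /phi /patch.
by case: ifP => // _; rewrite mul0e.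
Qed.
End substitutions.
End densities.

Section polar_coordinates.
Variable R : realType.
Local Open Scope ereal_scope.
Local Notation leb := (@lebesgue_measure R).
Implicit Type F : R -> \bar R.

Lemma integral_fold F : measurable_fun setT F -> (forall x, 0 <= F x) ->
  \int[leb]_x F x = \int[leb]_(x in `]0%R, +oo[) (F x + F (- x)%R).
Proof.
move=> mF F0.
have mFN : measurable_fun setT (fun x : R => F (- x)%R).
  by apply: (measurableT_comp mF); exact: oppr_measurable.
have TE : [set: R] = `]-oo, 0%R] `|` `]0%R, +oo[.
  apply/seteqP; split=> // x _ /=; rewrite !in_itv/= andbT.
  by have [?|?] := leP x 0%R; [left|right].
rewrite TE ge0_integral_setU//=; last 2 first.
- by rewrite -TE.
- apply/disj_setPS => x [] /=; rewrite !in_itv/= andbT => h1 h2.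
  by have := le_lt_trans h1 h2; rewrite ltxx.
rewrite ge0_integralD//=; [|exact: measurable_funTS|exact: measurable_funTS].
rewrite addeC; congr (_ + _).
rewrite [RHS]integral_itv_obnd_cbnd; last exact: measurable_funTS.
by rewrite ge0_integration_by_substitution0//; apply: eq_integral => x _; rewrite opprK.
Qed.

Variable g : R * R -> \bar R.
Hypothesis mg : measurable_fun setT g.
Hypothesis g0 : forall z, 0 <= g z.

Let w (x : R) : R := Num.max x 0%R.
Let mw : measurable_fun setT w. Proof. exact: measurable_maxr. Qed.
Let w0 x : (0 <= w x)%R. Proof. by rewrite /w le_max lexx orbT. Qed.

Let sym (x y : R) := g (x, y) + g (- x, - y)%R.
Let sym0 x y : 0 <= sym x y. Proof. exact: adde_ge0. Qed.

Let I : set R := `](- (pi / 2))%R, (pi / 2)%R[%classic.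

(** The plane is folded onto the half-plane x > 0. There y = x m introduces the slope m, Tonelli
    exchanges x and m, then m = tan t and x = s cos t. The Jacobian factors x, 1 / cos^2 t and cos t
    combine to s. Only one-dimensional substitutions occur; [w] encodes the positivity of x and
    s. *)
Lemma integral_polar : \int[(leb \x leb)]_z g z =
  \int[leb]_(s in `]0%R, +oo[) (s%:E * \int[leb]_(t in I) (g (s * cos t, s * sin t)%R + g (- (s * cos t), - (s * sin t))%R)).
Proof.
have mo2 (p : R * R -> R * R) : measurable_fun setT (fst \o p) -> measurable_fun setT (snd \o p) ->
    measurable_fun setT (g \o p).
  by move=> h1 h2; apply: (measurableT_comp mg); apply/measurable_fun_pairP.
have mm : measurable_fun setT (fun z : R * R => z.1 * z.2)%R by exact: measurable_funM.
have mN1 (q : R -> R) : measurable_fun setT q -> measurable_fun setT (fun z => - q z)%R.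
  by move=> mq; apply: measurableT_comp mq; exact: oppr_measurable.
have mN (q : R * R -> R) : measurable_fun setT q -> measurable_fun setT (fun z => - q z)%R.
  by move=> mq; apply: measurableT_comp mq; exact: oppr_measurable.
have msym : measurable_fun setT (fun z : R * R => sym z.1 (z.1 * z.2)%R).
  apply: emeasurable_funD.
    by apply: (mo2 (fun z => (z.1, z.1 * z.2)%R)); [exact: measurable_fst|exact: mm].
  apply: (mo2 (fun z => (- z.1, - (z.1 * z.2))%R)); first by apply: mN; exact: measurable_fst.
  by apply: mN.
pose G0 (z : R * R) := (w z.1)%:E * sym z.1 (z.1 * z.2)%R.
have mG0 : measurable_fun setT G0.
  apply: emeasurable_funM => //; apply/measurable_EFinP; exact: (measurableT_comp mw).
have G00 z : 0 <= G0 z by rewrite mule_ge0// lee_fin.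
have mgx x : measurable_fun setT (fun y => g (x, y)) by apply: measurable_fun_pair2.
rewrite fubini_tonelli1// /fubini_F integral_fold; last 2 first.
- exact: measurable_fun_fubini_tonelli_F.
- by move=> x; apply: integral_ge0.
transitivity (\int[leb]_x \int[leb]_m G0 (x, m)).
  rewrite integral_mkcond; apply: eq_integral => x _.
  have mG x' : measurable_fun setT (fun m => sym x' (x' * m)%R).
    by apply: (@measurable_fun_pair2 _ _ _ _ _ _ (fun z : R * R => sym z.1 (z.1 * z.2)%R) x').
  rewrite /patch /G0 /= (ge0_integralZl leb measurableT (mG x)) => [|m _|]; last 2 first.
  - exact: sym0.
  - by rewrite lee_fin.
  case: ifPn; rewrite ?inE ?notin_setE /= in_itv/= andbT => x0; last first.
    have -> : w x = 0%R by rewrite /w max_r// leNgt; apply/negP.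
    by rewrite mul0e.
  have -> : w x = x by rewrite /w max_l// ltW.
  have xn0 : x != 0%R by rewrite gt_eqF.
  have nxn0 : (- x)%R != 0%R by rewrite oppr_eq0.
  have m1 : measurable_fun setT (fun m => g (x, x * m)%R).
    by apply: (measurableT_comp (mgx x)); exact: mulrl_measurable.
  have m2 : measurable_fun setT (fun m => g (- x, - (x * m))%R).
    by apply: (measurableT_comp (mgx (- x)%R)); apply: mN1; exact: mulrl_measurable.
  rewrite (integral_scale xn0 (mgx x))// (integral_scale nxn0 (mgx (- x)%R))//.
  rewrite normrN gtr0_norm// -ge0_muleDr; [|exact: integral_ge0|exact: integral_ge0].
  congr (_ * _); rewrite ge0_integralD//.
  by congr (_ + _); apply: eq_integral => m _; rewrite mulNr.
transitivity (\int[leb]_m \int[leb]_x G0 (x, m)); first exact: (@fubini_tonelli _ _ _ _ _ leb leb _ mG0 G00).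
have cosI t : I t -> (0 < cos t)%R by exact: cos_gt0_I.
have mPhi : measurable_fun setT (fun m => \int[leb]_x G0 (x, m)).
  exact: measurable_fun_fubini_tonelli_G.
rewrite (integral_tan mPhi); last by move=> m; exact: integral_ge0.
pose H (z : R * R) := (w z.1)%:E * (g (z.1 * cos z.2, z.1 * sin z.2)%R + g (- (z.1 * cos z.2), - (z.1 * sin z.2))%R).
have mc : measurable_fun setT (fun z : R * R => z.1 * cos z.2)%R.
  apply: measurable_funM; first exact: measurable_fst.
  by apply: measurableT_comp measurable_snd; apply: continuous_measurable_fun; exact: continuous_cos.
have ms : measurable_fun setT (fun z : R * R => z.1 * sin z.2)%R.
  apply: measurable_funM; first exact: measurable_fst.
  by apply: measurableT_comp measurable_snd; apply: continuous_measurable_fun; exact: continuous_sin.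
have mH2 : measurable_fun setT (fun z : R * R => g (z.1 * cos z.2, z.1 * sin z.2)%R + g (- (z.1 * cos z.2), - (z.1 * sin z.2))%R).
  apply: emeasurable_funD.
    exact: (mo2 (fun z => (z.1 * cos z.2, z.1 * sin z.2)%R)).
  by apply: (mo2 (fun z => (- (z.1 * cos z.2), - (z.1 * sin z.2))%R)); exact: mN.
have mH : measurable_fun setT H.
  apply: emeasurable_funM mH2; apply/measurable_EFinP; exact: (measurableT_comp mw).
have H0 z : 0 <= H z by rewrite mule_ge0 ?adde_ge0// lee_fin.
have mI : measurable I by exact: measurable_itv.
transitivity (\int[leb]_(t in I) \int[leb]_s H (s, t)).
  apply: eq_integral => t; rewrite inE => tI; have ct := cosI t tI.
  have mG1 : measurable_fun setT (fun x => G0 (x, tan t)) by apply: measurable_fun_pair1.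
  have ct0 : cos t != 0%R by rewrite gt_eqF.
  rewrite (integral_scale ct0 mG1)// muleA -EFinM gtr0_norm//.
  have mG2 : measurable_fun setT (fun s => G0 (cos t * s, tan t)%R).
    by apply: (measurableT_comp mG1); exact: mulrl_measurable.
  rewrite -(ge0_integralZl leb measurableT mG2); last 2 first.
  - by move=> x _; exact: G00.
  - by rewrite lee_fin mulr_ge0 ?invr_ge0 ?sqr_ge0// ltW.
  apply: eq_integral => s _; rewrite /G0 /H /= muleA -EFinM.
  have -> : (cos t * s = s * cos t)%R by rewrite mulrC.
  have -> : (s * cos t * tan t = s * sin t)%R by rewrite /tan; field.
  congr (_%:E * _); rewrite /w.
  have [s0|s0] := leP s 0%R.
    by rewrite max_r ?mulr0// pmulr_lle0.
  by rewrite max_l; [field|rewrite mulr_ge0 ?ltW].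
transitivity (\int[leb]_t \int[leb]_s ((\1_I t)%:E * H (s, t))).
  rewrite integral_mkcond; apply: eq_integral => t _; rewrite /patch indicE.
  case: ifP => _; last by under eq_integral do rewrite mul0e; rewrite integral0.
  by under [RHS]eq_integral do rewrite mul1e.
have mK : measurable_fun setT (fun z : R * R => (\1_I z.2)%:E * H z).
  apply: emeasurable_funM mH; apply/measurable_EFinP.
  by apply: measurableT_comp measurable_snd; exact: measurable_indic.
have K0 z : 0 <= (\1_I z.2)%:E * H z by rewrite mule_ge0// lee_fin.
transitivity (\int[leb]_s \int[leb]_t ((\1_I t)%:E * H (s, t))); first exact: esym (@fubini_tonelli _ _ _ _ _ leb leb _ mK K0).
rewrite [RHS]integral_mkcond; apply: eq_integral => s _.
rewrite /H /patch /=.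
have mS : measurable_fun setT (fun t => g (s * cos t, s * sin t)%R + g (- (s * cos t), - (s * sin t))%R).
  by apply: (@measurable_fun_pair2 _ _ _ _ _ _ _ s mH2).
case: ifPn; rewrite ?inE ?notin_setE /= in_itv/= andbT => s0; last first.
  have -> : w s = 0%R by rewrite /w max_r// leNgt; apply/negP.
  by under eq_integral do rewrite mul0e mule0; rewrite integral0.
have -> : w s = s by rewrite /w max_l// ltW.
rewrite -ge0_integralZl//; last 3 first.
- exact: measurable_funTS.
- by move=> t _; exact: adde_ge0.
- by rewrite lee_fin ltW.
rewrite [RHS]integral_mkcond; apply: eq_integral => t _; rewrite /patch indicE.
by case: ifP => _; rewrite ?mul1e ?mul0e.
Qed.
End polar_coordinates.

(** * The exponential map and circles *)

Section exponential.
Variable R : realType.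
Local Notation N := (@Normc.normc R).
Local Notation C := R[i].
Local Notation Re := (@complex.Re R).
Local Notation Im := (@complex.Im R).
Local Notation leb := (@lebesgue_measure R).

Definition cexp (z : C) : C := (expR (Re z) * cos (Im z)) +i* (expR (Re z) * sin (Im z)).

Lemma cexpD z w : cexp (z + w) = cexp z * cexp w.
Proof.
case: z w => [x y] [u v]; rewrite /cexp /= expRD cosD sinD.
by apply/eqP; rewrite eq_complex/=; apply/andP; split; apply/eqP; ring.
Qed.

Lemma N_polar (s t : R) : 0 <= s -> N ((s * cos t) +i* (s * sin t)) = s.
Proof.
move=> s0; rewrite /= !exprMn -mulrDr cos2Dsin2 mulr1 sqrtr_sqr ger0_norm//.
Qed.

Lemma N_cexp z : N (cexp z) = expR (Re z).
Proof. by rewrite /cexp N_polar// expR_ge0. Qed.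

Lemma real_deriv0 (F : R -> R) d : is_derive (0 : R) (1 : R) F d -> forall e, 0 < e ->
  exists2 t, 0 < t & forall u, `|u| < t -> `|F u - F 0 - d * u| <= e * `|u|.
Proof.
move=> [dF <-] e e0; move/cvgrPdist_le : dF => /(_ _ e0)[/= t t0 ht].
exists t => // u ut; have [->|u0] := eqVneq u 0; first by rewrite !subrr mulr0 subr0 normr0 mulr0.
have := ht u; rewrite /ball_/= sub0r normrN => /(_ ut u0).
rewrite /GRing.scale/= mulr1 addr0 -/('D_1 F 0) => h.
rewrite (_ : _ - _ = - (('D_1 F 0 - u^-1 * (F u - F 0)) * u)); last by field.
by rewrite normrN normrM ler_wpM2r.
Qed.

Lemma cexp_deriv0 : forall e : R, 0 < e -> exists2 t : R, 0 < t &
  forall k, N k < t -> N (cexp k - 1 - k) <= e * N k.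
Proof.
move=> e e0; have e4 : 0 < e / 8 by rewrite divr_gt0.
have [t1 t10 h1] := real_deriv0 (is_derive_expR 0) e4.
have [t2 t20 h2] := real_deriv0 (is_derive_cos 0) e4.
have [t3 t30 h3] := real_deriv0 (is_derive_sin 0) e4.
have [t4 t40 h4] := real_deriv0 (is_derive_expR 0) ltr01.
have [t5 t50 h5] := real_deriv0 (is_derive_sin 0) ltr01.
exists (Num.min (Num.min (Num.min t1 t2) (Num.min t3 t4)) (Num.min (Num.min t5 1) (e / 8))).
  by rewrite !lt_min t10 t20 t30 t40 t50 ltr01 e4.
case=> x y; set K := N _; rewrite !lt_min => /andP[/andP[/andP[k1 k2] /andP[k3 k4]] /andP[/andP[k7 k5] k6]].
have Nx : `|x| <= K by exact: (N_Re (x +i* y)).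
have Ny : `|y| <= K by exact: (N_Im (x +i* y)).
have K0 : 0 <= K by exact: N_ge0.
have := h1 x (le_lt_trans Nx k1); rewrite expR0 mul1r => {}h1.
have := h2 y (le_lt_trans Ny k2); rewrite cos0 sin0 oppr0 mul0r subr0 => {}h2.
have := h3 y (le_lt_trans Ny k3); rewrite cos0 sin0 mul1r subr0 => {}h3.
have := h4 x (le_lt_trans Nx k4); rewrite expR0 mul1r => {}h4.
rewrite (le_trans (N_le _))//.
have -> : Re (cexp (x +i* y) - 1 - (x +i* y)) = (expR x - 1 - x) * cos y + (1 + x) * (cos y - 1).
  by rewrite /cexp /=; ring.
have -> : Im (cexp (x +i* y) - 1 - (x +i* y)) = (expR x - 1) * sin y + (sin y - y).
  by rewrite /cexp /=; ring.
have := h5 y (le_lt_trans Ny k7); rewrite cos0 sin0 mul1r mul1r subr0 => {}h5.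
have c1 : `|cos y| <= 1 by rewrite ler_norml cos_geN1 cos_le1.
have s1 : `|sin y| <= 2 * K.
  have : `|sin y| <= `|sin y - y| + `|y| by rewrite -{1}(subrK y (sin y)) ler_normD.
  by clear -h5 Ny; lra.
have x1 : `|expR x - 1| <= 2 * K.
  have : `|expR x - 1| <= `|expR x - 1 - x| + `|x| by rewrite -{1}(subrK x (expR x - 1)) ler_normD.
  by clear -h4 Nx; lra.
have x2 : `|1 + x| <= 2.
  rewrite (le_trans (ler_normD _ _))// normr1; clear -Nx k5; lra.
have a1 : `|(expR x - 1 - x) * cos y| <= e / 8 * K * 1.
  rewrite normrM; apply: ler_pM => //; apply: le_trans h1 _.
  by rewrite ler_wpM2l// ltW.
have a2 : `|(1 + x) * (cos y - 1)| <= 2 * (e / 8 * K).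
  rewrite normrM; apply: ler_pM => //; apply: le_trans h2 _.
  by rewrite ler_wpM2l// ltW.
have a3 : `|(expR x - 1) * sin y| <= 2 * K * (2 * (e / 8)).
  rewrite normrM; apply: ler_pM => //; apply: le_trans s1 _.
  by rewrite ler_wpM2l// ltW.
have a4 : `|sin y - y| <= e / 8 * K.
  by apply: le_trans h3 _; rewrite ler_wpM2l// ltW.
have a5 := ler_normD ((expR x - 1 - x) * cos y) ((1 + x) * (cos y - 1)).
have a6 := ler_normD ((expR x - 1) * sin y) (sin y - y).
by move: a1 a2 a3 a4 a5 a6; clear; lra.
Qed.

Lemma cderiv_cexp z : cderiv cexp z (cexp z).
Proof.
move=> e e0; have E0 : 0 < expR (Re z) by exact: expR_gt0.
have [t t0 ht] := cexp_deriv0 (divr_gt0 e0 E0); exists t => // w /ht h.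
have E : cexp w = cexp z * cexp (w - z) by rewrite -cexpD addrC subrK.
have -> : cexp w - cexp z - cexp z * (w - z) = cexp z * (cexp (w - z) - 1 - (w - z)).
  by rewrite E; ring.
rewrite NM N_cexp (le_trans (ler_wpM2l (ltW E0) h))//.
by rewrite mulrA mulrC [_ * (e / _)]mulrC divfK ?gt_eqF// mulrC.
Qed.

Lemma cderiv_comp (f g : C -> C) z l m : cderiv g z m -> cderiv f (g z) l ->
  cderiv (fun w => f (g w)) z (l * m).
Proof.
move=> gm fl e e0.
have m1 : 0 < N m + 1 by rewrite ltr_wpDl// N_ge0.
have l1 : 0 < N l + 1 by rewrite ltr_wpDl// N_ge0.
have [t1 t10 h1] := fl (e / 2 / (N m + 1)) (divr_gt0 (divr_gt0 e0 (ltr0n R 2)) m1).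
have [t2 t20 h2] := gm (e / 2 / (N l + 1)) (divr_gt0 (divr_gt0 e0 (ltr0n R 2)) l1).
have [t3 t30 h3] := gm 1 ltr01.
have [t4 t40 h4] := cderiv_cont gm t10.
exists (Num.min (Num.min t2 t3) t4); first by rewrite !lt_min t20 t30.
move=> w; rewrite !lt_min => /andP[/andP[w2 w3] w4].
have {}h1 := h1 _ (h4 _ w4); have {}h2 := h2 _ w2; have {}h3 := h3 _ w3.
set K := N (w - z) in h2 h3 *.
have K0 : 0 <= K by exact: N_ge0.
have gb : N (g w - g z) <= (N m + 1) * K.
  rewrite -(subrK (m * (w - z)) (g w - g z)) (le_trans (ND _ _))//.
  by rewrite NM -/K mulrDl addrC lerD.
rewrite (_ : _ - _ - _ = (f (g w) - f (g z) - l * (g w - g z)) + l * (g w - g z - m * (w - z))); last by ring.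
rewrite (le_trans (ND _ _))// (splitr e) mulrDl lerD//.
  rewrite (le_trans h1)// -[e / 2 * K](_ : e / 2 / (N m + 1) * ((N m + 1) * K) = _).
    by rewrite ler_wpM2l// divr_ge0 ?(ltW m1)// divr_ge0// ltW.
  by rewrite mulrA divfK// gt_eqF.
rewrite NM (@le_trans _ _ ((N l + 1) * (e / 2 / (N l + 1) * K)))//.
  by apply: ler_pM => //; rewrite ?N_ge0// lerDl.
by rewrite mulrA mulrC [(N l + 1) * _]mulrC divfK ?gt_eqF// mulrC.
Qed.

(** With t half the difference of the imaginary parts, cos (2 t) = 1 forces sin t = 0, and |t| < pi
    leaves only t = 0. *)
Lemma cexp_inj z w : `|Im z - Im w| < 2 * pi -> cexp z = cexp w -> z = w.
Proof.
move=> hzw E; have := congr1 N E; rewrite !N_cexp => /expR_inj Re_eq.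
have E0 : expR (Re w) != 0 by rewrite gt_eqF// expR_gt0.
have [cE sE] : cos (Im z) = cos (Im w) /\ sin (Im z) = sin (Im w).
  by move: E; rewrite /cexp Re_eq => -[/(mulfI E0) -> /(mulfI E0) ->].
suff Im_eq : Im z = Im w by case: z w Re_eq Im_eq {hzw E E0 cE sE} => [? ?] [? ?] /= -> ->.
pose t := (Im z - Im w) / 2.
have ht : `|t| < pi by rewrite /t normrM [ `|2^-1| ]ger0_norm// ltr_pdivrMr// mulrC.
have : cos (Im z - Im w) = 1 by rewrite cosB cE sE -!expr2 cos2Dsin2.
have -> : Im z - Im w = t + t by rewrite /t; field.
rewrite cosD -!expr2 => H.
have st : sin t = 0.
  by apply/eqP; rewrite -sqrf_eq0; apply/eqP; have := cos2Dsin2 t; lra.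
suff t0 : t = 0 by move: t0; rewrite /t; lra.
apply/eqP; rewrite -normr_eq0; apply/negPn/negP => tn0.
have tp : 0 < `|t| by rewrite lt_neqAle eq_sym tn0 normr_ge0.
have := @sin_gt0_pi R `|t|; rewrite tp ht => /(_ isT).
by case: (ger0P t) => _; rewrite ?sinN st ?oppr0 ltxx.
Qed.

Lemma conformal_halfplane (f : C -> C) : conformal_disk f ->
  halfplane_conformal (fun z => f (cexp z)).
Proof.
move=> [df injf].
have inD z : Re z < 0 -> unit_disk R (cexp z).
  move=> z0; have : N (cexp z) < 1 by rewrite N_cexp -expR0 ltr_expR.
  exact.
split=> [z z0|z w z0 w0 zw E].
  have [l hl] := cdiff_cderiv (df _ (inD z z0)).
  exact: cderiv_cdiff (cderiv_comp (@cderiv_cexp z) hl).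
apply: cexp_inj => //; apply: injf => //; rewrite inE; exact: inD.
Qed.

Definition circ (s t : R) : C := (s * cos t) +i* (s * sin t).

Lemma cexp_circ s t : 0 < s -> cexp (ln s +i* t) = circ s t.
Proof. by move=> s0; rewrite /cexp /circ /= lnK. Qed.

Lemma circle_upper (f : C -> C) r s1 s2 w0 : conformal_disk f -> 0 < r -> 0 < s1 -> s1 < s2 -> s2 < 1 ->
  (forall t, w0 <= t <= w0 + 2 * pi -> N (f (circ s1 t)) <= r) ->
  exists B : set R, [/\ measurable B, (leb B <= (16 * 4610 * (ln s2 - ln s1))%:E)%E &
    forall t, w0 <= t <= w0 + 2 * pi -> 2 * r <= N (f (circ s2 t)) -> B t].
Proof.
move=> cf r0 s10 s12 s21 hr; have s20 := lt_trans s10 s12.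
have [||t tw|B [mB lB hB]] := @upper_strip _ _ r (ln s1) (ln s2) w0 (conformal_halfplane cf) r0.
- by rewrite ltr_ln.
- by rewrite ln_lt0// s20.
- by rewrite cexp_circ//; exact: hr.
by exists B; split=> // t tw ht; apply: hB => //; rewrite cexp_circ.
Qed.

Lemma circle_lower : exists2 c : R, 0 < c & forall (f : C -> C) r s0 t0 s2, conformal_disk f ->
  0 < r -> 0 < s0 -> s0 < 1 -> - 1 <= ln s0 -> 0 < s2 -> s2 < 1 -> ln s0 / 2 <= ln s2 ->
  r <= N (f (circ s0 t0)) ->
  exists B : set R, [/\ measurable B, (leb B <= (- ln s0 / 32)%:E)%E &
    forall t, t0 + ln s0 / 4 <= t <= t0 - ln s0 / 4 -> ~ B t -> c * r < N (f (circ s2 t))].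
Proof.
have [c c0 H] := @lower_strip R; exists c => // f r s0 t0 s2 cf r0 s00 s01 ls0 s20 s21 ls2 hr.
have [|||B [mB lB hB]] := H _ r (ln s0) t0 (ln s2) (conformal_halfplane cf) r0 ls0 _ ls2.
- by rewrite ln_lt0// s00.
- by rewrite ln_lt0// s20.
- by rewrite cexp_circ.
by exists B; split=> // t tw nB; have := hB t tw nB; rewrite cexp_circ.
Qed.
End exponential.

(** * Layer cake and moments *)

Section explicit_integrals.
Variable R : realType.
Local Notation N := (@Normc.normc R).
Local Notation leb := (@lebesgue_measure R).

(** The integrand may blow up at the end points, as powers with negative exponent do, so the
    fundamental theorem is applied on increasing compact intervals and passed to the limit. *)
Lemma integral_deriv (f F : R -> R) a b : a < b -> (forall x, a < x < b -> 0 <= f x) ->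
  (forall x, a < x < b -> {for x, continuous f}) ->
  (forall x, a < x < b -> is_derive x 1 F (f x)) ->
  F x @[x --> a^'+] --> F a -> F x @[x --> b^'-] --> F b ->
  (\int[leb]_(x in `]a, b[) (f x)%:E = (F b - F a)%:E)%E.
Proof.
move=> ab f0 cf dF Fa Fb; pose d := b - a; have d0 : 0 < d by rewrite subr_gt0.
(* With the shift by 3, [e n] is at most a third of the length, so the margins at the two ends never
   meet. *)
pose e (n : nat) := d / n.+3%:R.
have e0 n : 0 < e n by rewrite divr_gt0.
have ed n : e n * 3 <= d.
  by rewrite /e mulrAC ler_pdivrMr// ler_pM2l// ler_nat.
have ecvg : e @ \oo --> (0 : R).
  have -> : e = (fun n => d * harmonic (n + 2)%N) by apply/funext => n; rewrite /e /harmonic /= addn2.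
  by rewrite -(mulr0 d); apply: cvgMl_tmp; rewrite (@cvg_shiftn 2 _ (@harmonic R : nat -> R)); exact: cvg_harmonic.
have edec m n : (m <= n)%N -> e n <= e m.
  by move=> mn; rewrite /e ler_wpM2l ?(ltW d0)// lef_pV2 ?posrE// ler_nat.
pose u n := a + e n; pose v n := b - e n.
have au n : a < u n by rewrite ltrDl.
have vb n : v n < b by rewrite gtrBl.
have uv n : u n < v n by rewrite /u /v; have := e0 n; have := ed n; rewrite /d; lra.
pose S n : set R := `[u n, v n]%classic.
have SE : (\bigcup_n S n = `]a, b[%classic).
  apply/seteqP; split => x.
    move=> [n _]; rewrite /S /= !in_itv/= => /andP[h1 h2].
    by rewrite (lt_le_trans (au n))//= (le_lt_trans h2).
  rewrite /= in_itv/= => /andP[ax xb].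
  have t0 : 0 < Num.min (x - a) (b - x) by rewrite lt_min !subr_gt0 ax.
  move/cvgrPdist_lt : ecvg => /(_ _ t0)[n _ /(_ _ (leqnn n))].
  rewrite /= sub0r normrN gtr0_norm// lt_min => /andP[h1 h2].
  by exists n => //; rewrite /S /= in_itv/= /u /v; apply/andP; split; lra.
have ndS : nondecreasing_seq S.
  move=> m n mn; apply/subsetPset => x; rewrite /S /= !in_itv/= /u /v => /andP[h1 h2].
  by have h3 := edec _ _ mn; apply/andP; split; lra.
have inab n x : S n x -> a < x < b.
  rewrite /S /= in_itv/= => /andP[h1 h2].
  by rewrite (lt_le_trans (au n))//= (le_lt_trans h2).
have mf : measurable_fun (`]a, b[%classic : set R) (fun x => (f x)%:E).
  apply/measurable_EFinP; apply: open_continuous_measurable_fun; first exact: interval_open.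
  by move=> x; rewrite inE /= in_itv/=; exact: cf.
have mfS n : measurable_fun (S n) (fun x => (f x)%:E).
  by apply: measurable_funS mf; [exact: measurable_itv|rewrite -SE; exact: bigcup_sup].
have I n : (\int[leb]_(x in S n) (f x)%:E = (F (v n) - F (u n))%:E)%E.
  rewrite EFinB; apply: continuous_FTC2 => //.
  - apply: continuous_in_subspaceT => x; rewrite inE => xS; exact: cf (inab n x xS).
  - have dFx x : a < x < b -> derivable F x 1 by move=> /dF[].
    have cF x : a < x < b -> {for x, continuous F}.
      by move=> /dFx dx; apply/differentiable_continuous/derivable1_diffP.
    split.
    + move=> x; rewrite in_itv/= => /andP[h1 h2].
      by apply: dFx; rewrite (lt_trans (au n))//= (lt_trans h2).
    + apply: cvg_at_right_filter; apply: cF; by rewrite au (lt_trans (uv n)).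
    + apply: cvg_at_left_filter; apply: cF; by rewrite vb andbT (lt_trans (au n)).
  - move=> x; rewrite in_itv/= => /andP[h1 h2]; rewrite derive1E.
    have xab : a < x < b by rewrite (lt_trans (au n))//= (lt_trans h2).
    by have [_ ->] := dF x xab.
have c1 : (\int[leb]_(x in S n) (f x)%:E)%E @[n --> \oo] --> (\int[leb]_(x in \bigcup_i S i) (f x)%:E)%E.
  apply: ge0_nondecreasing_set_cvg_integral => //; first by move=> n; exact: measurable_itv.
  by move=> n x /inab xab; rewrite lee_fin f0.
rewrite -SE; apply: (cvg_unique _ c1) => //.
rewrite (_ : (fun n => _) = (fun n => (F (v n) - F (u n))%:E)); last by apply/funext => n; exact: I.
apply: cvg_EFin; first by near=> n.
apply: cvgB.
  move/cvg_at_leftP : Fb; apply; split => //.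
  by rewrite -[X in _ --> X]subr0; apply: cvgB => //; exact: cvg_cst.
move/cvg_at_rightP : Fa; apply; split => //.
by rewrite -[X in _ --> X]addr0; apply: cvgD => //; exact: cvg_cst.
Unshelve. all: by end_near. Qed.

Lemma is_derive1_continuous (f : R -> R) (x d : R) : is_derive x 1 f d -> {for x, continuous f}.
Proof. by move=> [df _]; apply/differentiable_continuous/derivable1_diffP. Qed.

Lemma integral_powR (q a : R) : 0 < q -> 0 < a ->
  (\int[leb]_(r in `]0%R, a[) (q * r `^ (q - 1))%:E = (a `^ q)%:E)%E.
Proof.
move=> q0 a0; have dF (x : R) : 0 < x -> is_derive x 1 (@powR R ^~ q) (q * x `^ (q - 1)).
  exact: is_derive1_powR.
transitivity ((a `^ q - 0 `^ q)%:E); last by rewrite powR0 ?gt_eqF// subr0.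
apply: (@integral_deriv _ (@powR R ^~ q) 0 a) => //.
- by move=> x /andP[x0 _]; rewrite mulr_ge0 ?powR_ge0// ltW.
- move=> x /andP[x0 _]; apply: cvgMl_tmp.
  exact: (is_derive1_continuous (is_derive1_powR (q - 1) x0)).
- by move=> x /andP[x0 _]; exact: dF.
- by rewrite powR0 ?gt_eqF//; exact: powR_cvg0.
- apply: cvg_at_left_filter; exact: (is_derive1_continuous (dF a a0)).
Qed.

Lemma integral_weight (al s0 : R) : -1 < al -> 0 <= s0 < 1 ->
  (\int[leb]_(s in `]s0, 1%R[) (s * (1 - s ^+ 2) `^ al)%:E =
   ((1 - s0 ^+ 2) `^ (al + 1) / (2 * (al + 1)))%:E)%E.
Proof.
move=> al1 /andP[s00 s01]; have b0 : 0 < al + 1 by lra.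
pose F (s : R) := - (2 * (al + 1))^-1 * (1 - s ^+ 2) `^ (al + 1).
have pos (s : R) : 0 <= s -> s < 1 -> 0 < 1 - s ^+ 2.
  by move=> s1 s2; rewrite subr_gt0 expr_lt1.
have dpow (s : R) : 0 <= s -> s < 1 -> forall q, is_derive s 1 (fun s : R => (1 - s ^+ 2) `^ q) (q * (1 - s ^+ 2) `^ (q - 1) * (- (2 * s))).
  move=> s1 s2 q.
  have d1 : is_derive s 1 (fun s : R => 1 - s ^+ 2) (- (2 * s)).
    have [h1 h2] := is_deriveB (is_derive_cst (1 : R) s 1) (is_deriveX 2 (is_derive_id s (1 : R))).
    by apply: DeriveDef; [exact: h1|rewrite [LHS]h2 sub0r /GRing.scale/= mulr1 expr1].
  exact: (@is_derive1_comp _ (@powR R ^~ q) (fun s : R => 1 - s ^+ 2) s _ _ (is_derive1_powR q (pos s s1 s2)) d1).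
have dF (s : R) : 0 <= s -> s < 1 -> is_derive s 1 F (s * (1 - s ^+ 2) `^ al).
  move=> s1 s2.
  have -> : s * (1 - s ^+ 2) `^ al = - (2 * (al + 1))^-1 * ((al + 1) * (1 - s ^+ 2) `^ (al + 1 - 1) * (- (2 * s))).
    by rewrite addrK; field; rewrite gt_eqF.
  exact: (is_deriveZ (- (2 * (al + 1))^-1) (dpow s s1 s2 _)).
transitivity ((F 1 - F s0)%:E).
  apply: (@integral_deriv _ F s0 1) => //.
  - move=> x /andP[x0 x1]; rewrite mulr_ge0 ?powR_ge0//; lra.
  - move=> x /andP[x0 x1]; apply: cvgM; first exact: cvg_id.
    have x00 : 0 <= x by lra.
    exact: (is_derive1_continuous (dpow x x00 x1 al)).
  - move=> x /andP[x0 x1]; apply: dF => //; lra.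
  - apply: cvg_at_right_filter; exact: (is_derive1_continuous (dF s0 s00 s01)).
  - rewrite /F expr1n subrr powR0 ?gt_eqF//; apply: cvgMl_tmp.
    apply: (@cvg_comp _ _ _ (fun s : R => 1 - s ^+ 2) (fun y => y `^ (al + 1)) (1^'-) (0^'+)); last exact: powR_cvg0.
    move=> P [e /= e0 he]; exists (Num.min 1 (e / 2)); first by rewrite /= lt_min ltr01 divr_gt0.
    move=> s /=; rewrite lt_min => /andP[h1 h2] s1.
    have h : `|1 - s| = 1 - s by rewrite ger0_norm// subr_ge0 ltW.
    rewrite h in h1 h2; have s3 : 0 <= s by lra.
    have p := pos s s3 s1.
    apply: he => //=; rewrite sub0r normrN gtr0_norm//.
    have : (1 - s) * (1 + s) <= (1 - s) * 2 by rewrite ler_wpM2l; lra.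
    rewrite -subr_sqr expr1n; lra.
by rewrite /F expr1n subrr powR0 ?gt_eqF// mulr0 sub0r mulNr opprK mulrC.
Qed.
End explicit_integrals.

(** * The layer cake formula *)

Section cavalieri.
Variable R : realType.
Local Notation leb := (@lebesgue_measure R).

Section layer_cake.
Context d (T : measurableType d) (mu : {sigma_finite_measure set T -> \bar R}).
Variables (w : T -> \bar R) (g : T -> R).
Hypotheses (mw : measurable_fun setT w) (mg : measurable_fun setT g).
Hypotheses (w0 : forall z, (0 <= w z)%E) (g0 : forall z, 0 <= g z).

Definition tail (r : R) : \bar R := (\int[mu]_z (w z * ((r < g z)%R%:R)%:E))%E.

Lemma tail_ge0 r : (0 <= tail r)%E.
Proof. by apply: integral_ge0 => z _; rewrite mule_ge0// lee_fin. Qed.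

Let A : set (T * R) := [set y | y.2 < g y.1].
Let AE z r : ((r < g z)%R%:R = \1_A (z, r) :> R).
Proof. by rewrite indicE; congr (nat_of_bool _)%:R; apply/idP/idP; rewrite inE. Qed.

Let mA : measurable A.
Proof.
have mlt : measurable_fun setT (fun y : T * R => y.2 < g y.1).
  apply: measurable_fun_ltr; first exact: measurable_snd.
  exact: (measurableT_comp mg measurable_fst).
have -> : A = (fun y : T * R => y.2 < g y.1) @^-1` [set true] by apply/seteqP; split.
by rewrite -[X in measurable X]setTI; exact: mlt.
Qed.

Let mwA : measurable_fun setT (fun y : T * R => w y.1 * (\1_A y)%:E)%E.
Proof.
apply: emeasurable_funM; first exact: (measurableT_comp mw measurable_fst).
by apply/measurable_EFinP; exact: measurable_indic.
Qed.

Lemma measurable_tail : measurable_fun setT tail.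
Proof.
have -> : tail = (fun r => \int[mu]_z (w (z, r).1 * (\1_A (z, r))%:E))%E.
  by apply/funext => r; apply: eq_integral => z _; rewrite AE.
apply: (@measurable_fun_fubini_tonelli_G _ _ _ _ _ mu _ mwA) => y.
by rewrite mule_ge0// lee_fin.
Qed.

(** The p-th power of [g z] is the integral of p r^(p - 1) over 0 < r < g z, and Tonelli exchanges
    the integrals. The separate weight [w] lets the formula cover weighted area as well as length on
    a circle. *)
Lemma layer_cake (p : R) : 0 < p ->
  (\int[mu]_z (w z * (g z `^ p)%:E) = \int[leb]_(r in `]0%R, +oo[) ((p * r `^ (p - 1))%:E * tail r))%E.
Proof.
move=> p0; pose k (r : R) := p * r `^ (p - 1).
have k0 r : 0 <= k r by rewrite mulr_ge0 ?powR_ge0// ltW.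
have mk : measurable_fun setT k by apply: measurable_funM => //; exact: measurable_powR.
pose I : set R := `]0, +oo[%classic.
have mI1 : measurable_fun setT (\1_I : R -> R) by apply: measurable_indic; exact: measurable_itv.
pose H (y : T * R) := ((\1_I y.2)%:E * (k y.2)%:E * (w y.1 * (\1_A y)%:E))%E.
have H0 y : (0 <= H y)%E by rewrite !mule_ge0// lee_fin.
have mH : measurable_fun setT H.
  apply: emeasurable_funM => //; apply: emeasurable_funM; apply/measurable_EFinP.
    exact: (measurableT_comp mI1 measurable_snd).
  exact: (measurableT_comp mk measurable_snd).
transitivity (\int[leb]_r \int[mu]_z H (z, r))%E; last first.
  rewrite [RHS]integral_mkcond; apply: eq_integral => r _; rewrite /patch /H /=.
  have mr : measurable_fun setT (fun z => w z * (\1_A (z, r))%:E)%E.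
    exact: (@measurable_fun_pair1 _ _ _ _ _ _ (fun y : T * R => w y.1 * (\1_A y)%:E)%E r).
  rewrite ge0_integralZl//; last 2 first.
  - by move=> z _; rewrite mule_ge0// lee_fin.
  - by rewrite mule_ge0// lee_fin.
  rewrite indicE; case: ifP => _; rewrite ?mul1e ?mul0e//.
  by congr (_ * _)%E; apply: eq_integral => z _; rewrite AE.
rewrite -(@fubini_tonelli _ _ _ _ _ mu leb _ mH H0); apply: eq_integral => z _.
transitivity (\int[leb]_r (w z * ((\1_I r * k r * \1_A (z, r))%:E)))%E; last first.
  by apply: eq_integral => r _; rewrite /H /= muleCA -!EFinM.
rewrite ge0_integralZl//; last 2 first.
- apply/measurable_EFinP; apply: measurable_funM.
    exact: measurable_funM.
  exact: (@measurable_fun_pair2 _ _ _ _ _ _ (\1_A : T * R -> R) z (measurable_indic mA)).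
- move=> r _; rewrite lee_fin; apply: mulr_ge0; last by rewrite indicE ler0n.
  by apply: mulr_ge0 => //; rewrite indicE ler0n.
congr (_ * _)%E.
have [gz|gz] := eqVneq (g z) 0.
  rewrite gz powR0 ?gt_eqF// integral0_eq// => r _.
  rewrite -AE gz indicE; case: (boolP (r \in I)) => [|_]; last by rewrite mul0r mul0r.
  by rewrite inE /I /= in_itv/= andbT => /ltW; rewrite leNgt => /negbTE ->; rewrite mulr0.
have gz0 : 0 < g z by rewrite lt_neqAle eq_sym gz g0.
have key (r : R) : ((\1_I r * k r * \1_A (z, r))%:E = ((fun r => (k r)%:E) \_ `]0%R, g z[) r)%E.
  have -> : \1_I r = (0 < r)%R%:R :> R.
    by rewrite indicE; congr (nat_of_bool _)%:R; apply/idP/idP; rewrite inE /I /= in_itv/= andbT.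
  have -> : (((fun r => (k r)%:E) \_ `]0%R, g z[) r = if ((0 < r) && (r < g z))%R then (k r)%:E else 0)%E.
    by rewrite /patch mem_setE in_itv.
  rewrite -AE; case: (0 < r) => /=; last by rewrite !mul0r.
  by case: (r < g z); rewrite mul1r ?mulr1 ?mulr0.
rewrite -(integral_powR p0 gz0); apply/esym; rewrite [RHS]integral_mkcond; apply: eq_integral => r _.
exact: key.
Qed.
End layer_cake.
End cavalieri.

(** * Tail integrals and moments at infinity *)

Section moments.
Variable R : realType.
Local Notation leb := (@lebesgue_measure R).

Section transfer.
Variables (p r0 : R) (Y : R -> R).
Hypotheses (p0 : 0 < p) (r00 : 0 < r0) (mY : measurable_fun setT Y) (Y0 : forall r, 0 <= Y r).

Let mpow : measurable_fun setT (fun r : R => (r `^ (p - 1))%:E).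
Proof. by apply/measurable_EFinP; exact: measurable_powR. Qed.

Definition moment : \bar R := (\int[leb]_(r in `]r0, +oo[) (r `^ (p - 1) * Y r)%:E)%E.

Let Q := ((fun r : R => (r `^ (p - 1) * Y r)%:E) \_ `]r0, +oo[)%E.
Let QE r : Q r = if r0 < r then (r `^ (p - 1) * Y r)%:E else 0%E.
Proof. by rewrite /Q /patch mem_setE in_itv/= andbT. Qed.
Let Q0 r : (0 <= Q r)%E.
Proof. by rewrite QE; case: ifP => // _; rewrite lee_fin mulr_ge0// powR_ge0. Qed.
Let mQ : measurable_fun setT Q.
Proof.
apply/(measurable_restrictT _ (measurable_itv _)); apply: measurable_funTS.
by apply/measurable_EFinP; apply: measurable_funM => //; exact: measurable_powR.
Qed.
Let momentE : moment = (\int[leb]_r Q r)%E. Proof. exact: integral_mkcond. Qed.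

Variable G : R -> \bar R.
Hypotheses (mG : measurable_fun setT G) (G0 : forall r, (0 <= G r)%E).

Let H := ((fun r : R => (r `^ (p - 1))%:E * G r) \_ `]0%R, +oo[)%E.
Let HE (r : R) : H r = if 0 < r then ((r `^ (p - 1))%:E * G r)%E else 0%E.
Proof. by rewrite /H /patch mem_setE in_itv/= andbT. Qed.
Let H0 (r : R) : (0 <= H r)%E.
Proof. by rewrite HE; case: ifP => // _; rewrite mule_ge0// lee_fin powR_ge0. Qed.
Let mH : measurable_fun setT H.
Proof.
apply/(measurable_restrictT _ (measurable_itv _)); apply: measurable_funTS.
exact: emeasurable_funM.
Qed.

Lemma moment_upper (M c : R) : 0 <= M -> 0 <= c ->
  (forall r : R, 0 < r -> (G r <= M%:E)%E) ->
  (forall r, r0 < r -> (G (2 * r)%R <= (c * Y r)%:E)%E) ->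
  (\int[leb]_(r in `]0%R, +oo[) ((r `^ (p - 1))%:E * G r) <=
   (M / p * (3 * r0) `^ p)%:E + (c * 2 `^ p)%:E * moment)%E.
Proof.
move=> M0 c0 GM Gc.
(* The cut is at [3 * r0] rather than [2 * r0]: for [r >= 3 * r0] the half of [r] is strictly above
   [r0], as the hypothesis [Gc] requires. *)
pose P1 := ((fun r : R => (p * r `^ (p - 1))%:E) \_ `]0%R, (3 * r0)%R[)%E.
have P1E (r : R) : P1 r = if (0 < r) && (r < 3 * r0) then (p * r `^ (p - 1))%:E else 0%E.
  by rewrite /P1 /patch mem_setE in_itv/=.
have P10 (r : R) : (0 <= P1 r)%E.
  by rewrite P1E; case: ifP => // _; rewrite lee_fin mulr_ge0 ?powR_ge0// ltW.
have mP1 : measurable_fun setT P1.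
  apply/(measurable_restrictT _ (measurable_itv _)); apply: measurable_funTS.
  by apply/measurable_EFinP; apply: measurable_funM => //; exact: measurable_powR.
have Mp : 0 <= M / p by rewrite divr_ge0// ltW.
have c2 : 0 <= c * 2 `^ (p - 1) by rewrite mulr_ge0// powR_ge0.
have mQ2 : measurable_fun setT (fun r : R => Q (2^-1 * r)%R).
  by apply: (measurableT_comp mQ); exact: mulrl_measurable.
pose B1 (r : R) := ((M / p)%:E * P1 r)%E; pose B2 (r : R) := ((c * 2 `^ (p - 1))%:E * Q (2^-1 * r)%R)%E.
have B10 r : (0 <= B1 r)%E by rewrite /B1 mule_ge0// lee_fin.
have B20 r : (0 <= B2 r)%E by rewrite /B2 mule_ge0// lee_fin.
have mB1 : measurable_fun setT B1 by exact: emeasurable_funM.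
have mB2 : measurable_fun setT B2 by exact: emeasurable_funM.
have half (r : R) : (H r <= B1 r + B2 r)%E.
  rewrite HE; case: ifPn => [r_gt0|_]; last by rewrite adde_ge0.
  have [r3|r3] := ltP r (3 * r0).
    rewrite -[leLHS]adde0 leeD// /B1 P1E r_gt0 r3 /= -EFinM mulrA divfK ?gt_eqF//.
    by rewrite EFinM muleC lee_wpmul2r ?lee_fin ?powR_ge0// GM.
  rewrite -[leLHS]add0e leeD//.
  have r2 : r0 < 2^-1 * r by lra.
  rewrite /B2 QE r2 -EFinM.
  have -> : c * 2 `^ (p - 1) * ((2^-1 * r) `^ (p - 1) * Y (2^-1 * r)) = r `^ (p - 1) * (c * Y (2^-1 * r)).
    have -> : r `^ (p - 1) = 2 `^ (p - 1) * (2^-1 * r) `^ (p - 1).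
      by rewrite -powRM ?mulVKf//; lra.
    ring.
  rewrite EFinM lee_wpmul2l ?lee_fin ?powR_ge0//.
  by have := Gc _ r2; rewrite mulVKf.
rewrite integral_mkcond (@le_trans _ _ (\int[leb]_r (B1 r + B2 r))%E)//.
  by apply: ge0_le_integral => //; exact: emeasurable_funD.
rewrite ge0_integralD// /B1 /B2 ge0_integralZl// ge0_integralZl//.
have -> : (\int[leb]_x P1 x = ((3 * r0) `^ p)%:E)%E.
  by rewrite -integral_mkcond integral_powR// mulr_gt0.
rewrite -EFinM leeD2l// momentE.
have -> : (\int[leb]_x Q x = (2^-1)%:E * \int[leb]_x Q (2^-1 * x)%R)%E.
  by rewrite (@integral_scale _ 2^-1 Q _ mQ Q0) ?invr_eq0// gtr0_norm.
rewrite muleA -EFinM lee_wpmul2r//; first by apply: integral_ge0.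
have -> : 2 `^ (p - 1) = 2 `^ p / 2 :> R by rewrite powRB ?powRr1// pnatr_eq0 implybT.
by rewrite lee_fin mulrA.
Qed.

(** The substitution of [k * r] for [r]; the part of the integral at levels up to [k * r0] is
    discarded. *)
Lemma moment_lower c k : 0 < c -> 0 < k ->
  (forall r, r0 < r -> ((c * Y r)%:E <= G (k * r)%R)%E) ->
  (moment <= (c^-1 * k `^ (- p))%:E * \int[leb]_(r in `]0%R, +oo[) ((r `^ (p - 1))%:E * G r))%E.
Proof.
move=> c0 k0 cG; have ck : 0 <= c^-1 * k `^ (1 - p) by rewrite mulr_ge0 ?powR_ge0// invr_ge0 ltW.
pose B (r : R) := ((c^-1 * k `^ (1 - p))%:E * H (k * r)%R)%E.
have mHk : measurable_fun setT (fun r : R => H (k * r)%R).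
  by apply: (measurableT_comp mH); exact: mulrl_measurable.
have mB : measurable_fun setT B by exact: emeasurable_funM.
have half (r : R) : (Q r <= B r)%E.
  rewrite QE; case: ifPn => [rr|_]; last by rewrite /B mule_ge0// lee_fin.
  have r_gt0 : 0 < r by exact: lt_trans rr.
  rewrite /B HE mulr_gt0// muleA -EFinM.
  have -> : c^-1 * k `^ (1 - p) * (k * r) `^ (p - 1) = r `^ (p - 1) / c.
    rewrite powRM ?(ltW k0) ?(ltW r_gt0)// -(opprB p 1) powRN mulrA -[X in X * _]mulrA mulVf ?mulr1 1?mulrC//.
    by rewrite gt_eqF// powR_gt0.
  have -> : r `^ (p - 1) * Y r = r `^ (p - 1) / c * (c * Y r) by rewrite mulrA divfK// gt_eqF.
  rewrite EFinM lee_wpmul2l//; last exact: cG.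
  by rewrite lee_fin mulr_ge0 ?powR_ge0// invr_ge0 ltW.
rewrite momentE (@le_trans _ _ (\int[leb]_r B r)%E)//; first exact: ge0_le_integral.
rewrite /B ge0_integralZl//.
have -> : (\int[leb]_(r in `]0%R, +oo[) ((r `^ (p - 1))%:E * G r) = \int[leb]_r H r)%E.
  exact: integral_mkcond.
rewrite (integral_scale (lt0r_neq0 k0) mH H0) gtr0_norm// muleA -EFinM.
have -> : k `^ (1 - p) = k * k `^ (- p) by rewrite powRD ?powRr1 ?(ltW k0)// (lt0r_neq0 k0) implybT.
by rewrite -mulrA [k * _]mulrC.
Qed.
End transfer.
End moments.

(** * Depth of the superlevel sets *)

Section superlevel_depth.
Variable R : realType.
Local Notation N := (@Normc.normc R).
Local Notation C := R[i].

(** The supremum of -ln |z| over the superlevel set, capped at 1. Adjoining 0 gives an empty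
    superlevel set depth 0, and comparing with [expR (- x)] avoids the logarithm at the origin. The
    cap is not felt at levels that bound |f| on |z| <= 1/e. *)
Definition depth (f : C -> C) (r : R) : R := sup [set x | 0 <= x <= 1 /\
  (x = 0 \/ exists z, [/\ N z <= expR (- x), N z < 1 & r < N (f z)])].

Section depth.
Variable f : C -> C.
Let S r : set R := [set x | 0 <= x <= 1 /\
  (x = 0 \/ exists z, [/\ N z <= expR (- x), N z < 1 & r < N (f z)])].
Let S0 r : S r 0. Proof. by split; [rewrite lexx ler01|left]. Qed.
Let hS r : has_sup (S r).
Proof. by split; [exists 0; exact: S0|exists 1 => x [/andP[]]]. Qed.

Lemma depth_ge0 r : 0 <= depth f r.
Proof. exact: (ub_le_sup (proj2 (hS r)) (S0 r)). Qed.

Lemma depth_le1 r : depth f r <= 1.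
Proof. by apply: ge_sup; [exists 0; exact: S0|move=> x [/andP[]]]. Qed.

Lemma depth_noninc r r' : r <= r' -> depth f r' <= depth f r.
Proof.
move=> rr; apply: ge_sup; first by exists 0; exact: S0.
move=> x [x01 [->|[z [z1 z2 z3]]]]; first exact: depth_ge0.
apply: (ub_le_sup (proj2 (hS r))); split=> //; right; exists z; split=> //.
exact: le_lt_trans z3.
Qed.

Lemma depth_outside r z : (forall z, N z <= expR (- 1) -> N (f z) <= r) ->
  N z < 1 -> r < N (f z) -> expR (- depth f r) <= N z.
Proof.
move=> hr z1 fz; have ze : expR (- 1) < N z.
  by rewrite ltNge; apply/negP => /hr; rewrite leNgt fz.
have z0 : 0 < N z by apply: lt_trans ze; exact: expR_gt0.
rewrite -[leRHS]lnK ?posrE// ler_expR lerNl.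
apply: (ub_le_sup (proj2 (hS r))); split.
  rewrite oppr_ge0 ln_le0 ?(ltW z1)//= lerNl -(expRK (- 1)) ler_ln ?posrE ?expR_gt0//.
  exact: ltW.
by right; exists z; split=> //; rewrite opprK lnK.
Qed.

(** The supremum need not be attained, but some point is deeper than half of it. *)
Lemma depth_witness r : (forall z, N z <= expR (- 1) -> N (f z) <= r) -> 0 < depth f r ->
  exists z, [/\ 0 < N z, N z < 1, - 1 <= ln (N z), depth f r / 2 < - ln (N z) & r < N (f z)].
Proof.
move=> hr d0; have [x [/andP[x0 x1] [->|[z [zx z1 fz]]] hx]] := sup_adherent (divr_gt0 d0 (ltr0n R 2)) (hS r).
  by move: hx d0; rewrite -/(depth f r); lra.
have ze : expR (- 1) < N z.
  by rewrite ltNge; apply/negP => /hr; rewrite leNgt fz.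
have z0 : 0 < N z by apply: lt_trans ze; exact: expR_gt0.
exists z; split=> //.
  by rewrite -(expRK (- 1)) ler_ln ?posrE ?expR_gt0// ltW.
have : ln (N z) <= - x by rewrite -[leRHS]expRK ler_ln ?posrE ?expR_gt0.
by move: hx; rewrite -/(depth f r); lra.
Qed.
End depth.

(** Angles cover a half-circle only and the opposite half is reached by a sign, to match the form of
    [integral_polar]. *)
Lemma polar_angle (z : C) : 0 < N z -> exists t, [/\ - (pi / 2) <= t, t <= pi / 2 &
  z = circ (N z) t \/ z = - circ (N z) t].
Proof.
case: z => x y; set s := N _ => s0.
have sE : x ^+ 2 + y ^+ 2 = s ^+ 2 by rewrite /s /= sqr_sqrtr// addr_ge0// sqr_ge0.
clearbody s.
have key (u v : R) : 0 <= u -> u ^+ 2 + v ^+ 2 = s ^+ 2 ->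
    exists t, [/\ - (pi / 2) <= t, t <= pi / 2 & u +i* v = circ s t].
  move=> u0 E; have vs : -1 <= v / s <= 1.
    rewrite -ler_norml normrM normfV (gtr0_norm s0) ler_pdivrMr// mul1r.
    rewrite -(gtr0_norm s0) -ler_sqr ?nnegrE// !real_normK ?num_real//.
    by rewrite -E lerDr sqr_ge0.
  exists (asin (v / s)); rewrite asin_geNpi2// asin_lepi2//; split=> //.
  rewrite /circ asinK ?in_itv//= [s * (v / s)]mulrC divfK ?gt_eqF//.
  rewrite cos_asin//; congr (_ +i* _); apply/eqP.
  have c0 : 0 <= 1 - (v / s) ^+ 2 by rewrite subr_ge0 -real_normK ?num_real// expr_le1// ler_norml.
  rewrite -(@eqrXn2 _ 2)// ?mulr_ge0 ?sqrtr_ge0 ?(ltW s0)//.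
  rewrite exprMn sqr_sqrtr//; apply/eqP.
  have -> : s ^+ 2 * (1 - (v / s) ^+ 2) = s ^+ 2 - v ^+ 2 by field; rewrite gt_eqF.
  by rewrite -E addrK.
have [x0|x0] := leP 0 x.
  by have [t [h1 h2 h3]] := key x y x0 sE; exists t; split=> //; left.
have nx0 : 0 <= - x by lra.
have nE : (- x) ^+ 2 + (- y) ^+ 2 = s ^+ 2 by rewrite !sqrrN.
have [t [h1 h2 h3]] := key (- x) (- y) nx0 nE.
exists t; split=> //; right; rewrite -h3.
by apply/eqP; rewrite eq_complex /= !opprK !eqxx.
Qed.

Lemma N_circ (s t : R) : 0 <= s -> N (circ s t) = s.
Proof. exact: N_polar. Qed.

Lemma circDpi (s t : R) : circ s (t + pi) = - circ s t.
Proof. by rewrite /circ cosDpi sinDpi !mulrN; apply/eqP; rewrite eq_complex /= !eqxx. Qed.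

Lemma conformal_rotation (f : C -> C) (u : C) : conformal_disk f -> N u = 1 ->
  conformal_disk (fun z => f (u * z)).
Proof.
move=> [df injf] u1; have u0 : u != 0 by apply/eqP => uE; move: u1; rewrite uE N0; lra.
have inD z : unit_disk R z -> unit_disk R (u * z).
  move=> z1; have : N (u * z) < 1 by rewrite NM u1 mul1r; exact: z1.
  exact.
split=> [z /inD uz|z w].
  have [l hl] := cdiff_cderiv (df _ uz).
  apply: cderiv_cdiff (cderiv_comp (m := u) _ hl) => e e0; exists 1 => // w _.
  by rewrite -mulrBr subrr N0 mulr_ge0 ?N_ge0 ?(ltW e0).
rewrite !inE => /inD zD /inD wD E; apply: (mulfI u0); apply: injf; rewrite ?inE//.
Qed.

(** The disk of radius 1/e lies in the square of half-side 1/2, a compact subset of the unit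
    disk. *)
Lemma bounded_near_zero (f : C -> C) : conformal_disk f -> exists2 r0, 0 < r0 &
  forall z, N z <= expR (- 1) -> N (f z) <= r0.
Proof.
move=> [df _]; have e2 : expR (- 1) <= 1 / 2 :> R.
  by rewrite expRN div1r lef_pV2 ?posrE ?expR_gt0//; have := @expR_ge1Dx R 1; lra.
have sq2 (x : R) : - (1 / 2) <= x <= 1 / 2 -> x ^+ 2 <= 1 / 4.
  move=> /andP[x1 x2]; have : 0 <= (1 / 2 - x) * (1 / 2 + x) by rewrite mulr_ge0; lra.
  lra.
have cf : ctsr f (- (1 / 2)) (1 / 2) (- (1 / 2)) (1 / 2).
  move=> [x y] [/sq2 hx /sq2 hy]; apply: cdiff_ccont; apply: df.
  rewrite /unit_disk /= -(@sqrtr1 R) ltr_sqrt//; move: hx hy => /=; lra.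
have [||M hM] := rect_max _ _ cf; [lra|lra|].
exists (Num.max M 1); first by rewrite lt_max ltr01 orbT.
move=> z z1; rewrite le_max hM// /rect -!ler_norml.
by split; [apply: le_trans (N_Re z) _|apply: le_trans (N_Im z) _]; lra.
Qed.

Lemma circ_cont (f : C -> C) (s : R) : conformal_disk f -> 0 <= s < 1 ->
  continuous (fun t => N (f (circ s t))).
Proof.
move=> [df _] /andP[s0 s1] t.
have cD : unit_disk R (circ s t) by have : N (circ s t) < 1 by rewrite N_circ.
apply/cvgrPdist_le => e e0; have [d d0 hd] := cdiff_ccont (df _ cD) e0.
have h1 : s * cos u @[u --> t] --> s * cos t by apply: cvgMl_tmp; exact: continuous_cos.
have h2 : s * sin u @[u --> t] --> s * sin t by apply: cvgMl_tmp; exact: continuous_sin.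
have d2 : 0 < d / 2 by rewrite divr_gt0.
near=> u.
have u1 : `|s * cos t - s * cos u| < d / 2 by near: u; move/cvgrPdist_lt : h1; exact.
have u2 : `|s * sin t - s * sin u| < d / 2 by near: u; move/cvgrPdist_lt : h2; exact.
have fu : N (f (circ s u) - f (circ s t)) <= e.
  apply/ltW/hd; apply: le_lt_trans (N_dist _ _ _ _) _.
  by rewrite distrC [X in _ + X]distrC; lra.
have := NBr (f (circ s u)) (f (circ s t)); have := NBr (f (circ s t)) (f (circ s u)).
rewrite [N (f (circ s t) - _)]NC ler_norml => h3 h4; apply/andP; split; lra.
Unshelve. all: by end_near. Qed.

Lemma measurable_circ (f : C -> C) (s : R) : conformal_disk f -> 0 <= s < 1 ->
  measurable_fun setT (fun t : R => N (f (circ s t))).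
Proof. by move=> cf s01; apply: continuous_measurable_fun; exact: circ_cont. Qed.

Lemma measurable_arc (f : C -> C) (s r : R) (J : set R) : conformal_disk f -> 0 <= s < 1 ->
  measurable J -> measurable [set t | J t /\ r < N (f (circ s t))].
Proof.
move=> cf s01 mJ; have mlt := measurable_fun_ltr (measurable_cst r) (measurable_circ cf s01).
have h : measurable ((fun t : R => r < N (f (circ s t))) @^-1` [set true]).
  by rewrite -[X in measurable X]setTI; exact: mlt.
exact: (measurableI _ _ mJ h).
Qed.
End superlevel_depth.

(** * Arcs of circles inside the superlevel sets *)

Section arcs.
Variable R : realType.
Local Notation N := (@Normc.normc R).
Local Notation C := R[i].
Local Notation leb := (@lebesgue_measure R).

Lemma arc_empty (f : C -> C) u r s t : N u = 1 -> (forall z, N z <= expR (- 1) -> N (f z) <= r) ->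
  0 <= s < 1 -> s < expR (- depth f r) -> N (f (u * circ s t)) <= r.
Proof.
move=> u1 hr /andP[s0 s1] sd; rewrite leNgt; apply/negP => fz.
have zE : N (u * circ s t) = s by rewrite NM u1 mul1r N_circ.
have := depth_outside hr _ fz; rewrite zE => /(_ s1).
by rewrite leNgt sd.
Qed.

(** Below the radius exp (- depth) the arc is empty. Otherwise [circle_upper] starts from the circle
    of radius exp (- 2 depth), on which |f| <= r, and as [ln s < 0] the logarithmic width is at most
    twice the depth. *)
Lemma arc_upper : exists2 K : R, 0 < K & forall (f : C -> C) u r s w0 (J : set R), conformal_disk f ->
  N u = 1 -> 0 < r -> (forall z, N z <= expR (- 1) -> N (f z) <= r) -> 0 < s < 1 -> measurable J ->
  (forall t, J t -> w0 <= t <= w0 + 2 * pi) ->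
  (leb [set t | J t /\ (2 * r < N (f (u * circ s t)))%R] <= (K * depth f r)%:E)%E.
Proof.
have [k k0 H] : exists2 k : R, 0 < k & forall (f : C -> C) r s1 s2 w0, conformal_disk f -> 0 < r -> 0 < s1 -> s1 < s2 -> s2 < 1 ->
  (forall t, w0 <= t <= w0 + 2 * pi -> N (f (circ s1 t)) <= r) ->
  exists B : set R, [/\ measurable B, (leb B <= (k * (ln s2 - ln s1))%:E)%E &
    forall t, w0 <= t <= w0 + 2 * pi -> 2 * r <= N (f (circ s2 t)) -> B t].
  by exists (16 * 4610); [rewrite mulr_gt0 ?ltr0n|exact: circle_upper].
exists (2 * k); first by rewrite mulr_gt0.
move=> f u r s w0 J cf u1 r0 hr /andP[s0 s1] mJ Jw; have d0 := depth_ge0 f r.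
have cg := conformal_rotation cf u1.
have s01 : 0 <= s < 1 by rewrite (ltW s0).
have mA := @measurable_arc _ _ s (2 * r) _ cg s01 mJ.
have [sd|sd] := ltP s (expR (- depth f r)).
  rewrite (_ : mkset _ = set0).
    by rewrite measure0 lee_fin !mulr_ge0// ltW.
  apply/seteqP; split=> // t [_]; have := @arc_empty f u r s t u1 hr s01 sd; lra.
have dp : 0 < depth f r.
  have : expR (- depth f r) < expR 0 by rewrite expR0 (le_lt_trans sd).
  by rewrite ltr_expR; lra.
have s10 : 0 < expR (- (2 * depth f r)) by exact: expR_gt0.
have s12 : expR (- (2 * depth f r)) < expR (- depth f r) by rewrite ltr_expR; lra.
have [|B [mB lB hB]] := H (fun z => f (u * z)) r _ s w0 cg r0 s10 (lt_le_trans s12 sd) s1.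
  by move=> t _; apply: arc_empty => //; rewrite (ltW s10)/= (lt_trans s12)// (le_lt_trans sd).
apply: (@le_trans _ _ (leb B)).
  apply: le_measure; rewrite ?inE//.
  by move=> t [Jt ht]; apply: hB; [exact: Jw|exact: ltW].
apply: le_trans lB _; rewrite lee_fin expRK.
have : ln s < 0 by rewrite ln_lt0// s0.
by move=> ls; rewrite [2 * k]mulrC -mulrA ler_pM2l//; lra.
Qed.

Lemma arc_lower : exists2 c : R, 0 < c & forall (f : C -> C) u r s s0 t0 a b (J : set R), conformal_disk f ->
  N u = 1 -> 0 < r -> 0 < s0 -> s0 < 1 -> - 1 <= ln s0 -> r < N (f (u * circ s0 t0)) ->
  0 < s < 1 -> ln s0 / 2 <= ln s -> measurable J -> (forall t, a < t < b -> J t) ->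
  1 <= b - a -> a <= t0 <= b ->
  ((- ln s0 / 8)%:E <= leb [set t | J t /\ (c * r < N (f (u * circ s t)))%R])%E.
Proof.
have [c c0 H] := @circle_lower R; exists c => // f u r s s0 t0 a b J cf u1 r0 s00 s01 ls0 fz /andP[sp s1] ls mJ Jab ab /andP[at0 t0b].
have cg := conformal_rotation cf u1.
have sp1 : 0 <= s < 1 by rewrite (ltW sp).
have mA := @measurable_arc _ _ s (c * r) _ cg sp1 mJ.
have [B [mB lB hB]] := H (fun z => f (u * z)) r s0 t0 s cg r0 s00 s01 ls0 sp s1 ls (ltW fz).
have l0 : ln s0 < 0 by rewrite ln_lt0// s00.
(* An interval of length [- ln s0 / 4] inside both [[a, b]] and the window around [t0]. It lies on
   one side of [t0], which may be an end point of [[a, b]]. Removing [B] leaves 1/4 - 1/32 of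
   [- ln s0], more than 1/8. *)
have [v [v1 v2 v3 v4]] : exists v, [/\ a <= v, v - ln s0 / 4 <= b, t0 + ln s0 / 4 <= v & v - ln s0 / 4 <= t0 - ln s0 / 4].
  have [h|h] := leP (t0 - ln s0 / 4) b.
    by exists t0; split=> //; lra.
  by exists (t0 + ln s0 / 4); split; lra.
set A := mkset _.
have sub : `]v, (v - ln s0 / 4)%R[ `<=` A `|` B.
  move=> t /=; rewrite in_itv/= => /andP[t1 t2].
  have [Bt|nB] := pselect (B t); [by right|left; split; first by apply: Jab; lra].
  by apply: hB => //; lra.
have mI : measurable (`]v, (v - ln s0 / 4)%R[%classic : set R) by exact: measurable_itv.
have lI : (leb `]v, (v - ln s0 / 4)%R[ = (- ln s0 / 4)%:E)%E.
  apply: etrans (lebesgue_measure_itv _) _ => /=; rewrite lte_fin ifT; last by lra.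
  by rewrite -EFinB; congr (_%:E); ring.
have le1 : (leb `]v, (v - ln s0 / 4)%R[ <= leb A + leb B)%E.
  apply: le_trans (measureU2 _ _ _) => //.
  by apply: le_measure; rewrite ?inE//; exact: measurableU.
rewrite lI in le1.
have := le_trans le1 (leeD2l _ lB); case: (leb A) => [x| |] //; rewrite -?EFinD ?lee_fin ?leey//; lra.
Qed.
End arcs.

(** * Weighted areas of the superlevel sets *)

Section disk.
Variable R : realType.
Local Notation N := (@Normc.normc R).
Local Notation C := R[i].

(** An open set of the plane is the countable union of the rational boxes that it contains, and
    boxes are measurable for the product sigma-algebra. *)
Lemma open_rectangle_measurable (A : set (R * R)) :
  (forall z, A z -> exists2 e, 0 < e & forall z' : R * R, `|z'.1 - z.1| < e -> `|z'.2 - z.2| < e -> A z') ->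
  measurable A.
Proof.
move=> hA; pose box (q : (rat * rat) * (rat * rat)) : set (R * R) :=
  (`](ratr q.1.1 : R), (ratr q.1.2 : R)[ : set R) `*` (`](ratr q.2.1 : R), (ratr q.2.2 : R)[ : set R).
have mbox q : measurable (box q) by apply: measurableX; exact: measurable_itv.
pose F q := if `[<box q `<=` A>] then box q else set0.
have -> : A = \bigcup_q F q.
  apply/seteqP; split=> [z Az|z [q _]]; last by rewrite /F; case: asboolP => // h; exact: h.
  have [e e0 he] := hA z Az.
  have rin (x : R) : exists q : rat * rat, [/\ x - e < ratr q.1, ratr q.1 < x, x < ratr q.2 & ratr q.2 < x + e].
    have [|a /[!in_itv]/= /andP[a1 a2]] := @rat_in_itvoo R (x - e) x; first by rewrite ltrBlDr ltrDl.
    have [|b /[!in_itv]/= /andP[b1 b2]] := @rat_in_itvoo R x (x + e); first by rewrite ltrDl.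
    by exists (a, b).
  have [q1 [h1 h2 h3 h4]] := rin z.1; have [q2 [h5 h6 h7 h8]] := rin z.2.
  exists (q1, q2) => //; rewrite /F asboolT.
    by rewrite /box /=; split; rewrite /= in_itv/=; apply/andP.
  move=> z' []; rewrite /= !in_itv/= => /andP[k1 k2] /andP[k3 k4].
  by apply: he; rewrite ltr_norml; apply/andP; split; lra.
apply: countable_bigcupT_measurable; first exact: countableP.
by move=> q; rewrite /F; case: asboolP => // _; exact: mbox.
Qed.

(** With the extension by 0, the superlevel sets at levels [r >= 0] are exactly those of [f] in the
    disk. *)
Definition disk_part (f : C -> C) (z : R * R) : R :=
  if N (to_complex z) < 1 then N (f (to_complex z)) else 0.

Definition disk_weight (al : R) (z : R * R) : \bar R :=
  if N (to_complex z) < 1 then ((1 - N (to_complex z) ^+ 2) `^ al)%:E else 0%E.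

Lemma disk_part_ge0 f z : 0 <= disk_part f z.
Proof. by rewrite /disk_part; case: ifP => // _; exact: N_ge0. Qed.

Lemma disk_weight_ge0 al z : (0 <= disk_weight al z)%E.
Proof. by rewrite /disk_weight; case: ifP => // _; rewrite lee_fin powR_ge0. Qed.

Lemma measurable_modulus : measurable_fun setT (fun z : R * R => N (to_complex z)).
Proof.
have -> : (fun z : R * R => N (to_complex z)) = (fun z => Num.sqrt (z.1 ^+ 2 + z.2 ^+ 2)).
  by apply/funext => -[x y].
have ms : measurable_fun setT (@Num.sqrt R) by apply: continuous_measurable_fun; exact: sqrt_continuous.
apply: (measurableT_comp ms); apply: measurable_funD.
  exact: measurable_funX measurable_fst.
exact: measurable_funX measurable_snd.
Qed.

Lemma measurable_disk_weight al : measurable_fun setT (disk_weight al).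
Proof.
apply: measurable_fun_ifT; last exact: measurable_cst.
  by apply: measurable_fun_ltr; [exact: measurable_modulus|exact: measurable_cst].
apply/measurable_EFinP; apply: (measurableT_comp (measurable_powR _)).
apply: measurable_funB; first exact: measurable_cst.
exact: measurable_funX measurable_modulus.
Qed.

Lemma measurable_disk_part (f : C -> C) : conformal_disk f -> measurable_fun setT (disk_part f).
Proof.
move=> [df _]; apply: (measurability _ (RGenOInfty.measurableE R)) => _ [_ [r ->] <-].
rewrite setTI.
have [r0|r0] := ltP r 0.
  rewrite (_ : _ @^-1` _ = setT)//; apply/seteqP; split=> // z _ /=.
  by rewrite in_itv/= andbT (lt_le_trans r0)// disk_part_ge0.
apply: open_rectangle_measurable => z; rewrite /= in_itv/= andbT /disk_part.
case: ifPn => z1 rz; last by move: (le_lt_trans r0 rz); rewrite ltxx.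
have e1 : 0 < N (f (to_complex z)) - r by rewrite subr_gt0.
have [t t0 ht] := cdiff_ccont (df _ z1) e1.
have e2 : 0 < 1 - N (to_complex z) by rewrite subr_gt0.
exists (Num.min (t / 2) ((1 - N (to_complex z)) / 2)); first by rewrite lt_min !divr_gt0.
move=> z'; rewrite !lt_min => /andP[h1 h2] /andP[h3 h4].
have hd : N (to_complex z' - to_complex z) <= `|z'.1 - z.1| + `|z'.2 - z.2| by exact: N_dist.
have z'1 : N (to_complex z') < 1.
  by have := NBr (to_complex z') (to_complex z); lra.
rewrite in_itv/= andbT z'1.
have := ht (to_complex z') _; have hlt : N (to_complex z' - to_complex z) < t by lra.
move=> /(_ hlt); have := NBr (f (to_complex z)) (f (to_complex z')); rewrite NC; lra.
Qed.
End disk.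

Section disk_tails.
Variable R : realType.
Local Notation N := (@Normc.normc R).
Local Notation C := R[i].
Local Notation Re := (@complex.Re R).
Local Notation Im := (@complex.Im R).
Local Notation leb := (@lebesgue_measure R).

(** The product measure under a name of its own, to which the sigma-finite structure used by the
    layer cake formula is attached. *)
Definition plane : set (measurableTypeR R * measurableTypeR R) -> \bar R := (leb \x leb)%E.

HB.instance Definition _ := Measure.on plane.

Let plane_sigma_finite : sigma_finite setT plane.
Proof.
have /sigma_finiteP[F [TF ndF Foo]] := sigma_finiteT leb.
exists (fun n => F n `*` F n).
  rewrite -setXTT TF predeqE => -[x y]; split.
    move=> [/= [n _ Fnx] [k _ Fky]]; exists (maxn n k) => //; split.
    - by move: x Fnx; exact/subsetPset/ndF/leq_maxl.
    - by move: y Fky; exact/subsetPset/ndF/leq_maxr.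
  by move=> [n _ []/= ? ?]; split; exists n.
move=> k; have [mF finF] := Foo k; split; first exact: measurableX.
rewrite /plane product_measure1E// lte_mul_pinfty//.
by rewrite ge0_fin_numE.
Qed.

HB.instance Definition _ := Measure_isSigmaFinite.Build _ _ _ plane plane_sigma_finite.

Let I : set R := `](- (pi / 2)), (pi / 2)[%classic.

(** The values [u = 1] and [u = - 1] give the two half-circles that occur in [integral_polar]. *)
Definition half_arc (f : C -> C) (u : C) (r s : R) : set R := [set t | I t /\ r < N (f (u * circ s t))].

Definition disk_tail (f : C -> C) (al r : R) : \bar R :=
  @tail R _ (measurableTypeR R * measurableTypeR R)%type plane (disk_weight al) (disk_part f) r.

Section polar.
Variables (f : C -> C) (al : R).
Hypothesis cf : conformal_disk f.

Let h r (z : R * R) : \bar R := (disk_weight al z * ((r < disk_part f z)%R%:R)%:E)%E.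
Let h0 r z : (0 <= h r z)%E. Proof. by rewrite mule_ge0// ?disk_weight_ge0// lee_fin. Qed.
Let mh r : measurable_fun setT (h r).
Proof.
apply: emeasurable_funM; first exact: measurable_disk_weight.
apply/measurable_EFinP.
have mlt := measurable_fun_ltr (measurable_cst r) (measurable_disk_part cf).
have -> : (fun z : R * R => (r < disk_part f z)%R%:R : R) = \1_([set z | r < disk_part f z]).
  by apply/funext => z; rewrite indicE; congr (nat_of_bool _)%:R; apply/idP/idP; rewrite inE.
apply: measurable_indic.
have -> : [set z | r < disk_part f z] = (fun z : R * R => r < disk_part f z) @^-1` [set true] by apply/seteqP; split.
by rewrite -[X in measurable X]setTI; exact: mlt.
Qed.

Lemma measurable_arcI u r s : N u = 1 -> 0 <= s < 1 -> measurable (half_arc f u r s).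
Proof.
move=> u1 s01; apply: (measurable_arc r (conformal_rotation cf u1) s01).
exact: measurable_itv.
Qed.

Let point (u : C) (s t : R) : R * R := (Re (u * circ s t), Im (u * circ s t)).

Let arc_integral (u : C) (r s : R) : N u = 1 -> 0 <= s < 1 ->
  (\int[leb]_(t in I) h r (point u s t) =
   ((1 - s ^+ 2) `^ al)%:E * leb (half_arc f u r s))%E.
Proof.
move=> u1 s01; have mA := measurable_arcI r u1 s01; have /andP[s0 s1] := s01.
have E t : to_complex (point u s t) = u * circ s t by rewrite /point; case: (u * circ s t).
have zE t : N (u * circ s t) = s by rewrite NM u1 mul1r N_circ.
pose A1 : R -> R := \1_(half_arc f u r s).
transitivity (\int[leb]_(t in I) (((1 - s ^+ 2) `^ al)%:E * (A1 t)%:E))%E.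
  apply: eq_integral => t; rewrite inE => It.
  rewrite /h /disk_weight /disk_part E zE s1 /A1 indicE; congr (_ * (nat_of_bool _)%:R%:E)%E.
  by apply/idP/idP; rewrite inE; [split|case].
have mI : measurable I by exact: measurable_itv.
have mA1 : measurable_fun setT A1 by exact: measurable_indic.
have m1 : measurable_fun (I : set R) (fun t : R => (A1 t)%:E).
  by apply/measurable_EFinP; exact: measurable_funTS.
have n1 t : I t -> (0%:E <= (A1 t)%:E)%E by rewrite lee_fin /A1 indicE ler0n.
rewrite (ge0_integralZl leb mI m1 n1) ?lee_fin ?powR_ge0//.
by rewrite integral_indic//; congr (_ * leb _)%E; apply/seteqP; split => [t []|t [It ht]].
Qed.

Let pointE1 s t : point 1 s t = (s * cos t, s * sin t).
Proof. by rewrite /point mul1r. Qed.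
Let pointE2 s t : point (- 1) s t = (- (s * cos t), - (s * sin t)).
Proof. by rewrite /point mulN1r. Qed.

Let mpoint u r s : measurable_fun setT (fun t => h r (point u s t)).
Proof.
apply: (measurableT_comp (mh r)); apply/measurable_fun_pairP; split.
  have -> : fst \o point u s = (fun t => Re u * (s * cos t) - Im u * (s * sin t)).
    by apply/funext => t; rewrite /point /=; case: u.
  apply: continuous_measurable_fun => t.
  apply: cvgB; apply: cvgMl_tmp; apply: cvgMl_tmp; [exact: continuous_cos|exact: continuous_sin].
have -> : snd \o point u s = (fun t => Re u * (s * sin t) + Im u * (s * cos t)).
  by apply/funext => t; rewrite /point /=; case: u.
apply: continuous_measurable_fun => t.
apply: cvgD; apply: cvgMl_tmp; apply: cvgMl_tmp; [exact: continuous_sin|exact: continuous_cos].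
Qed.

Let inner r s : 0 <= s < 1 ->
  (\int[leb]_(t in I) (h r (s * cos t, s * sin t)%R + h r (- (s * cos t), - (s * sin t))%R) =
   ((1 - s ^+ 2) `^ al)%:E * (leb (half_arc f 1%R r s) + leb (half_arc f (- 1)%R r s)))%E.
Proof.
move=> s01; have N11 : N (- 1) = 1 by rewrite NN N1.
rewrite ge0_muleDr// -(arc_integral r (N1 R) s01) -(arc_integral r N11 s01).
have mI : measurable I by exact: measurable_itv.
have n0 u t : I t -> (0 <= h r (point u s t))%E by move=> _; exact: h0.
have m0 u : measurable_fun I (fun t => h r (point u s t)) by exact: measurable_funTS.
rewrite -(ge0_integralD leb mI (n0 _) (m0 _) (n0 _) (m0 _)).
by apply: eq_integral => t _; rewrite pointE1 pointE2.
Qed.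

Let outer r s : 1 <= s ->
  (\int[leb]_(t in I) (h r (s * cos t, s * sin t)%R + h r (- (s * cos t), - (s * sin t))%R) = 0)%E.
Proof.
move=> s1; have s0 : 0 <= s by lra.
have hz z : 1 <= N (to_complex z) -> h r z = 0%E.
  by move=> z1; rewrite /h /disk_weight ltNge z1 mul0e.
rewrite integral0_eq// => t _; rewrite !hz ?adde0//.
  have -> : to_complex (- (s * cos t), - (s * sin t)) = - circ s t by [].
  by rewrite NN N_circ.
have -> : to_complex (s * cos t, s * sin t) = circ s t by [].
by rewrite N_circ.
Qed.

Lemma disk_tail_polar (r : R) : (disk_tail f al r =
  \int[leb]_(s in `]0%R, 1%R[) ((s * (1 - s ^+ 2) `^ al)%:E * (leb (half_arc f 1%R r s) + leb (half_arc f (- 1)%R r s))))%E.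
Proof.
transitivity (\int[(leb \x leb)%E]_z h r z)%E; first by [].
rewrite (integral_polar (mh r) (h0 r)).
rewrite integral_mkcond [RHS]integral_mkcond; apply: eq_integral => s _.
rewrite /patch !mem_setE !in_itv/= andbT.
have [s0|s0] //= := ltP 0 s; have [s1|s1] := ltP s 1; last by rewrite outer// mule0.
by rewrite inner ?(ltW s0)// EFinM muleA.
Qed.
End polar.
End disk_tails.

(** * Two-sided bounds for weighted areas *)

Section tail_bounds.
Variable R : realType.
Local Notation N := (@Normc.normc R).
Local Notation leb := (@lebesgue_measure R).

(** The integral of a nonnegative function is a supremum over the simple functions below it, hence
    monotone for arbitrary functions. This spares the measurability of arc lengths as functions of
    the radius. *)
Lemma integral_mono d (T : measurableType d) (mu : {measure set T -> \bar R}) (D : set T) (F G : T -> \bar R) :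
  (forall x, D x -> 0 <= F x)%E -> (forall x, D x -> F x <= G x)%E ->
  (\int[mu]_(x in D) F x <= \int[mu]_(x in D) G x)%E.
Proof.
move=> F0 FG; rewrite !(integral_mkcond D).
have h (x : T) : (0 <= (F \_ D) x <= (G \_ D) x)%E.
  by rewrite /patch; case: ifPn => [/set_mem Dx|_]; rewrite ?lexx// (F0 _ Dx) (FG _ Dx).
have hF x : (0 <= (F \_ D) x)%E by have /andP[] := h x.
have hG x : (0 <= (G \_ D) x)%E by have /andP[h1 h2] := h x; exact: le_trans h2.
rewrite !ge0_integralTE//.
apply: le_ereal_sup => _ [g hg <-]; exists g => // x; apply: le_trans (hg x) _.
by have /andP[] := h x.
Qed.

Let q (al s : R) := s * (1 - s ^+ 2) `^ al.

Let q0 al s : 0 < s -> 0 <= q al s.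
Proof. by move=> s0; rewrite mulr_ge0 ?powR_ge0// ltW. Qed.

Let mq al : measurable_fun setT (q al).
Proof.
apply: measurable_funM => //; apply: (measurableT_comp (measurable_powR _)).
by apply: measurable_funB => //; exact: measurable_funX.
Qed.

Let integral_q al s0 k : -1 < al -> 0 <= s0 < 1 -> 0 <= k ->
  (\int[leb]_(s in `]s0, 1%R[) ((q al s)%:E * k%:E) = ((1 - s0 ^+ 2) `^ (al + 1) / (2 * (al + 1)) * k)%:E)%E.
Proof.
move=> al1 s01 k0; have /andP[s00 _] := s01.
have mI : measurable (`]s0, 1%R[%classic : set R) by exact: measurable_itv.
have m1 : measurable_fun (`]s0, 1%R[%classic : set R) (fun s : R => (q al s)%:E).
  by apply/measurable_EFinP; exact: measurable_funTS.
have n1 (s : R) : `]s0, 1%R[%classic s -> (0%:E <= (q al s)%:E)%E.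
  by rewrite /= in_itv/= => /andP[s1 _]; rewrite lee_fin q0// (le_lt_trans s00).
rewrite (ge0_integralZr leb mI m1 n1)// EFinM; congr (_ * _)%E.
exact: integral_weight.
Qed.

(** Only radii at least exp (- d) contribute, and their arcs have length at most a multiple of the
    depth d. Integrating the weight over the larger range above [s1] = exp (- 2 d) gives a multiple
    of (1 - s1^2)^(al + 1), which is at most (4 d)^(al + 1). *)
Lemma disk_tail_upper al : -1 < al -> exists2 c : R, 0 < c & forall f r, conformal_disk f -> 0 < r ->
  (forall z, N z <= expR (- 1) -> N (f z) <= r) ->
  (disk_tail f al (2 * r)%R <= (c * depth f r `^ (al + 2))%:E)%E.
Proof.
move=> al1; have [K K0 hK] := arc_upper R; have b0 : 0 < al + 1 by lra.
exists (4 `^ (al + 1) / (2 * (al + 1)) * (2 * K)).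
  by rewrite !mulr_gt0 ?powR_gt0 ?invr_gt0 ?mulr_gt0.
move=> f r cf r0 hr; set d := depth f r; have d0 : 0 <= d := depth_ge0 f r.
have N11 : N (- 1) = 1 by rewrite NN N1.
have w0 (t : R) : (`](- (pi / 2)), (pi / 2)[%classic : set R) t -> - (pi / 2) <= t <= - (pi / 2) + 2 * pi.
  by rewrite /= in_itv/= => /andP[t1 t2]; have := @pi_gt0 R; lra.
have up u s : N u = 1 -> 0 < s < 1 -> (leb (half_arc f u (2 * r) s) <= (K * d)%:E)%E.
  by move=> u1 s01; apply: (hK f u r s _ _ cf u1 r0 hr s01 _ w0); exact: measurable_itv.
have em u s : N u = 1 -> 0 < s < 1 -> s < expR (- d) -> leb (half_arc f u (2 * r) s) = 0%E.
  move=> u1 /andP[s0 s1] sd; rewrite (_ : half_arc _ _ _ _ = set0) ?measure0//.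
  have s01 : 0 <= s < 1 by rewrite (ltW s0).
  by apply/seteqP; split=> // t [_]; have := @arc_empty _ f u r s t u1 hr s01 sd; lra.
pose l s := (leb (half_arc f 1%R (2 * r)%R s) + leb (half_arc f (- 1)%R (2 * r)%R s))%E.
have l0 s : (0 <= l s)%E by rewrite adde_ge0.
have lup s : 0 < s < 1 -> (l s <= (2 * (K * d))%:E)%E.
  move=> s01; rewrite mulrDl mul1r EFinD; apply: leeD; apply: up => //; exact: N1.
have lem s : 0 < s < 1 -> s < expR (- d) -> (l s = 0)%E.
  by move=> s01 sd; rewrite /l !em ?adde0//; exact: N1.
have -> : (disk_tail f al (2 * r)%R = \int[leb]_(s in `]0%R, 1%R[) ((q al s)%:E * l s))%E.
  exact: disk_tail_polar.
have [d_eq0|d_neq0] := eqVneq d 0.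
  rewrite integral0_eq.
    by rewrite lee_fin mulr_ge0 ?powR_ge0// !mulr_ge0 ?powR_ge0 ?invr_ge0 ?mulr_ge0 ?(ltW K0) ?(ltW b0).
  move=> s /=; rewrite in_itv/= => s01; suff -> : l s = 0%E by rewrite mule0.
  apply/eqP; rewrite eq_le l0 andbT; have := lup s s01.
  by rewrite d_eq0 !mulr0.
have dp : 0 < d by rewrite lt_neqAle eq_sym d_neq0.
pose s1 := expR (- (2 * d)).
have s10 : 0 < s1 by exact: expR_gt0.
have s1d : s1 < expR (- d) by rewrite ltr_expR; lra.
have s11 : s1 < 1 by rewrite -expR0 ltr_expR; lra.
apply: (@le_trans _ _ (\int[leb]_(s in `]s1, 1%R[) ((q al s)%:E * (2 * (K * d))%:E))%E).
  rewrite integral_mkcond [leRHS]integral_mkcond; apply: integral_mono => s _.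
    apply: erestrict_ge0 => x /=; rewrite in_itv/= => /andP[x0 _].
    by rewrite mule_ge0// lee_fin q0.
  rewrite /patch !mem_setE !in_itv/=.
  have [s_gt0|s_le0] := ltP 0 s; last by rewrite (le_gtF (le_trans s_le0 (ltW s10))).
  have [s_lt1|_] := ltP s 1; last by rewrite /= andbF lexx.
  have s01 : 0 < s < 1 by rewrite s_gt0.
  have [h|h] := ltP s1 s => /=; first by rewrite lee_wpmul2l ?lup// lee_fin q0.
  by rewrite lem// ?mule0// (le_lt_trans h).
rewrite integral_q//; last 2 first.
- by rewrite (ltW s10).
- by rewrite !mulr_ge0// ltW.
rewrite lee_fin.
have e1 : 1 - s1 ^+ 2 <= 4 * d.
  by rewrite /s1 -expRM_natl; have := @expR_ge1Dx R (2%:R * - (2 * d)); lra.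
have e0 : 0 <= 1 - s1 ^+ 2 by rewrite subr_ge0 expr_le1// ltW.
have e2 : (1 - s1 ^+ 2) `^ (al + 1) <= 4 `^ (al + 1) * d `^ (al + 1).
  by rewrite -powRM// ge0_ler_powR ?nnegrE ?mulr_ge0// ltW.
have -> : d `^ (al + 2) = d `^ (al + 1) * d.
  rewrite mulrC; have h2 : 0 < al + 2 by lra.
  by rewrite -(mulr_powRB1 d0 h2); congr (_ * _ `^ _); lra.
rewrite (_ : 4 `^ (al + 1) / (2 * (al + 1)) * (2 * K) * (d `^ (al + 1) * d) = 4 `^ (al + 1) * d `^ (al + 1) / (2 * (al + 1)) * (2 * (K * d))); last by ring.
by rewrite !ler_wpM2r ?invr_ge0 ?mulr_ge0// ltW.
Qed.

(** A witness [z] has -ln |z| > d / 2, so every circle with -ln s < d / 4 is at most half as deep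
    and by [arc_lower] carries an arc of length at least d / 16. The weight integrated over these
    circles is at least of order d^(al + 1), since 1 - exp (- d / 2) >= d / 4 for d <= 1. *)
Lemma disk_tail_lower al : -1 < al -> exists k c : R, [/\ 0 < k, 0 < c & forall f r, conformal_disk f -> 0 < r ->
  (forall z, N z <= expR (- 1) -> N (f z) <= r) ->
  ((c * depth f r `^ (al + 2))%:E <= disk_tail f al (k * r)%R)%E].
Proof.
move=> al1; have [k k0 hk] := arc_lower R; have b0 : 0 < al + 1 by lra.
exists k, (4^-1 `^ (al + 1) / (2 * (al + 1)) * 16^-1); split=> //.
  by rewrite !mulr_gt0 ?powR_gt0 ?invr_gt0 ?mulr_gt0 ?invr_gt0.
move=> f r cf r0 hr; set d := depth f r; have d0 : 0 <= d := depth_ge0 f r.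
have d1 : d <= 1 := depth_le1 f r.
have h2 : 0 < al + 2 by lra.
have [d_eq0|d_neq0] := eqVneq d 0.
  by rewrite d_eq0 powR0 ?gt_eqF// mulr0 tail_ge0// => z; exact: disk_weight_ge0.
have dp : 0 < d by rewrite lt_neqAle eq_sym d_neq0.
have [z [z0 z1 lz zd fz]] := depth_witness hr dp.
have [t0 [t1 t2 zt]] := polar_angle z0.
have [u [u1 u11 zE]] : exists u, [/\ N u = 1, u = 1 \/ u = - 1 & z = u * circ (N z) t0].
  case: zt => zt; first by exists 1; rewrite mul1r N1; split=> //; left.
  by exists (- 1); rewrite mulN1r NN N1; split=> //; right.
pose l s := (leb (half_arc f 1%R (k * r)%R s) + leb (half_arc f (- 1)%R (k * r)%R s))%E.
have l0 s : (0 <= l s)%E by rewrite adde_ge0.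
pose s1 := expR (- (d / 4)).
have s10 : 0 < s1 by exact: expR_gt0.
have s11 : s1 < 1 by rewrite -expR0 ltr_expR; lra.
have low s : s1 < s < 1 -> ((d / 16)%:E <= l s)%E.
  move=> /andP[h1 h3]; have sp : 0 < s by exact: lt_trans h1.
  have s01 : 0 < s < 1 by rewrite sp.
  have ls : - (d / 4) < ln s by rewrite -(expRK (- (d / 4))) ltr_ln ?posrE.
  have lsz : ln (N z) / 2 <= ln s by move: zd; rewrite -/d; lra.
  have fz' : r < N (f (u * circ (N z) t0)) by rewrite -zE.
  have tw : - (pi / 2) <= t0 <= pi / 2 by rewrite t1.
  have pi1 : 1 <= pi / 2 - - (pi / 2) :> R by have := @pi_ge2 R; lra.
  have mI : measurable (`](- (pi / 2)), (pi / 2)[%classic : set R) by exact: measurable_itv.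
  have subI (t : R) : - (pi / 2) < t < pi / 2 -> (`](- (pi / 2)), (pi / 2)[%classic : set R) t.
    by rewrite /= in_itv.
  have hl := hk f u r s (N z) t0 _ _ _ cf u1 r0 z0 z1 lz fz' s01 lsz mI subI pi1 tw.
  apply: (@le_trans _ _ (leb (half_arc f u (k * r) s))).
    by apply: le_trans hl; rewrite lee_fin; move: zd; rewrite -/d; lra.
  by case: u11 => ->; [exact: leeDl|exact: leeDr].
have -> : (disk_tail f al (k * r)%R = \int[leb]_(s in `]0%R, 1%R[) ((q al s)%:E * l s))%E.
  exact: disk_tail_polar.
apply: (@le_trans _ _ (\int[leb]_(s in `]s1, 1%R[) ((q al s)%:E * (d / 16)%:E))%E); last first.
  rewrite integral_mkcond [leRHS]integral_mkcond; apply: integral_mono => s _.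
    apply: erestrict_ge0 => x /=; rewrite in_itv/= => /andP[x0 _].
    by rewrite mule_ge0// lee_fin ?q0 ?(lt_trans s10)// divr_ge0.
  rewrite /patch !mem_setE !in_itv/=.
  have [s_gt1|_] /= := ltP s1 s; last first.
    by case: ifP => // /andP[s_gt0 _]; rewrite mule_ge0// lee_fin q0.
  rewrite (lt_trans s10 s_gt1)/=; case: ifP => // s_lt1.
  by rewrite lee_wpmul2l ?low ?s_gt1// lee_fin q0// (lt_trans s10).
rewrite integral_q//; last 2 first.
- by rewrite (ltW s10).
- by rewrite divr_ge0.
rewrite lee_fin.
have e1 : 4^-1 * d <= 1 - s1 ^+ 2.
  have -> : s1 ^+ 2 = (expR (d / 2))^-1.
    by rewrite -expRN /s1 -expRM_natl; congr expR; lra.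
  have e3 : 1 + d / 2 <= expR (d / 2) by exact: expR_ge1Dx.
  have e4 : (expR (d / 2))^-1 <= (1 + d / 2)^-1 by rewrite lef_pV2 ?posrE ?expR_gt0//; lra.
  have e5 : (1 + d / 2)^-1 <= 1 - 4^-1 * d.
    rewrite -[leLHS]mul1r ler_pdivrMr; last by lra.
    have : 0 <= d * (1 - d) by rewrite mulr_ge0//; lra.
    by lra.
  by lra.
have e2 : 4^-1 `^ (al + 1) * d `^ (al + 1) <= (1 - s1 ^+ 2) `^ (al + 1).
  have d40 : 0 <= 4^-1 * d by lra.
  have d41 := le_trans d40 e1.
  rewrite -powRM ?invr_ge0//; apply: ge0_ler_powR; rewrite ?nnegrE//.
  exact: ltW.
rewrite -(mulr_powRB1 d0 h2).
have -> : al + 2 - 1 = al + 1 by ring.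
rewrite (_ : 4^-1 `^ (al + 1) / (2 * (al + 1)) * 16^-1 * (d * d `^ (al + 1)) = 4^-1 `^ (al + 1) * d `^ (al + 1) / (2 * (al + 1)) * (d / 16)); last by ring.
by rewrite !ler_wpM2r ?invr_ge0 ?mulr_ge0 ?divr_ge0// ltW.
Qed.

Lemma disk_tail_bounded al : -1 < al -> exists2 M : R, 0 <= M & forall f r, conformal_disk f ->
  (disk_tail f al r <= M%:E)%E.
Proof.
move=> al1; exists ((1 - 0 ^+ 2) `^ (al + 1) / (2 * (al + 1)) * (2 * pi)).
  rewrite !mulr_ge0 ?powR_ge0 ?invr_ge0 ?mulr_ge0 ?pi_ge0//; lra.
move=> f r cf; rewrite disk_tail_polar//.
have z01 : 0 <= (0 : R) < 1 by rewrite lexx ltr01.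
have pi20 : 0 <= 2 * pi :> R by rewrite mulr_ge0// pi_ge0.
rewrite -(integral_q al1 z01 pi20).
have lI : leb (`](- (pi / 2)), (pi / 2)[%classic : set R) = pi%:E.
  apply: etrans (lebesgue_measure_itv _) _ => /=; have p0 := @pi_gt0 R.
  rewrite lte_fin ifT; last by lra.
  by rewrite -EFinB; congr (_%:E); lra.
have up u s : N u = 1 -> 0 < s < 1 -> (leb (half_arc f u r s) <= pi%:E)%E.
  move=> u1 /andP[s0 s1]; rewrite -lI; apply: le_measure; rewrite ?inE.
  - by apply: measurable_arcI => //; rewrite (ltW s0).
  - exact: measurable_itv.
  - by move=> t [].
apply: integral_mono => s /=; rewrite in_itv/= => s01; have /andP[s0 _] := s01.
  by rewrite mule_ge0 ?adde_ge0// lee_fin q0.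
rewrite lee_wpmul2l ?lee_fin ?q0// mulrDl mul1r EFinD.
by apply: leeD; apply: up => //; rewrite ?NN; exact: N1.
Qed.
End tail_bounds.

(** * The integrability criteria *)

Section criteria.
Variable R : realType.
Local Notation N := (@Normc.normc R).
Local Notation C := R[i].
Local Notation leb := (@lebesgue_measure R).

Lemma measurable_depth (f : C -> C) (b : R) : measurable_fun setT (fun r => depth f r `^ b).
Proof.
apply: (measurableT_comp (measurable_powR b)); apply: nonincreasing_measurable => // x y.
exact: depth_noninc.
Qed.

Section criterion.
Variables (f : C -> C) (p r0 b : R).
Hypotheses (p0 : 0 < p) (r00 : 0 < r0).

(** The common form of the Bergman and area cases, where [G] is a tail or a power of one. The Hardy
    case involves a family of such functions, one for each circle, and is treated apart. *)
Lemma moment_criterion (G : R -> \bar R) (M k c1 c2 : R) :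
  measurable_fun setT G -> (forall r, 0 <= G r)%E ->
  0 <= M -> (forall r, 0 < r -> (G r <= M%:E)%E) ->
  0 < c1 -> (forall r, r0 < r -> (G (2 * r)%R <= (c1 * depth f r `^ b)%:E)%E) ->
  0 < k -> 0 < c2 -> (forall r, r0 < r -> ((c2 * depth f r `^ b)%:E <= G (k * r)%R)%E) ->
  ((\int[leb]_(r in `]0%R, +oo[) ((r `^ (p - 1))%:E * G r) < +oo) <->
   (moment p r0 (fun r => depth f r `^ b)%R < +oo))%E.
Proof.
move=> mG G0 M0 GM c10 Gup k0 c20 Glow.
have mY := measurable_depth f b; have Y0 r : 0 <= depth f r `^ b by exact: powR_ge0.
split=> h.
  apply: le_lt_trans (moment_lower p r00 mY Y0 mG G0 c20 k0 Glow) _.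
  by apply: lte_mul_pinfty => //; rewrite lee_fin mulr_ge0 ?powR_ge0// invr_ge0 ltW.
apply: le_lt_trans (moment_upper p0 r00 mY Y0 mG G0 M0 (ltW c10) GM Gup) _.
rewrite lte_add_pinfty ?ltry//; apply: lte_mul_pinfty => //.
by rewrite lee_fin mulr_ge0 ?powR_ge0// ltW.
Qed.
End criterion.

Section bergman_and_area.
Variables (f : C -> C) (p r0 : R).
Hypotheses (p0 : 0 < p) (r00 : 0 < r0) (cf : conformal_disk f).
Hypothesis hr0 : forall z, N z <= expR (- 1) -> N (f z) <= r0.

Let hr r : r0 < r -> forall z, N z <= expR (- 1) -> N (f z) <= r.
Proof. by move=> r0r z /hr0 h; exact: le_trans (ltW r0r). Qed.

Let mtail a : measurable_fun setT (disk_tail f a).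
Proof.
exact: (@measurable_tail R _ (measurableTypeR R * measurableTypeR R)%type (@plane R) _ _ (measurable_disk_weight a) (measurable_disk_part cf) (disk_weight_ge0 a)).
Qed.

Let tail0 a r : (0 <= disk_tail f a r)%E.
Proof. by apply: tail_ge0 => z; exact: disk_weight_ge0. Qed.

Lemma bergman_criterion al : - 1 < al ->
  bergman p al f <-> (moment p r0 (fun r => depth f r `^ (al + 2))%R < +oo)%E.
Proof.
move=> al1; have [c1 c10 H1] := disk_tail_upper al1; have [k [c2 [k0 c20 H2]]] := disk_tail_lower al1.
have [M M0 HM] := disk_tail_bounded al1.
have key := @moment_criterion f p r0 (al + 2) p0 r00 (disk_tail f al) M k c1 c2 (mtail al) (tail0 al)
  M0 (fun r _ => HM f r cf) c10 (fun r h => H1 f r cf (lt_trans r00 h) (hr h))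
  k0 c20 (fun r h => H2 f r cf (lt_trans r00 h) (hr h)).
apply: iff_trans key.
have E : (\int[lebesgue2 R]_(w in @to_complex R @^-1` unit_disk R)
       (N (f (to_complex w)) `^ p * (1 - N (to_complex w) ^+ 2) `^ al)%:E =
   p%:E * \int[leb]_(r in `]0%R, +oo[) ((r `^ (p - 1))%:E * disk_tail f al r))%E.
  transitivity (\int[@plane R]_z (disk_weight al z * (disk_part f z `^ p)%:E))%E.
    rewrite integral_mkcond; apply: eq_integral => z _.
    rewrite /patch /disk_weight /disk_part.
    have -> : (z \in @to_complex R @^-1` unit_disk R) = (N (to_complex z) < 1).
      by apply/idP/idP; rewrite inE.
    by case: ifP => _; rewrite ?mul0e// -EFinM mulrC.
  rewrite (@layer_cake R _ (measurableTypeR R * measurableTypeR R)%type (@plane R) _ _ (measurable_disk_weight al) (measurable_disk_part cf) (disk_weight_ge0 al) (disk_part_ge0 f) _ p0).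
  have mI : measurable (`]0%R, +oo[%classic : set R) by exact: measurable_itv.
  have mG : measurable_fun (`]0%R, +oo[%classic : set R) (fun r => (r `^ (p - 1))%:E * disk_tail f al r)%E.
    apply: measurable_funTS; apply: emeasurable_funM => //.
    by apply/measurable_EFinP; exact: measurable_powR.
  have nG (r : R) : `]0%R, +oo[%classic r -> (0 <= (r `^ (p - 1))%:E * disk_tail f al r)%E.
    by move=> _; rewrite mule_ge0// lee_fin powR_ge0.
  rewrite -(ge0_integralZl leb mI mG nG) ?lee_fin ?(ltW p0)//.
  by apply: eq_integral => r _; rewrite EFinM muleA.
rewrite /bergman /= E; split=> [[_ h]|h].
  rewrite ltNge; apply/negP; rewrite leye_eq => /eqP hy; move: h.
  by rewrite hy gt0_muley ?lte_fin// ltxx.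
split; first by case: cf.
by apply: lte_mul_pinfty => //; rewrite lee_fin ltW.
Qed.
Lemma area_superlevel r : 0 <= r -> area (superlevel f r) = disk_tail f 0 r.
Proof.
move=> r1; pose A : set (measurableTypeR R * measurableTypeR R) := @to_complex R @^-1` superlevel f r.
have AE z : (A z <-> r < disk_part f z).
  rewrite /A /superlevel /disk_part /=; split=> [[z1 rz]|].
    have z1' : N (to_complex z) < 1 by [].
    by rewrite z1'.
  by case: ifPn => [//|_ h]; move: (le_lt_trans r1 h); rewrite ltxx.
have mA : measurable A.
  have mlt := measurable_fun_ltr (measurable_cst r) (measurable_disk_part cf).
  have -> : A = (fun z : R * R => r < disk_part f z) @^-1` [set true].
    by apply/seteqP; split=> z /=; rewrite AE.
  by rewrite -[X in measurable X]setTI; exact: mlt.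
transitivity (\int[@plane R]_z (\1_A z)%:E)%E.
  by rewrite integral_indic// setIT.
apply: eq_integral => z _; rewrite indicE /disk_weight.
have -> : (z \in A) = (r < disk_part f z) by apply/idP/idP; rewrite inE AE.
by rewrite /disk_part; case: ifPn => [_|_]; rewrite ?powRr0 ?mul1e// mul0e ltNge r1.
Qed.

(** Area is the tail for weight exponent 0, hence comparable to the square of the depth; the power
    [b / 2] turns this into the power [b] of the depth. *)
Lemma area_criterion b : 0 < b ->
  (\int[leb]_(r in `]0%R, +oo[) ((r `^ (p - 1))%:E * area (superlevel f r) `^ (b / 2)) < +oo)%E <->
  (moment p r0 (fun r => depth f r `^ b)%R < +oo)%E.
Proof.
move=> b0; have b2 : 0 < b / 2 by rewrite divr_gt0.
have al1 : - 1 < 0 :> R by rewrite oppr_lt0.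
have [c1 c10 H1] := disk_tail_upper al1; have [k [c2 [k0 c20 H2]]] := disk_tail_lower al1.
have [M M0 HM] := disk_tail_bounded al1.
pose G (r : R) := (disk_tail f 0 r `^ (b / 2))%E.
have mG : measurable_fun setT G by exact: (measurableT_comp (measurable_poweR (b / 2)) (mtail 0)).
have G0 r : (0 <= G r)%E by exact: poweR_ge0.
have mono (x y : \bar R) : (0 <= x)%E -> (x <= y)%E -> (x `^ (b / 2) <= y `^ (b / 2))%E.
  move=> x0 xy; apply: gt0_ler_poweR => //; first exact: ltW.
    by rewrite in_itv/= x0 leey.
  by rewrite in_itv/= (le_trans x0 xy) leey.
have powE c r : 0 < c -> ((c * depth f r `^ (0 + 2))%:E `^ (b / 2) = (c `^ (b / 2) * depth f r `^ b)%:E)%E.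
  move=> c0; rewrite poweR_EFin powRM ?powR_ge0 ?(ltW c0)// -powRrM.
  by congr (_ * _ `^ _)%:E; field.
have key := @moment_criterion f p r0 b p0 r00 G (M `^ (b / 2)) k (c1 `^ (b / 2)) (c2 `^ (b / 2)) mG G0.
rewrite -key; first last.
- move=> r rr; rewrite -powE//; apply: mono; first by rewrite lee_fin mulr_ge0 ?powR_ge0// ltW.
  by apply: H2 => //; [exact: lt_trans rr|exact: hr].
- exact: powR_gt0.
- exact: k0.
- move=> r rr; rewrite -powE//; apply: mono => //.
  by apply: H1 => //; [exact: lt_trans rr|exact: hr].
- exact: powR_gt0.
- by move=> r r1; rewrite /G -poweR_EFin; apply: mono => //; exact: HM.
- exact: powR_ge0.
suff -> : (\int[leb]_(r in `]0%R, +oo[) ((r `^ (p - 1))%:E * area (superlevel f r) `^ (b / 2)) =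
  \int[leb]_(r in `]0%R, +oo[) ((r `^ (p - 1))%:E * G r))%E by [].
by apply: eq_integral => r; rewrite inE /= in_itv/= andbT => r1; rewrite area_superlevel// ltW.
Qed.
End bergman_and_area.
End criteria.

(** * Hardy spaces *)

Section hardy_spaces.
Variable R : realType.
Local Notation N := (@Normc.normc R).
Local Notation C := R[i].
Local Notation leb := (@lebesgue_measure R).

Section hardy.
Variables (f : C -> C) (p r0 : R).
Hypotheses (p0 : 0 < p) (r00 : 0 < r0) (cf : conformal_disk f).
Hypothesis hr0 : forall z, N z <= expR (- 1) -> N (f z) <= r0.

Let J : set R := `[0, 2 * pi]%classic.
Let mJ : measurable J. Proof. exact: measurable_itv. Qed.

Let w (t : R) : \bar R := (\1_J t)%:E.
Let mw : measurable_fun setT w.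
Proof. by apply/measurable_EFinP; exact: measurable_indic. Qed.
Let w0 t : (0 <= w t)%E. Proof. by rewrite lee_fin. Qed.

Let g (s t : R) : R := N (f (circ s t)).
Let g0 s t : 0 <= g s t. Proof. exact: N_ge0. Qed.
Let mg s : 0 <= s < 1 -> measurable_fun setT (g s). Proof. exact: measurable_circ. Qed.

Let m (s r : R) : \bar R := @tail R _ (measurableTypeR R) leb w (g s) r.

Let m_ge0 s r : (0 <= m s r)%E. Proof. exact: tail_ge0. Qed.

Let mm s : 0 <= s < 1 -> measurable_fun setT (m s).
Proof. move=> s01; exact: (@measurable_tail R _ (measurableTypeR R) leb _ _ mw (mg s01) w0). Qed.

Let mE s r : 0 <= s < 1 -> m s r = leb [set t | J t /\ r < g s t].
Proof.
move=> s01; pose A : set R := [set t | J t /\ r < g s t].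
have mA : measurable A by exact: measurable_arc.
transitivity (\int[leb]_t (\1_A t)%:E)%E; last by rewrite integral_indic// setIT.
apply: eq_integral => t _; rewrite /w !indicE -EFinM -natrM mulnb.
congr (nat_of_bool _)%:R%:E; apply/idP/idP; rewrite !inE.
  by move=> /andP[/set_mem].
by move=> [Jt ht]; rewrite mem_set.
Qed.

Definition circle_mean (s : R) : \bar R := (\int[leb]_(t in J) (g s t `^ p)%:E)%E.

Let circle_meanE s : 0 <= s < 1 ->
  circle_mean s = (p%:E * \int[leb]_(r in `]0%R, +oo[) ((r `^ (p - 1))%:E * m s r))%E.
Proof.
move=> s01; transitivity (\int[leb]_t (w t * (g s t `^ p)%:E))%E.
  rewrite /circle_mean integral_mkcond; apply: eq_integral => t _.
  by rewrite /patch /w indicE; case: ifP => _; rewrite ?mul1e ?mul0e.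
rewrite (@layer_cake R _ (measurableTypeR R) leb _ _ mw (mg s01) w0 (g0 s) _ p0).
have mI : measurable (`]0%R, +oo[%classic : set R) by exact: measurable_itv.
have mG : measurable_fun (`]0%R, +oo[%classic : set R) (fun r => (r `^ (p - 1))%:E * m s r)%E.
  apply: measurable_funTS; apply: emeasurable_funM; last exact: mm.
  by apply/measurable_EFinP; exact: measurable_powR.
have nG (r : R) : `]0%R, +oo[%classic r -> (0 <= (r `^ (p - 1))%:E * m s r)%E.
  by move=> _; rewrite mule_ge0// lee_fin powR_ge0.
rewrite -(ge0_integralZl leb mI mG nG) ?lee_fin ?(ltW p0)//.
by apply: eq_integral => r _; rewrite EFinM muleA.
Qed.

Let hr r : r0 < r -> forall z, N z <= expR (- 1) -> N (f z) <= r.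
Proof. by move=> r0r z /hr0 h; exact: le_trans (ltW r0r). Qed.

Lemma circle_mean_bounded : (moment p r0 (depth f) < +oo)%E ->
  exists A : R, forall s, 0 < s < 1 -> (circle_mean s <= A%:E)%E.
Proof.
move=> hm; have [K K0 hK] := arc_upper R.
have pi20 : 0 <= 2 * pi :> R by rewrite mulr_ge0// pi_ge0.
pose B := ((2 * pi / p * (3 * r0) `^ p)%:E + (K * 2 `^ p)%:E * moment p r0 (depth f))%E.
have mom0 : (0 <= moment p r0 (depth f))%E.
  by apply: integral_ge0 => r _; rewrite lee_fin mulr_ge0 ?powR_ge0// depth_ge0.
have B0 : (0 <= B)%E.
  apply: adde_ge0; last by apply: mule_ge0 => //; rewrite lee_fin mulr_ge0 ?powR_ge0// ltW.
  by rewrite lee_fin mulr_ge0 ?powR_ge0// divr_ge0// ltW.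
have Bfin : B \is a fin_num.
  rewrite ge0_fin_numE// lte_add_pinfty ?ltry//; apply: lte_mul_pinfty => //.
  by rewrite lee_fin mulr_ge0 ?powR_ge0// ltW.
exists (p * fine B) => s /andP[s0 s1]; have s01 : 0 <= s < 1 by rewrite (ltW s0).
rewrite circle_meanE// EFinM fineK// lee_wpmul2l ?lee_fin ?(ltW p0)//.
have mY : measurable_fun setT (depth f).
  by apply: nonincreasing_measurable => // x y; exact: depth_noninc.
apply: (moment_upper p0 r00 mY (depth_ge0 f) (mm s01) (m_ge0 s) pi20 (ltW K0)).
  move=> r _; rewrite mE//.
  have lJ : leb J = (2 * pi)%:E.
    apply: etrans (lebesgue_measure_itv _) _ => /=; have pp := @pi_gt0 R.
    by rewrite lte_fin mulr_gt0// sube0.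
  rewrite -lJ; apply: le_measure; rewrite ?inE//; first exact: measurable_arc.
  by move=> t [].
move=> r rr; rewrite mE//; have s02 : 0 < s < 1 by rewrite s0.
have Jw (t : R) : J t -> 0 <= t <= 0 + 2 * pi by rewrite /J /= in_itv/= add0r.
have := hK f 1 r s 0 J cf (N1 R) (lt_trans r00 rr) (hr rr) s02 mJ Jw.
by rewrite /g; under eq_fun do rewrite mul1r.
Qed.

(** On a fixed circle the lower bound for arcs is available only at levels whose depth is large
    compared with [- ln s]. The truncated depths [Y n] keep just these levels; as the circles tend
    to the unit circle, monotone convergence recovers the full moment. *)
Lemma circle_mean_moment (A : R) : (forall s, 0 < s < 1 -> (circle_mean s <= A%:E)%E) ->
  (moment p r0 (depth f) < +oo)%E.
Proof.
move=> hA; have [k k0 hk] := arc_lower R.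
(* Where [Y n] is not cut off, a witness has -ln |z| > depth / 2 >= 2 / (n + 1), so the circle of
   radius [s n], with -ln (s n) = 1 / (n + 1), is at most half as deep, as [arc_lower] requires;
   hence the 4. *)
pose Y (n : nat) r : R := if 4 / n.+1%:R <= depth f r then depth f r else 0.
have Y0 n r : 0 <= Y n r by rewrite /Y; case: ifP => // _; exact: depth_ge0.
have mY n : measurable_fun setT (Y n).
  apply: nonincreasing_measurable => // x y xy; rewrite /Y.
  have h := depth_noninc f xy; case: ifPn => hx.
    by rewrite (le_trans hx h).
  by case: ifP => // _; exact: depth_ge0.
pose s n : R := expR (- n.+1%:R^-1).
have s01 n : 0 < s n < 1.
  by rewrite expR_gt0/= -expR0 ltr_expR oppr_lt0 invr_gt0 ltr0n.
have low n r : r0 < r -> ((16^-1 * Y n r)%:E <= m (s n) (k * r)%R)%E.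
  move=> rr; rewrite /Y; case: ifPn => [hn|_]; last by rewrite mulr0.
  have r_gt0 := lt_trans r00 rr.
  have n0 : 0 < 4 / n.+1%:R :> R by rewrite divr_gt0.
  have [z [z0 z1 lz zd fz]] := depth_witness (hr rr) (lt_le_trans n0 hn).
  have [t0 [t0w zt]] : exists t, 0 <= t <= 2 * pi /\ z = circ (N z) t.
    have pp := @pi_gt0 R.
    have [t [t1 t2 [zt|zt]]] := polar_angle z0; last first.
      by exists (t + pi); rewrite circDpi; split=> //; lra.
    have [tp|tn] := leP 0 t; first by exists t; split=> //; lra.
    exists (t + 2 * pi); split; first lra.
    have -> : t + 2 * pi = t + pi + pi by lra.
    by rewrite !circDpi opprK.
  have fz' : r < N (f (1 * circ (N z) t0)) by rewrite mul1r -zt.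
  have ls : ln (N z) / 2 <= ln (s n).
    by rewrite expRK; move: zd hn; move: (n.+1%:R^-1 : R) (depth f r) (ln (N z)) => i d l; lra.
  have Jab (t : R) : 0 < t < 2 * pi -> J t.
    by rewrite /J /= in_itv/= => /andP[h1 h2]; rewrite !ltW.
  have pi1 : 1 <= 2 * pi - 0 :> R by have := @pi_ge2 R; lra.
  have := hk f 1 r (s n) (N z) t0 0 (2 * pi) J cf (N1 R) r_gt0 z0 z1 lz fz' (s01 n) ls mJ Jab pi1 t0w.
  have /andP[sn0 sn1] := s01 n.
  rewrite mE ?(ltW sn0)// /g; under eq_fun do rewrite mul1r.
  by apply: le_trans; rewrite lee_fin; move: zd; lra.
have bnd_n n : (moment p r0 (Y n) <= (16^-1^-1 * k `^ (- p) * (p^-1 * A))%:E)%E.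
  have /andP[sn0 sn1] := s01 n; have sn : 0 <= s n < 1 by rewrite (ltW sn0).
  have c0 : 0 < 16^-1 :> R by rewrite invr_gt0.
  apply: le_trans (moment_lower p r00 (mY n) (Y0 n) (mm sn) (m_ge0 (s n)) c0 k0 (low n)) _.
  rewrite [leRHS]EFinM; apply: lee_wpmul2l; first by rewrite lee_fin mulr_ge0 ?powR_ge0.
  have := hA (s n) (s01 n); rewrite circle_meanE//; set I := (\int[_]_(_ in _) _)%E => hI.
  have -> : I = ((p^-1)%:E * (p%:E * I))%E by rewrite muleA -EFinM mulVf ?gt_eqF// mul1e.
  by rewrite EFinM lee_wpmul2l// lee_fin invr_ge0 ltW.
suff : (moment p r0 (depth f) <= (16^-1^-1 * k `^ (- p) * (p^-1 * A))%:E)%E.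
  by move/le_lt_trans; apply; exact: ltry.
pose D : set R := `]r0, +oo[%classic.
pose F n (r : R) := (r `^ (p - 1) * Y n r)%:E.
have mD : measurable D by exact: measurable_itv.
have mF n : measurable_fun D (F n).
  apply: measurable_funTS; apply/measurable_EFinP; apply: measurable_funM; last exact: mY.
  exact: measurable_powR.
have F0 n r : D r -> (0 <= F n r)%E by rewrite lee_fin mulr_ge0// powR_ge0.
have ndF r : D r -> {homo F ^~ r : a b / (a <= b)%N >-> (a <= b)%E}.
  move=> _ a b ab; rewrite lee_fin ler_wpM2l ?powR_ge0// /Y; case: ifPn => ha; last first.
    by case: ifP => // _; exact: depth_ge0.
  rewrite ifT// (le_trans _ ha)// ler_wpM2l// lef_pV2 ?posrE// ler_nat//.
have limF r : D r -> limn (F ^~ r) = (r `^ (p - 1) * depth f r)%:E.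
  move=> _; apply/cvg_lim => //; have [d_eq0|dn0] := eqVneq (depth f r) 0.
    have E n : F n r = (r `^ (p - 1) * depth f r)%:E by rewrite /F /Y d_eq0 if_same.
    by rewrite (_ : F ^~ r = fun=> (r `^ (p - 1) * depth f r)%:E); [exact: cvg_cst|apply/funext].
  have dp : 0 < depth f r by rewrite lt_neqAle eq_sym dn0 depth_ge0.
  apply: cvg_near_cst; near=> n; rewrite /F /Y ifT//.
  rewrite ler_pdivrMr// mulrC -ler_pdivrMr//.
  apply: le_trans (_ : n%:R <= _); last by rewrite ler_nat.
  by near: n; exact: nbhs_infty_ger.
have E : (moment p r0 (depth f) = limn (fun n => moment p r0 (Y n)))%E.
  rewrite /moment -(monotone_convergence leb mD mF F0 ndF).
  by apply: eq_integral => r; rewrite inE => Dr; rewrite limF.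
rewrite E; apply: lime_le; last exact: nearW.
apply: ereal_nondecreasing_is_cvgn => a b ab; apply: integral_mono => r Dr; first exact: F0.
exact: ndF.
Unshelve. all: by end_near. Qed.

Lemma hardy_criterion : hardy p f <-> (moment p r0 (depth f) < +oo)%E.
Proof.
rewrite /hardy /=; split=> [[_ hs]|h]; last first.
  split; first by case: cf.
  have [A hA] := circle_mean_bounded h.
  apply: (@le_lt_trans _ _ A%:E); last exact: ltry.
  apply: ge_ereal_sup => _ [s /= + <-]; rewrite in_itv/= => s01; exact: hA.
set S := ereal_sup _ in hs.
have hS s : 0 < s < 1 -> (circle_mean s <= S)%E.
  by move=> s01; apply: ereal_sup_ubound; exists s; first by rewrite /= in_itv.
(* A single circle suffices to see that the supremum is nonnegative; being finite as well, it is
   recovered from its real part [fine S]. *)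
have half01 : 0 < (2^-1 : R) < 1 by apply/andP; split; lra.
have S0 : (0 <= S)%E.
  by apply: le_trans (hS _ half01); apply: integral_ge0 => t _; rewrite lee_fin powR_ge0.
apply: (@circle_mean_moment (fine S)) => s s01; rewrite fineK ?hS//.
by rewrite ge0_fin_numE.
Qed.
End hardy.

End hardy_spaces.

Theorem theorem1p2 (R : realType) (p alpha : R) (f : R[i] -> R[i])
    (p_gt0 : 0 < p) (alpha_ge : -1 <= alpha) (f_conf : conformal_disk f) :
  bergman_hardy p alpha f <->
  (\int[lebesgue_measure]_(r in `]0%R, +oo[)
     ((r `^ (p - 1))%:E * area (superlevel f r) `^ ((alpha + 2) / 2)) < +oo)%E.
Proof.
have [r0 r00 hr0] := bounded_near_zero f_conf.
have b0 : 0 < alpha + 2 by lra.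
rewrite (area_criterion p_gt0 r00 f_conf hr0 b0) /bergman_hardy.
case: eqVneq => [->|alphaN1].
  rewrite (hardy_criterion p_gt0 r00 f_conf hr0).
  suff -> : (fun r => depth f r `^ (- 1 + 2)) = depth f by exact: iff_refl.
  by apply/funext => r; rewrite (_ : - 1 + 2 = 1) ?powRr1 ?depth_ge0//; lra.
by apply: bergman_criterion => //; rewrite lt_neqAle eq_sym alphaN1.
Qed.
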